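(* Let $n\ge 0$ be an integer. If $1<p\le\infty$, then the operator norm of the Berezin transform $B_{\mathcal{U}^n}$ on $L^p(\mathcal{U}^n)$ is $$\|B_{\mathcal{U}^n}\|_{p\to p}=\frac{\pi}{p\sin\frac{\pi}{p}}\prod_{k=1}^{n+1}\left(1+\frac{1}{kp}\right),$$ where, when $p=\infty$, the quantity on the right-hand side is interpreted as $1$.
   Context: Write points of $\mathbb{C}^{n+1}$ as $z=(z',z_{n+1})$ with $z'=(z_1,\dots,z_n)\in\mathbb{C}^n$, $z_{n+1}\in\mathbb{C}$, and $z'\cdot\overline{w'}=\sum_{j=1}^n z_j\overline{w_j}$. The Siegel upper half-space is $\mathcal{U}^n=\{z\in\mathbb{C}^{n+1}:\operatorname{Im}z_{n+1}>|z'|^2\}$ (so $\mathcal{U}^0$ is the upper half-plane). $dV$ is Lebesgue measure on $\mathbb{C}^{n+1}$, and $L^p(\mathcal{U}^n)$ is taken with respect to $dV$. Put $$\boldsymbol{\rho}(z,w):=\tfrac{i}{2}(\overline{w}_{n+1}-z_{n+1})-z'\cdot\overline{w'},$$ so that $\boldsymbol{\rho}(z,z)=\operatorname{Im}z_{n+1}-|z'|^2$. The Bergman kernel of $\mathcal{U}^n$ is $K_{\mathcal{U}^n}(z,w)=\frac{(n+1)!}{4\pi^{n+1}}\boldsymbol{\rho}(z,w)^{-n-2}$, and the Berezin transform is $$(B_{\mathcal{U}^n}f)(z):=\int_{\mathcal{U}^n}\frac{|K_{\mathcal{U}^n}(z,w)|^2}{K_{\mathcal{U}^n}(z,z)}f(w)\,dV(w)=\frac{(n+1)!}{4\pi^{n+1}}\int_{\mathcal{U}^n}\frac{\boldsymbol{\rho}(z,z)^{n+2}}{|\boldsymbol{\rho}(z,w)|^{2(n+2)}}f(w)\,dV(w).$$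 $\|\cdot\|_{p\to p}$ denotes the operator norm on $L^p(\mathcal{U}^n)$. *)

(* Defs.v *)
From HB Require Import structures.
From mathcomp Require Import all_boot all_order all_algebra.
From mathcomp Require Import all_classical all_reals all_analysis.
From mathcomp Require Import complex.

Set Implicit Arguments.
Unset Strict Implicit.
Unset Printing Implicit Defensive.

Import Order.TTheory GRing.Theory Num.Theory.
Import numFieldNormedType.Exports.

Local Open Scope classical_set_scope.
Local Open Scope ring_scope.
Local Open Scope complex_scope.

(* The sigma-finite structure that is inferred for m1 \x m2 requires both factors
   to be subprobabilities; [prodm] is m1 \x m2 with its general instance. *)
Section prodm.
Context d1 d2 (T1 : measurableType d1) (T2 : measurableType d2) (R : realType).
Variables (m1 : {sigma_finite_measure set T1 -> \bar R}).
Variables (m2 : {sigma_finite_measure set T2 -> \bar R}).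

Definition prodm : set (T1 * T2)%type -> \bar R := (m1 \x m2)%E.

HB.instance Definition _ := Measure.on prodm.

Let prodm_sigma_finite : sigma_finite setT prodm.
Proof.
have /sigma_finiteP[F [TF ndF Foo]] := sigma_finiteT m1.
have /sigma_finiteP[G [TG ndG Goo]] := sigma_finiteT m2.
exists (fun k => F k `*` G k).
  rewrite -setXTT TF TG predeqE => -[x y]; split.
    move=> [/= [k _ Fkx] [l _ Gly]]; exists (maxn k l) => //; split.
    - by move: x Fkx; exact/subsetPset/ndF/leq_maxl.
    - by move: y Gly; exact/subsetPset/ndG/leq_maxr.
  by move=> [k _ []/= ? ?]; split; exists k.
move=> k; have [? ?] := Foo k; have [? ?] := Goo k; split.
  exact: measurableX.
by rewrite /prodm product_measure1E// lte_mul_pinfty// ge0_fin_numE.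
Qed.

HB.instance Definition _ := Measure_isSigmaFinite.Build _ _ _ prodm
  prodm_sigma_finite.

End prodm.

(* Transport of a sigma-finite measure along a measurable bijection f with
   measurable inverse g; the proofs are arguments so that the measure
   structures can be inferred. *)
Section transport.
Context d1 d2 (T1 : measurableType d1) (T2 : measurableType d2) (R : realType).
Variables (m : {sigma_finite_measure set T1 -> \bar R}).
Variables (f : T1 -> T2) (g : T2 -> T1).

Definition transport (fK : cancel f g) (mf : measurable_fun [set: T1] f)
  (mg : measurable_fun [set: T2] g) : set T2 -> \bar R := pushforward m f.

Variables (fK : cancel f g) (mf : measurable_fun [set: T1] f).
Variable mg : measurable_fun [set: T2] g.

Let mpre (A : set T2) : measurable A -> measurable (f @^-1` A).
Proof. by move=> mA; rewrite -[X in measurable X]setTI; exact: mf. Qed.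

Let transport0 : transport fK mf mg set0 = 0%E.
Proof. by rewrite /transport /pushforward preimage_set0 measure0. Qed.

Let transport_ge0 A : (0 <= transport fK mf mg A)%E.
Proof. exact: measure_ge0. Qed.

Let transport_sigma_additive : semi_sigma_additive (transport fK mf mg).
Proof.
move=> F mF tF mUF; rewrite /transport /pushforward preimage_bigcup.
apply: measure_semi_sigma_additive.
- by move=> n; exact: mpre.
- apply/trivIsetP => /= i j _ _ ij; rewrite -preimage_setI.
  by move/trivIsetP : tF => /(_ _ _ _ _ ij) ->//; rewrite preimage_set0.
- by rewrite -preimage_bigcup; exact: mpre.
Qed.

HB.instance Definition _ := isMeasure.Build _ _ _ (transport fK mf mg)
  transport0 transport_ge0 transport_sigma_additive.

Let transport_sigma_finite : sigma_finite setT (transport fK mf mg).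
Proof.
have [F TF Foo] := sigma_finiteT m.
exists (fun k => g @^-1` F k).
  by rewrite -preimage_bigcup -TF preimage_setT.
move=> k; have [mFk Fkoo] := Foo k; split.
  by rewrite -[X in measurable X]setTI; exact: mg.
rewrite /transport /pushforward -comp_preimage.
by rewrite (_ : g \o f = idfun) //; apply/funext => x /=; rewrite fK.
Qed.

HB.instance Definition _ := Measure_isSigmaFinite.Build _ _ _
  (transport fK mf mg) transport_sigma_finite.

End transport.

(* The Borel sigma-algebra of R[i] and its Lebesgue measure, both carried over
   from R * R by the bijection (x, y) |-> x + i y. *)
Section complex_measure.
Variable R : realType.

Definition pair_of_complex (z : R[i]) : measurableTypeR R * measurableTypeR R :=
  (complex.Re z, complex.Im z).
Definition complex_of_pair (x : measurableTypeR R * measurableTypeR R) : R[i] :=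
  x.1 +i* x.2.

HB.instance Definition _ := isPointed.Build R[i] 0.
HB.instance Definition _ := Measurable.copy R[i]
  (g_sigma_algebra_preimageType pair_of_complex).

Lemma complex_of_pairK : cancel complex_of_pair pair_of_complex.
Proof. by case. Qed.

Lemma measurable_pair_of_complex : measurable_fun [set: R[i]] pair_of_complex.
Proof. by move=> _ B mB; exists B. Qed.

Lemma measurable_complex_of_pair :
  measurable_fun [set: measurableTypeR R * measurableTypeR R] complex_of_pair.
Proof.
move=> _ _ [B mB <-]; rewrite !setTI -comp_preimage.
by rewrite (_ : _ \o _ = idfun) //; apply/funext => -[].
Qed.

Definition lebesgueC : {sigma_finite_measure set R[i] -> \bar R} :=
  transport (prodm (@lebesgue_measure R) (@lebesgue_measure R))
    complex_of_pairK measurable_complex_of_pair measurable_pair_of_complex.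

End complex_measure.

(* The n-fold power of a sigma-finite measure; the sigma-algebra of n-tuples is
   the one generated by the coordinates. *)
Section tuple_measure.
Context d (T : measurableType d) (R : realType).

Definition cons_pair n (x : T * n.-tuple T) : n.+1.-tuple T :=
  [tuple of x.1 :: x.2].
Definition pair_of_tuple n (t : n.+1.-tuple T) : T * n.-tuple T :=
  (thead t, [tuple of behead t]).

Lemma cons_pairK n : cancel (@cons_pair n) (@pair_of_tuple n).
Proof.
by case=> x t; rewrite /pair_of_tuple theadE; congr pair; exact/val_inj.
Qed.

Lemma measurable_cons_pair n :
  measurable_fun [set: T * n.-tuple T] (@cons_pair n).
Proof. exact: measurable_cons. Qed.

Lemma measurable_pair_of_tuple n :
  measurable_fun [set: n.+1.-tuple T] (@pair_of_tuple n).
Proof.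
apply: measurable_fun_pair; [exact: measurable_tnth|exact: measurable_behead].
Qed.

Fixpoint tuple_measure (m : {sigma_finite_measure set T -> \bar R}) n :
    {sigma_finite_measure set (n.-tuple T) -> \bar R} :=
  if n isn't n'.+1 then \d_[tuple]
  else transport (prodm m (tuple_measure m n'))
    (@cons_pairK n') (@measurable_cons_pair n') (@measurable_pair_of_tuple n').

End tuple_measure.

Section siegel.
Variables (R : realType) (n : nat).

(* A point z = (z', z_{n+1}) of C^{n+1}: z.1 is z' and z.2 is z_{n+1}. *)
Definition cspace : Type := (n.-tuple R[i] * R[i])%type.
HB.instance Definition _ := Measurable.on cspace.

Definition dV : {sigma_finite_measure set cspace -> \bar R} :=
  prodm (tuple_measure (lebesgueC R) n) (lebesgueC R).

Implicit Types (z w : cspace) (f : cspace -> R[i]) (p : \bar R).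

Definition hdot z w : R[i] := \sum_(j < n) tnth z.1 j * (tnth w.1 j)^*.

Definition siegel : set cspace :=
  [set z | \sum_(j < n) complex.Re (`|tnth z.1 j|) ^+ 2 < complex.Im z.2].

Definition rho z w : R[i] := 'i / 2 * ((w.2)^* - z.2) - hdot z w.

Definition bergman_kernel z w : R[i] :=
  ((n.+1)`!%:R / (4 * pi ^+ n.+1))%:C * rho z w ^- n.+2.

Definition berezin_integrand f z w : R[i] :=
  `|bergman_kernel z w| ^+ 2 / bergman_kernel z z * f w.

(* Total: junk where the integral does not converge absolutely. *)
Definition berezin f z : R[i] :=
  (\int[dV]_(w in siegel) complex.Re (berezin_integrand f z w))%R +i*
  (\int[dV]_(w in siegel) complex.Im (berezin_integrand f z w))%R.

Definition berezin_cvg f z : Prop :=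
  dV.-integrable siegel (fun w => (complex.Re (berezin_integrand f z w))%:E) /\
  dV.-integrable siegel (fun w => (complex.Im (berezin_integrand f z w))%:E).

(* Elements of L^p(siegel) are represented by functions on all of C^{n+1} of
   which only the restriction to siegel matters. *)
Definition Lpnorm p f : \bar R :=
  'N[dV]_p[(fun z => (complex.Re `|f z|)%:E) \_ siegel]%E.

Definition Lp p f : Prop := measurable_fun siegel f /\ (Lpnorm p f < +oo)%E.

Definition opnorm p (B : (cspace -> R[i]) -> cspace -> R[i]) : \bar R :=
  ereal_sup [set Lpnorm p (B f) | f in [set f | Lp p f /\ (Lpnorm p f <= 1)%E]].

End siegel.

(* Main.v *)
From HB Require Import structures.
Require Import Defs.
From mathcomp Require Import all_boot all_order all_algebra.
From mathcomp Require Import all_classical all_reals all_analysis.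
From mathcomp Require Import measurable_realfun ess_sup_inf.
From mathcomp Require Import complex.
From mathcomp Require Import ring lra.

Set Implicit Arguments.
Unset Strict Implicit.
Unset Printing Implicit Defensive.

Import Order.TTheory GRing.Theory Num.Theory.
Import numFieldNormedType.Exports.
Local Open Scope classical_set_scope.
Local Open Scope ring_scope.

(** Write a point of the Siegel domain as [chart h r], where [h] lies in the
    Heisenberg group and [r = Im z_(n+1) - |z'|^2] is its height.  Lebesgue
    measure becomes Haar measure times [dr], and the Heisenberg translations
    together with the anisotropic dilations act simply transitively.  Moving
    [z] to the point of height 1 over the identity turns the Berezin transform
    into an average with one fixed kernel ([ge0_integral_bkernel]):

      [B f (z) = \int qker(y) f (act z y) dy.]

    Integrated over the Heisenberg variable, [qker] leaves the density
    [(n+2) (1+x)^-(n+3)] of the ratio [x] of the two heights ([integral_qker]);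
    it is a probability density, which settles [p = oo].

    Upper bound for finite [p].  For a fixed [y], the map [z |-> act z y] is a
    right translation followed by a scaling of the height, so composition with
    it has norm [x^(-1/p)] on [L^p] ([ge0_integral_siegel_act]).  By Minkowski's
    inequality the norm of [B] is at most the integral of [qker(y) x^(-1/p)];
    the proof applies Jensen's inequality with this very weight and then
    Tonelli's theorem ([le_integral_avg]).  The same estimates give absolute
    convergence of the integral at every point ([avg_le_Lp]).

    Lower bound.  The function [height^(-1/p)] is an eigenfunction for the
    value of that integral, but it is not in [L^p].  It is cut off to heights
    in [[a, b]] and multiplied by a bump in the Heisenberg variable.  From a
    point of height [r] the average moves by about [sqrt r] in the Heisenberg
    group, so for small [b] the bump is almost constant at that scale, by the
    Harnack type inequality [bump_hmul_ge].  The [p]-th power of the norm of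
    the test function is a multiple of [ln (b / a)] ([integral_test_fun]), and
    the points near the two cuts cost a bounded amount of it: letting [a] tend
    to 0 first removes this cost ([gain_le]), and then [b] tends to 0
    ([berezin_norm_le]).

    Value of the constant.  The integral of [x^(-1/p) (1+x)^-(n+3)] is reduced
    by integrations by parts ([integral_beta_step]), which produce the product,
    to Euler's reflection integral of [x^(s-1) / (1+x)], equal to
    [pi / sin (pi s)] ([reflection_integral]).  Repeated use of
    [1 / (1+x) = 1 - x / (1+x)] expands the latter in partial fractions, and the
    partial sums converge to [pi / sin (pi s)] by an estimate on the Dirichlet
    kernel ([dirichlet_prim_pi_le]). *)

(** * Affine changes of variable on the line *)

Lemma eq_mul_of_mulV (R : realType) (c : R) (x y : \bar R) :
  0 < c -> (x = (c^-1)%:E * y -> y = c%:E * x)%E.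
Proof. by move=> c0 ->; rewrite muleA -EFinM divff ?gt_eqF// mul1e. Qed.

Section affine_real.
Variable R : realType.
Notation mu := (@lebesgue_measure R).

Let affine (c a : R) : measurableTypeR R -> measurableTypeR R :=
  fun x => c * x + a.

Let measurable_affine (c a : R) : measurable_fun [set: measurableTypeR R] (affine c a).
Proof. by apply: measurable_funD => //; apply: measurable_funM. Qed.

Let pushforward_affine (c a : R) : {measure set (measurableTypeR R) -> \bar R}.
Proof. refine (pushforward mu (affine c a)); exact: measurable_affine. Defined.

(** Half-open intervals determine Lebesgue measure, and on them both sides agree. *)
Let lebesgue_measure_affine (c a : R) (c0 : 0 < c) (A : set (measurableTypeR R)) :
  measurable A -> mu A = mscale (NngNum (ltW c0)) (pushforward_affine c a) A.
Proof.
apply: lebesgue_measure_unique => X [[x y] _ <-] /=.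
rewrite /mscale/= /pushforward_affine /pushforward /affine /=.
rewrite (_ : (fun x : R => c * x + a) @^-1` `]x, y] = `](x - a) / c, (y - a) / c]%classic); last first.
  by apply/seteqP; split => z; rewrite /= !in_itv/= ltr_pdivrMr// ler_pdivlMr// ltrBlDr lerBrDr (mulrC z).
rewrite !lebesgue_measure_itv/= !lte_fin.
rewrite ltr_pM2r ?invr_gt0// ltrD2r.
case: ifP => _; last by rewrite mule0.
rewrite -!EFinB -EFinM; congr EFin; field; exact: lt0r_neq0.
Qed.

Lemma ge0_integral_affine (c a : R) (f : R -> \bar R) : 0 < c ->
  measurable_fun [set: measurableTypeR R] (f : measurableTypeR R -> \bar R) -> (forall x, 0 <= f x)%E ->
  (\int[mu]_x f (c * x + a)%R = (c^-1)%:E * \int[mu]_x f x)%E.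
Proof.
move=> c0 mf f0.
have := @ge0_integral_pushforward _ _ _ _ R (affine c a) (measurable_affine c a) mu setT f measurableT mf (fun x _ => f0 x).
rewrite preimage_setT => /= <-.
rewrite [in RHS](@eq_measure_integral _ _ _ _ (mscale (NngNum (ltW c0)) (pushforward_affine c a))); last first.
  by move=> A mA _; exact: (lebesgue_measure_affine a c0 mA).
rewrite ge0_integral_mscale//= muleA -EFinM mulVf ?mul1e//; exact: lt0r_neq0.
Qed.

Lemma ge0_integral_shift (a : R) (f : R -> \bar R) :
  measurable_fun [set: measurableTypeR R] (f : measurableTypeR R -> \bar R) -> (forall x, 0 <= f x)%E ->
  (\int[mu]_x f (x + a)%R = \int[mu]_x f x)%E.
Proof.
move=> mf f0; have := @ge0_integral_affine 1 a f ltr01 mf f0.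
by rewrite invr1 mul1e => <-; apply: eq_integral => x _; rewrite mul1r.
Qed.

Lemma ge0_integral_scale_pos (c : R) (f : R -> \bar R) : 0 < c ->
  measurable_fun [set: measurableTypeR R] (f : measurableTypeR R -> \bar R) -> (forall x, 0 <= f x)%E ->
  (\int[mu]_(x in `]0%R, +oo[) f (c * x)%R = (c^-1)%:E * \int[mu]_(x in `]0%R, +oo[) f x)%E.
Proof.
move=> c0 mf f0.
rewrite [LHS]integral_mkcond [in RHS]integral_mkcond.
rewrite -(@ge0_integral_affine c 0)//; last 2 first.
- exact/(measurable_restrictT _ _).1/measurable_funTS.
- by move=> x; rewrite patchE; case: ifP.
apply: eq_integral => x _; rewrite !patchE addr0; congr (if _ then _ else _).
by apply/idP/idP; rewrite !inE/= !in_itv/= !andbT pmulr_rgt0.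
Qed.

End affine_real.

(** * Iterated integrals and complex affine maps *)

Section iterated.
Variable R : realType.
Notation mu := (@lebesgue_measure R).
Local Open Scope ereal_scope.

Lemma ge0_integral_prodm d1 d2 (T1 : measurableType d1) (T2 : measurableType d2)
  (m1 : {sigma_finite_measure set T1 -> \bar R})
  (m2 : {sigma_finite_measure set T2 -> \bar R}) (f : T1 * T2 -> \bar R) :
  measurable_fun [set: T1 * T2] f -> (forall x, 0 <= f x) ->
  \int[prodm m1 m2]_x f x = \int[m1]_x \int[m2]_y f (x, y).
Proof. by move=> mf f0; exact: (@fubini_tonelli1 _ _ _ _ R m1 m2 f mf f0). Qed.

Lemma ge0_integral_prodm_swap d1 d2 (T1 : measurableType d1) (T2 : measurableType d2)
  (m1 : {sigma_finite_measure set T1 -> \bar R})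
  (m2 : {sigma_finite_measure set T2 -> \bar R}) (f : T1 * T2 -> \bar R) :
  measurable_fun [set: T1 * T2] f -> (forall x, 0 <= f x) ->
  \int[m1]_x \int[m2]_y f (x, y) = \int[m2]_y \int[m1]_x f (x, y).
Proof.
move=> mf f0; rewrite -ge0_integral_prodm//.
exact: (@fubini_tonelli2 _ _ _ _ R m1 m2 f mf f0).
Qed.

Lemma measurable_ge0_integral d1 d2 (T1 : measurableType d1) (T2 : measurableType d2)
  (m2 : {sigma_finite_measure set T2 -> \bar R}) (f : T1 * T2 -> \bar R) :
  measurable_fun [set: T1 * T2] f -> (forall x, 0 <= f x) ->
  measurable_fun [set: T1] (fun x => \int[m2]_y f (x, y)).
Proof. by move=> mf f0; exact: (@measurable_fun_fubini_tonelli_F _ _ _ _ R m2 f mf f0). Qed.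

Lemma ge0_integral_lebesgueC (f : R[i] -> \bar R) :
  measurable_fun [set: R[i]] f -> (forall x, 0 <= f x) ->
  \int[lebesgueC R]_z f z = \int[mu]_x \int[mu]_y f (x +i* y)%C.
Proof.
move=> mf f0.
have := @ge0_integral_pushforward _ _ _ _ R _ (@measurable_complex_of_pair R)
   (prodm mu mu) setT f measurableT mf (fun x _ => f0 x).
rewrite preimage_setT => E.
rewrite [LHS]E ge0_integral_prodm//; last by move=> x; exact: f0.
exact: measurableT_comp mf (@measurable_complex_of_pair R).
Qed.

Lemma ge0_integral_tuple0 d (T : measurableType d)
  (m : {sigma_finite_measure set T -> \bar R}) (f : 0.-tuple T -> \bar R) :
  measurable_fun [set: 0.-tuple T] f ->
  \int[tuple_measure m 0]_t f t = f [tuple].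
Proof. by move=> mf; rewrite integral_dirac// diracT mul1e. Qed.

Lemma ge0_integral_tupleS d (T : measurableType d)
  (m : {sigma_finite_measure set T -> \bar R}) n (f : n.+1.-tuple T -> \bar R) :
  measurable_fun [set: n.+1.-tuple T] f -> (forall x, 0 <= f x) ->
  \int[tuple_measure m n.+1]_t f t =
  \int[m]_x \int[tuple_measure m n]_t f (cons_pair (x, t)).
Proof.
move=> mf f0.
have := @ge0_integral_pushforward _ _ _ _ R _ (@measurable_cons_pair _ T n)
   (prodm m (tuple_measure m n)) setT f measurableT mf (fun x _ => f0 x).
rewrite preimage_setT => E.
rewrite [LHS]E ge0_integral_prodm//; last by move=> x; exact: f0.
exact: measurableT_comp mf (@measurable_cons_pair _ T n).
Qed.

End iterated.

Section complex_measurability.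
Variable R : realType.

Lemma measurable_Re : measurable_fun [set: R[i]] (@complex.Re R : R[i] -> measurableTypeR R).
Proof. exact: measurableT_comp (@measurable_fst _ _ _ _) (@measurable_pair_of_complex R). Qed.

Lemma measurable_Im : measurable_fun [set: R[i]] (@complex.Im R : R[i] -> measurableTypeR R).
Proof. exact: measurableT_comp (@measurable_snd _ _ _ _) (@measurable_pair_of_complex R). Qed.

Lemma measurable_mkcomplex d (T : measurableType d) (f g : T -> R) :
  measurable_fun setT f -> measurable_fun setT g ->
  measurable_fun setT (fun x => (f x +i* g x)%C).
Proof.
move=> mf mg.
exact: (measurableT_comp (@measurable_complex_of_pair R) (measurable_fun_pair mf mg)).
Qed.

Lemma measurable_fun_Re d (T : measurableType d) (D : set T) (f : T -> R[i]) :
  measurable_fun D f -> measurable_fun D (fun x => complex.Re (f x)).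
Proof. by move=> mf; exact: (measurableT_comp measurable_Re mf). Qed.

Lemma measurable_fun_Im d (T : measurableType d) (D : set T) (f : T -> R[i]) :
  measurable_fun D f -> measurable_fun D (fun x => complex.Im (f x)).
Proof. by move=> mf; exact: (measurableT_comp measurable_Im mf). Qed.

End complex_measurability.

Section affine_tuple.
Variable R : realType.
Notation mu := (@lebesgue_measure R).
Implicit Types (n : nat) (c : R).

(** The map [u |-> c u + a], written with real and imaginary parts so that Lebesgue
    measure on [R[i]] reduces at once to the plane. *)
Definition zaxpy c (a u : R[i]) : R[i] :=
  ((c * complex.Re u + complex.Re a) +i* (c * complex.Im u + complex.Im a))%C.

Definition taxpy n c (a u : n.-tuple R[i]) : n.-tuple R[i] :=
  [tuple zaxpy c (tnth a j) (tnth u j) | j < n].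

Lemma measurable_fun_zaxpy d (T : measurableType d) (c : T -> R) (a u : T -> R[i]) :
  measurable_fun setT c -> measurable_fun setT a -> measurable_fun setT u ->
  measurable_fun setT (fun x => zaxpy (c x) (a x) (u x)).
Proof.
move=> mc ma mu_; apply: measurable_mkcomplex; apply: measurable_funD.
- by apply: measurable_funM => //; exact: measurable_fun_Re.
- exact: measurable_fun_Re.
- by apply: measurable_funM => //; exact: measurable_fun_Im.
- exact: measurable_fun_Im.
Qed.

Lemma measurable_fun_taxpy d (T : measurableType d) n (c : T -> R) (a u : T -> n.-tuple R[i]) :
  measurable_fun setT c -> measurable_fun setT a -> measurable_fun setT u ->
  measurable_fun setT (fun x => taxpy (c x) (a x) (u x)).
Proof.
move=> mc ma mu_; apply/measurable_fun_tnthP => j.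
rewrite (_ : _ \o _ = fun x => zaxpy (c x) (tnth (a x) j) (tnth (u x) j)); last first.
  by apply/funext => x /=; rewrite tnth_mktuple.
apply: measurable_fun_zaxpy => //.
- exact: (measurableT_comp (measurable_tnth j) ma).
- exact: (measurableT_comp (measurable_tnth j) mu_).
Qed.

Local Open Scope ereal_scope.

Lemma ge0_integral_zaxpy c (a : R[i]) (f : R[i] -> \bar R) : (0 < c)%R ->
  measurable_fun [set: R[i]] f -> (forall x, 0 <= f x) ->
  \int[lebesgueC R]_z f (zaxpy c a z) = (c ^- 2)%:E * \int[lebesgueC R]_z f z.
Proof.
move=> c0 mf f0.
have mfC : measurable_fun [set: measurableTypeR R * measurableTypeR R]
    (fun x => f (x.1 +i* x.2)%C).
  exact: measurableT_comp mf (@measurable_complex_of_pair R).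
rewrite !ge0_integral_lebesgueC//; last first.
  by apply: measurableT_comp => //; apply: measurable_fun_zaxpy.
rewrite /zaxpy/=.
have ci0 : (0 <= c^-1%:E :> \bar R) by rewrite lee_fin invr_ge0 ltW.
transitivity (\int[mu]_x ((c^-1)%:E * \int[mu]_y f ((c * x + complex.Re a)%R +i* y)%C)).
  apply: eq_integral => x _.
  rewrite -(@ge0_integral_affine _ c (complex.Im a))//.
  by apply: measurableT_comp => //; apply: measurable_mkcomplex.
have mI : measurable_fun [set: measurableTypeR R] (fun x : R => \int[mu]_y f (x +i* y)%C).
  exact: (@measurable_ge0_integral _ _ _ _ _ mu _ mfC).
rewrite ge0_integralZl; [|exact: measurableT| | | exact: ci0]; last 2 first.
- have mg : measurable_fun [set: measurableTypeR R]
      ((fun x => c * x + complex.Re a)%R : _ -> measurableTypeR R).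
    by apply: measurable_funD => //; exact: measurable_funM.
  exact: (measurableT_comp mI mg).
- by move=> x _; exact: integral_ge0.
rewrite (@ge0_integral_affine _ c (complex.Re a) (fun x => \int[mu]_y f (x +i* y)%C))//.
- by rewrite muleA -EFinM expr2 invfM.
- by move=> x; exact: integral_ge0.
Qed.

Lemma taxpy_cons n c (x y : R[i]) (a u : n.-tuple R[i]) :
  taxpy c (cons_pair (x, a)) (cons_pair (y, u)) = cons_pair (zaxpy c x y, taxpy c a u).
Proof.
apply: eq_from_tnth => j; rewrite tnth_mktuple.
case: (unliftP ord0 j) => [k|] ->; last by rewrite !tnth0.
by rewrite !tnthS tnth_mktuple.
Qed.

Lemma ge0_integral_taxpy n c (a : n.-tuple R[i]) (f : n.-tuple R[i] -> \bar R) :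
  (0 < c)%R -> measurable_fun [set: n.-tuple R[i]] f -> (forall x, 0 <= f x) ->
  \int[tuple_measure (lebesgueC R) n]_u f (taxpy c a u) =
  (c ^- (2 * n))%:E * \int[tuple_measure (lebesgueC R) n]_u f u.
Proof.
move=> c0; elim: n a f => [|n IH] a f mf f0.
  rewrite !ge0_integral_tuple0//; last first.
    by apply: measurableT_comp => //; exact: measurable_fun_taxpy.
  rewrite muln0 expr0 invr1 mul1e; congr f.
  by apply: eq_from_tnth => -[].
have mfc : measurable_fun setT (fun x : R[i] * n.-tuple R[i] => f (cons_pair x)).
  exact: measurableT_comp mf (@measurable_cons_pair _ _ n).
have ci0 k : 0 <= (c ^- k)%:E :> \bar R by rewrite lee_fin invr_ge0 exprn_ge0// ltW.
rewrite !ge0_integral_tupleS//; last first.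
  by apply: measurableT_comp => //; exact: measurable_fun_taxpy.
have [x [b ->{a}]] : exists x b, a = @cons_pair _ _ n (x, b).
  by exists (thead a), [tuple of behead a]; rewrite [LHS]tuple_eta; exact: val_inj.
rename b into a.
have mI : measurable_fun setT (fun z : R[i] => \int[tuple_measure (lebesgueC R) n]_u f (cons_pair (z, u))).
  exact: (@measurable_ge0_integral _ _ _ _ _ (tuple_measure (lebesgueC R) n) _ mfc).
transitivity (\int[lebesgueC R]_z ((c ^- (2 * n))%:E * \int[tuple_measure (lebesgueC R) n]_u f (cons_pair (zaxpy c x z, u)))).
  apply: eq_integral => z _; under eq_integral do rewrite taxpy_cons.
  rewrite -(IH a (fun t => f (cons_pair (zaxpy c x z, t))))//.
  have mg : measurable_fun setT (fun t : n.-tuple R[i] => (zaxpy c x z, t)).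
    exact: measurable_fun_pair.
  exact: (measurableT_comp mfc mg).
rewrite ge0_integralZl; [|exact: measurableT| | | exact: ci0]; last 2 first.
- have mg : measurable_fun setT (zaxpy c x) by exact: measurable_fun_zaxpy.
  exact: (measurableT_comp mI mg).
- by move=> z _; exact: integral_ge0.
rewrite (@ge0_integral_zaxpy c x (fun z => \int[tuple_measure (lebesgueC R) n]_u f (cons_pair (z, u))))//.
- by rewrite muleA -EFinM -invfM -exprD mulnS addnC.
- by move=> z; exact: integral_ge0.
Qed.

End affine_tuple.

(** * Heisenberg coordinates on the Siegel domain *)

Section heisenberg.
Variables (R : realType) (n : nat).
Notation mu := (@lebesgue_measure R).
Notation tup := (n.-tuple R[i]).

(** The space [C^n x R] that carries the Heisenberg group; it has a name of its own
    so that the product sigma-algebra is inferred for it. *)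
Definition heis : Type := (tup * measurableTypeR R)%type.
HB.instance Definition _ := Measurable.on heis.

Definition haar : {sigma_finite_measure set heis -> \bar R} :=
  prodm (tuple_measure (lebesgueC R) n) mu.

Definition nsq (u : tup) : R :=
  \sum_(j < n) (complex.Re (tnth u j) ^+ 2 + complex.Im (tnth u j) ^+ 2).

(** With [imdot], the two parts of the Hermitian product [a . conj u]. *)
Definition redot (a u : tup) : R :=
  \sum_(j < n) (complex.Re (tnth a j) * complex.Re (tnth u j) +
                complex.Im (tnth a j) * complex.Im (tnth u j)).

Definition imdot (a u : tup) : R :=
  \sum_(j < n) (complex.Im (tnth a j) * complex.Re (tnth u j) -
                complex.Re (tnth a j) * complex.Im (tnth u j)).

(** The Heisenberg product of [a] with the dilate of [h] by [d]. *)
Definition hmul (d : R) (a h : heis) : heis :=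
  (taxpy d a.1 h.1, d ^+ 2 * h.2 + (a.2 + 2 * d * imdot a.1 h.1)).

(** The height is the value of [rho z z], so that the Siegel domain becomes the
    half-space of positive heights. *)
Definition chart (h : heis) (r : R) : cspace R n :=
  (h.1, (h.2 +i* (r + nsq h.1))%C).

Definition height (z : cspace R n) : R := complex.Im z.2 - nsq z.1.

Definition base (z : cspace R n) : heis := (z.1, complex.Re z.2).

Lemma nsq_ge0 u : 0 <= nsq u.
Proof. by apply: sumr_ge0 => j _; rewrite addr_ge0// sqr_ge0. Qed.

Lemma height_chart h r : height (chart h r) = r.
Proof. by rewrite /height /=; ring. Qed.

Lemma base_chart h r : base (chart h r) = h.
Proof. by case: h. Qed.

Lemma chart_base z : chart (base z) (height z) = z.
Proof. by case: z => u [s t]; rewrite /chart /height /= subrK. Qed.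

Lemma siegelE (z : cspace R n) : siegel z = (0 < height z) :> Prop.
Proof.
rewrite /siegel /height subr_gt0 /=; congr (is_true (_ < _)).
apply: eq_bigr => j _; case: (tnth z.1 j) => x y /=; rewrite sqr_sqrtr//.
by rewrite addr_ge0// sqr_ge0.
Qed.

Section measurability.
Context d (T : measurableType d).
Implicit Types (u a : T -> tup).

Lemma measurable_fun_bigsum m (f : 'I_m -> T -> R) :
  (forall j, measurable_fun setT (f j)) ->
  measurable_fun setT (fun x => \sum_(j < m) f j x).
Proof.
elim: m f => [|m IH] f mf.
  by rewrite (_ : (fun _ => _) = cst 0)//; apply/funext => x; rewrite big_ord0.
rewrite (_ : (fun _ => _) =
    (fun x => f ord0 x + \sum_(j < m) f (lift ord0 j) x)); last first.
  by apply/funext => x; rewrite big_ord_recl.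
by apply: measurable_funD => //; apply: IH.
Qed.

Lemma measurable_fun_Re_tnth u j : measurable_fun setT u ->
  measurable_fun setT (fun x => complex.Re (tnth (u x) j)).
Proof. by move=> mf; apply: measurable_fun_Re; exact: (measurableT_comp (measurable_tnth j) mf). Qed.

Lemma measurable_fun_Im_tnth u j : measurable_fun setT u ->
  measurable_fun setT (fun x => complex.Im (tnth (u x) j)).
Proof. by move=> mf; apply: measurable_fun_Im; exact: (measurableT_comp (measurable_tnth j) mf). Qed.

Lemma measurable_fun_nsq u : measurable_fun setT u -> measurable_fun setT (fun x => nsq (u x)).
Proof.
move=> mf; apply: measurable_fun_bigsum => j; apply: measurable_funD; apply: measurable_funX.
- exact: measurable_fun_Re_tnth.
- exact: measurable_fun_Im_tnth.
Qed.

Lemma measurable_fun_redot a u : measurable_fun setT a -> measurable_fun setT u ->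
  measurable_fun setT (fun x => redot (a x) (u x)).
Proof.
move=> ma mf; apply: measurable_fun_bigsum => j; apply: measurable_funD; apply: measurable_funM;
  by [exact: measurable_fun_Re_tnth|exact: measurable_fun_Im_tnth].
Qed.

Lemma measurable_fun_imdot a u : measurable_fun setT a -> measurable_fun setT u ->
  measurable_fun setT (fun x => imdot (a x) (u x)).
Proof.
move=> ma mf; apply: measurable_fun_bigsum => j; apply: measurable_funB; apply: measurable_funM;
  by [exact: measurable_fun_Re_tnth|exact: measurable_fun_Im_tnth].
Qed.

Lemma measurable_fun_fst1 d1 d2 (A : measurableType d1) (B : measurableType d2) (f : T -> A * B) :
  measurable_fun setT f -> measurable_fun setT (fun x => (f x).1).
Proof. by move=> mf; exact: (measurableT_comp measurable_fst mf). Qed.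

Lemma measurable_fun_snd2 d1 d2 (A : measurableType d1) (B : measurableType d2) (f : T -> A * B) :
  measurable_fun setT f -> measurable_fun setT (fun x => (f x).2).
Proof. by move=> mf; exact: (measurableT_comp measurable_snd mf). Qed.

Lemma measurable_fun_hmul (c : T -> R) (a h : T -> heis) :
  measurable_fun setT c -> measurable_fun setT a -> measurable_fun setT h ->
  measurable_fun setT (fun x => hmul (c x) (a x) (h x)).
Proof.
move=> mc ma mh; apply: measurable_fun_pair.
  by apply: measurable_fun_taxpy => //; exact: measurable_fun_fst1.
apply: measurable_funD.
  by apply: measurable_funM; [exact: measurable_funX|exact: measurable_fun_snd2].
apply: measurable_funD; first exact: measurable_fun_snd2.
by apply: measurable_funM; [exact: measurable_funM|apply: measurable_fun_imdot; exact: measurable_fun_fst1].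
Qed.

Lemma measurable_fun_chart (h : T -> heis) (r : T -> R) :
  measurable_fun setT h -> measurable_fun setT r ->
  measurable_fun setT (fun x => chart (h x) (r x)).
Proof.
move=> mh mr; apply: measurable_fun_pair; first exact: measurable_fun_fst1.
apply: measurable_mkcomplex; first exact: measurable_fun_snd2.
by apply: measurable_funD => //; apply: measurable_fun_nsq; exact: measurable_fun_fst1.
Qed.

Lemma measurable_fun_height (z : T -> cspace R n) : measurable_fun setT z ->
  measurable_fun setT (fun x => height (z x)).
Proof.
move=> mz; apply: measurable_funB.
  by apply: measurable_fun_Im; exact: measurable_fun_snd2.
by apply: measurable_fun_nsq; exact: measurable_fun_fst1.
Qed.

Lemma measurable_fun_base (z : T -> cspace R n) : measurable_fun setT z ->
  measurable_fun setT (fun x => base (z x)).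
Proof.
move=> mz; apply: measurable_fun_pair; first exact: measurable_fun_fst1.
by apply: measurable_fun_Re; exact: measurable_fun_snd2.
Qed.

End measurability.

Lemma measurable_siegel : measurable (@siegel R n).
Proof.
rewrite (_ : @siegel R n = [set: cspace R n] `&` height @^-1` `]0, +oo[%classic); last first.
  by rewrite setTI; apply/funext => z; rewrite /= in_itv/= andbT siegelE.
by apply: measurable_fun_height.
Qed.

Local Open Scope ereal_scope.

(** Left translation is a shear of the central variable over a translation, so only
    the dilation changes the measure; its exponent is the homogeneous dimension. *)
Lemma ge0_integral_hmul_left d (a : heis) (f : heis -> \bar R) : (0 < d)%R ->
  measurable_fun [set: heis] f -> (forall h, 0 <= f h) ->
  \int[haar]_h f (hmul d a h) = (d ^- (2 * n.+1))%:E * \int[haar]_h f h.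
Proof.
move=> d0 mf f0.
have mI : measurable_fun setT (fun u : tup => \int[mu]_t f (u, t)).
  exact: (@measurable_ge0_integral _ _ _ _ _ mu _ mf).
have mfm : measurable_fun [set: heis] (fun h => f (hmul d a h)).
  by apply: (measurableT_comp mf); exact: measurable_fun_hmul.
have fm0 h : 0 <= f (hmul d a h) by [].
rewrite [LHS](ge0_integral_prodm _ _ mfm fm0) [in RHS](ge0_integral_prodm _ _ mf f0).
transitivity (\int[tuple_measure (lebesgueC R) n]_u
    ((d ^- 2)%:E * \int[mu]_t f (taxpy d a.1 u, t))).
  apply: eq_integral => u _; rewrite /hmul /=.
  rewrite (@ge0_integral_affine _ (d ^+ 2) _ (fun t => f (taxpy d a.1 u, t)))//.
  - by rewrite exprn_gt0.
  - by apply: (measurableT_comp mf); exact: measurable_fun_pair.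
rewrite ge0_integralZl; [|exact: measurableT| | |]; last 3 first.
- by apply: (measurableT_comp mI); exact: measurable_fun_taxpy.
- by move=> u _; exact: integral_ge0.
- by rewrite lee_fin invr_ge0 exprn_ge0// ltW.
rewrite (@ge0_integral_taxpy _ _ d a.1 (fun u => \int[mu]_t f (u, t)))//; last first.
  by move=> u; exact: integral_ge0.
by rewrite muleA -EFinM -invfM -exprD mulnS addnC.
Qed.

(** The dilation acts on the fixed factor [h]: in the variable [a] only a shear over
    a translation is left. This is the unimodularity of the group. *)
Lemma ge0_integral_hmul_right d (h : heis) (f : heis -> \bar R) :
  measurable_fun [set: heis] f -> (forall h, 0 <= f h) ->
  \int[haar]_a f (hmul d a h) = \int[haar]_a f a.
Proof.
move=> mf f0.
have mI : measurable_fun setT (fun u : tup => \int[mu]_t f (u, t)).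
  exact: (@measurable_ge0_integral _ _ _ _ _ mu _ mf).
have mfm : measurable_fun [set: heis] (fun a => f (hmul d a h)).
  by apply: (measurableT_comp mf); exact: measurable_fun_hmul.
have fm0 a : 0 <= f (hmul d a h) by [].
rewrite [LHS](ge0_integral_prodm _ _ mfm fm0) [RHS](ge0_integral_prodm _ _ mf f0).
pose b : tup := [tuple zaxpy d 0%R (tnth h.1 j) | j < n].
transitivity (\int[tuple_measure (lebesgueC R) n]_u \int[mu]_t f (taxpy 1 b u, t)).
  apply: eq_integral => u _; rewrite /hmul /=.
  have -> : taxpy d u h.1 = taxpy 1 b u.
    apply: eq_from_tnth => j; rewrite !tnth_mktuple /zaxpy/= !mul1r !addr0.
    by congr (_ +i* _)%C; rewrite addrC.
  rewrite -(@ge0_integral_shift _ (d ^+ 2 * h.2 + 2 * d * imdot u h.1)%R (fun t => f (taxpy 1 b u, t)))//.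
  - by apply: eq_integral => t _; congr (f (_, _)); ring.
  - by apply: (measurableT_comp mf); exact: measurable_fun_pair.
rewrite (@ge0_integral_taxpy _ _ 1 b (fun u => \int[mu]_t f (u, t)))//; last first.
  by move=> u; exact: integral_ge0.
by rewrite expr1n invr1 mul1e.
Qed.

(** The chart shifts [Im z_(n+1)] by a function of [z']: it preserves volume. *)
Lemma ge0_integral_siegel (F : cspace R n -> \bar R) :
  measurable_fun [set: cspace R n] F -> (forall z, 0 <= F z) ->
  \int[dV R n]_(z in @siegel R n) F z =
  \int[haar]_h \int[mu]_(r in `]0%R, +oo[) F (chart h r).
Proof.
move=> mF F0; rewrite integral_mkcond.
pose G := F \_ (@siegel R n).
have G0 z : 0 <= G z by rewrite /G patchE; case: ifP.
have mG : measurable_fun [set: cspace R n] G.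
  by apply/(measurable_restrictT _ _).1; [exact: measurable_siegel|exact: measurable_funTS].
have GE h r : G (chart h r) = (if (0 < r)%R then F (chart h r) else 0).
  rewrite /G patchE -[in RHS](height_chart h r).
  case: ifPn; [rewrite inE|rewrite notin_setE]; rewrite siegelE height_chart.
    by move=> ->.
  by move/negP/negbTE => ->.
rewrite [LHS](ge0_integral_prodm _ _ mG G0).
have mGc : measurable_fun [set: heis] (fun h => \int[mu]_r G (chart h r)).
  apply: (@measurable_ge0_integral _ _ _ _ _ mu (fun x : heis * measurableTypeR R => G (chart x.1 x.2))) => //.
  by apply: (measurableT_comp mG); exact: measurable_fun_chart.
transitivity (\int[haar]_h \int[mu]_r G (chart h r)); last first.
  apply: eq_integral => h _; rewrite [RHS]integral_mkcond; apply: eq_integral => r _.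
  rewrite GE patchE; case: ifPn => r0; case: ifPn => //.
    by rewrite notin_setE /= in_itv/= r0.
  by rewrite inE /= in_itv/= (negbTE r0).
rewrite [RHS](ge0_integral_prodm _ _ mGc); last first.
  by move=> h; exact: integral_ge0.
apply: eq_integral => u _.
have mGu : measurable_fun [set: R[i]] (fun z => G (u, z)).
  by apply: (measurableT_comp mG); exact: measurable_fun_pair.
rewrite (ge0_integral_lebesgueC mGu (fun z => G0 _)); apply: eq_integral => s _.
rewrite -(@ge0_integral_shift _ (nsq u) (fun t => G (u, (s +i* t)%C)))//.
by apply: (measurableT_comp mGu); exact: measurable_mkcomplex.
Qed.

End heisenberg.

(** * The Berezin kernel in Heisenberg coordinates *)

Section kernel.
Variables (R : realType) (n : nat).
Notation mu := (@lebesgue_measure R).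
Notation heis := (heis R n).
Notation haar := (haar R n).

(** [`|rho z w|^2] in real coordinates. *)
Definition rho2 (z w : cspace R n) : R :=
  ((complex.Im w.2 + complex.Im z.2) / 2 - redot z.1 w.1) ^+ 2 +
  ((complex.Re w.2 - complex.Re z.2) / 2 - imdot z.1 w.1) ^+ 2.

Definition bconst : R := (n.+1)`!%:R / (4 * pi ^+ n.+1).

(** The weight [`|K(z,w)|^2 / K(z,z)] of the Berezin transform. *)
Definition bkernel (z w : cspace R n) : R :=
  bconst * height z ^+ n.+2 / rho2 z w ^+ n.+2.

Lemma bconst_gt0 : 0 < bconst.
Proof.
by rewrite divr_gt0// ?ltr0n ?fact_gt0// mulr_gt0// exprn_gt0// pi_gt0.
Qed.

Lemma hdotE (z w : cspace R n) : hdot z w = (redot z.1 w.1 +i* imdot z.1 w.1)%C.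
Proof.
rewrite /hdot /redot /imdot; elim/big_ind3: _ => //.
  by move=> x1 y1 z1 x2 y2 z2 -> ->.
move=> j _; case: (tnth z.1 j) => a b; case: (tnth w.1 j) => c d.
by apply/eqP; rewrite eq_complex /=; apply/andP; split; apply/eqP; ring.
Qed.

Lemma rhoE (z w : cspace R n) : rho z w =
  (((complex.Im w.2 + complex.Im z.2) / 2 - redot z.1 w.1) +i*
   ((complex.Re w.2 - complex.Re z.2) / 2 - imdot z.1 w.1))%C.
Proof.
rewrite /rho hdotE; case: z => z' [a b]; case: w => w' [c d] /=.
have -> : ('i / 2 = 0 +i* 2^-1 :> R[i])%C.
  have e2 : (2 : R[i]) = (2%:C)%C by rewrite rmorph_nat.
  rewrite e2 -(fmorphV (real_complex R)).
  by apply/eqP; rewrite eq_complex /=; apply/andP; split; apply/eqP; ring.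
by apply/eqP; rewrite eq_complex /=; apply/andP; split; apply/eqP; ring.
Qed.

Lemma redot_diag (u : n.-tuple R[i]) : redot u u = nsq u.
Proof. by apply: eq_bigr => j _; rewrite !expr2. Qed.

Lemma imdot_diag (u : n.-tuple R[i]) : imdot u u = 0.
Proof. by rewrite /imdot big1// => j _; ring. Qed.

Lemma rho_diag (z : cspace R n) : rho z z = ((height z)%:C)%C.
Proof.
rewrite rhoE redot_diag imdot_diag subrr mul0r subrr /height.
by congr (_ +i* _)%C; field.
Qed.

Lemma rho2E (z w : cspace R n) : `|rho z w| ^+ 2 = ((rho2 z w)%:C)%C.
Proof. by rewrite -add_Re2_Im2 rhoE. Qed.

Lemma rho2_ge0 (z w : cspace R n) : 0 <= rho2 z w.
Proof. by rewrite addr_ge0// sqr_ge0. Qed.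

Lemma berezin_integrandE f (z w : cspace R n) : siegel z ->
  berezin_integrand f z w = ((bkernel z w)%:C)%C * f w.
Proof.
rewrite siegelE => z0; congr (_ * _).
have c0 := bconst_gt0.
rewrite /bergman_kernel normrM exprMn normfV normrX exprVn -exprM mulnC exprM rho2E rho_diag.
rewrite /bkernel -/bconst; move: bconst c0 => b b0.
rewrite ger0_norm; last by rewrite lecR ltW.
rewrite rmorphM fmorphV rmorphM !rmorphXn /=.
set c := (b%:C)%C; set h := ((height z)%:C)%C.
have cN0 : c != 0 by rewrite fmorph_eq0 gt_eqF.
have hN0 : h ^+ n.+2 != 0 by rewrite expf_neq0// fmorph_eq0 gt_eqF.
set X := _ ^- _; set Y := _ ^+ n.+2 in hN0 *.
by rewrite invf_div expr2; field; rewrite ?cN0 ?hN0.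
Qed.

Lemma bkernel_ge0 (z w : cspace R n) : siegel z -> 0 <= bkernel z w.
Proof.
rewrite siegelE => z0; rewrite /bkernel divr_ge0 ?exprn_ge0 ?rho2_ge0//.
by rewrite mulr_ge0 ?exprn_ge0 ?ltW// bconst_gt0.
Qed.

Lemma nsq_taxpy (d : R) (a u : n.-tuple R[i]) :
  nsq (taxpy d a u) = nsq a + 2 * d * redot a u + d ^+ 2 * nsq u.
Proof.
rewrite /nsq /redot !mulr_sumr -!big_split /=; apply: eq_bigr => j _.
by rewrite tnth_mktuple /zaxpy/=; ring.
Qed.

Lemma redot_taxpy (d : R) (a u : n.-tuple R[i]) :
  redot a (taxpy d a u) = nsq a + d * redot a u.
Proof.
rewrite /nsq /redot !mulr_sumr -!big_split /=; apply: eq_bigr => j _.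
by rewrite tnth_mktuple /zaxpy/=; ring.
Qed.

Lemma imdot_taxpy (d : R) (a u : n.-tuple R[i]) :
  imdot a (taxpy d a u) = d * imdot a u.
Proof.
rewrite /imdot !mulr_sumr; apply: eq_bigr => j _.
by rewrite tnth_mktuple /zaxpy/=; ring.
Qed.

(** Invariance of [rho]: the base points enter only through the group element that
    leads from one to the other. *)
Lemma rho2_chart d (a h : heis) r r' :
  rho2 (chart a r) (chart (hmul d a h) r') =
  ((r + r' + d ^+ 2 * nsq h.1) ^+ 2 + (d ^+ 2 * h.2) ^+ 2) / 4.
Proof.
by rewrite /rho2 /= redot_taxpy imdot_taxpy nsq_taxpy; field.
Qed.

(** The weight [bkernel] at the point of height 1 over the identity, as a function of
    the Heisenberg variable [y.1] and of the height [y.2]. *)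
Definition qker (y : heis * measurableTypeR R) : R :=
  if 0 < y.2 then
    bconst / (((1 + y.2 + nsq y.1.1) ^+ 2 + y.1.2 ^+ 2) / 4) ^+ n.+2
  else 0.

(** The point obtained from the position [y], relative to the identity at height 1,
    by the motion that sends the latter to [chart a r]. *)
Definition act (a : heis) (r : R) (y : heis * measurableTypeR R) : cspace R n :=
  chart (hmul (Num.sqrt r) a y.1) (r * y.2).

Definition haarR : {sigma_finite_measure set (heis * measurableTypeR R)%type -> \bar R} :=
  prodm haar mu.

Lemma qker_ge0 y : 0 <= qker y.
Proof.
rewrite /qker; case: ifP => // _; rewrite divr_ge0 ?(ltW bconst_gt0)//.
by rewrite exprn_ge0// divr_ge0// addr_ge0// sqr_ge0.
Qed.

Lemma bkernel_chart (a : heis) r y : 0 < r -> 0 < y.2 ->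
  bkernel (chart a r) (act a r y) = r ^- n.+2 * qker y.
Proof.
move=> r0 y0; rewrite /bkernel height_chart /act rho2_chart /qker y0 sqr_sqrtr ?ltW//.
have -> : (r + r * y.2 + r * nsq y.1.1) ^+ 2 + (r * y.1.2) ^+ 2 =
  r ^+ 2 * ((1 + y.2 + nsq y.1.1) ^+ 2 + y.1.2 ^+ 2) by ring.
rewrite -[_ * _ / 4]mulrA exprMn invfM -[in LHS](exprM r 2) mul2n -addnn exprD invfM.
have rn : r ^+ n.+2 != 0 by rewrite expf_neq0// gt_eqF.
set Q := (_ / _) ^- _ .
by rewrite -mulrA; set s := r ^+ n.+2 in rn *; field.
Qed.

Lemma measurable_inv : measurable_fun [set: measurableTypeR R] (fun x : R => x^-1).
Proof.
rewrite (_ : (fun _ => _) = (fun x : R => x * (x ^+ 2) `^ (-1))).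
  apply: measurable_funM => //.
  exact: (measurableT_comp (@measurable_powR R (-1)) (@exprn_measurable R setT 2)).
apply/funext => x; rewrite powR_inv1 ?sqr_ge0//.
have [->|x0] := eqVneq x 0; first by rewrite invr0 mul0r.
by field.
Qed.

Lemma measurable_fun_inv d (T : measurableType d) (f : T -> R) :
  measurable_fun setT f -> measurable_fun setT (fun x => (f x)^-1).
Proof. by move=> mf; exact: (measurableT_comp measurable_inv mf). Qed.

Lemma measurable_qker : measurable_fun setT qker.
Proof.
apply: measurable_fun_ifT => //; last first.
  apply: measurable_funM => //; apply: measurable_fun_inv; apply: measurable_funX.
  apply: measurable_funM => //; apply: measurable_funD; apply: measurable_funX.
    apply: measurable_funD; first by apply: measurable_funD => //; exact: measurable_snd.
    by apply: measurable_fun_nsq; apply: measurable_fun_fst1; exact: measurable_fst.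
  by apply: measurable_fun_snd2; exact: measurable_fst.
by apply: measurable_fun_ltr => //; exact: measurable_snd.
Qed.

Lemma measurable_fun_act d (T : measurableType d) (a : T -> heis) (r : T -> R) (y : T -> heis * measurableTypeR R) :
  measurable_fun setT a -> measurable_fun setT r -> measurable_fun setT y ->
  measurable_fun setT (fun x => act (a x) (r x) (y x)).
Proof.
move=> ma mr my; apply: measurable_fun_chart.
  apply: measurable_fun_hmul => //; last exact: measurable_fun_fst1.
  by apply: (measurableT_comp _ mr); apply: continuous_measurable_fun; exact: sqrt_continuous.
by apply: measurable_funM => //; exact: measurable_fun_snd2.
Qed.

Lemma measurable_fun_rho2 d (T : measurableType d) (z w : T -> cspace R n) :
  measurable_fun setT z -> measurable_fun setT w ->
  measurable_fun setT (fun x => rho2 (z x) (w x)).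
Proof.
move=> mz mw; apply: measurable_funD; apply: measurable_funX; apply: measurable_funB.
- apply: measurable_funM => //; apply: measurable_funD; apply: measurable_fun_Im; exact: measurable_fun_snd2.
- by apply: measurable_fun_redot; exact: measurable_fun_fst1.
- apply: measurable_funM => //; apply: measurable_funB; apply: measurable_fun_Re; exact: measurable_fun_snd2.
- by apply: measurable_fun_imdot; exact: measurable_fun_fst1.
Qed.

Lemma measurable_fun_bkernel d (T : measurableType d) (z w : T -> cspace R n) :
  measurable_fun setT z -> measurable_fun setT w ->
  measurable_fun setT (fun x => bkernel (z x) (w x)).
Proof.
move=> mz mw; apply: measurable_funM.
  by apply: measurable_funM => //; apply: measurable_funX; exact: measurable_fun_height.
by apply: measurable_fun_inv; apply: measurable_funX; exact: measurable_fun_rho2.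
Qed.

Local Open Scope ereal_scope.

Lemma ge0_integral_siegel_height (F : cspace R n -> \bar R) :
  measurable_fun [set: cspace R n] F -> (forall z, 0 <= F z) ->
  \int[dV R n]_(z in @siegel R n) F z =
  \int[mu]_(r in `]0%R, +oo[) \int[haar]_h F (chart h r).
Proof.
move=> mF F0; rewrite ge0_integral_siegel//.
pose G (x : heis * measurableTypeR R) := if (0 < x.2)%R then F (chart x.1 x.2) else 0.
have mG : measurable_fun setT G.
  apply: measurable_fun_ifT => //.
    by apply: measurable_fun_ltr => //; exact: measurable_snd.
  by apply: (measurableT_comp mF); exact: measurable_fun_chart.
have G0 x : 0 <= G x by rewrite /G; case: ifP.
transitivity (\int[haar]_h \int[mu]_r G (h, r)).
  apply: eq_integral => h _; rewrite integral_mkcond; apply: eq_integral => r _.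
  rewrite patchE /G /=; case: ifPn => r0; case: ifPn => //.
    by move/negP; rewrite inE /= in_itv/= andbT in r0; rewrite r0.
  by move=> r1; rewrite notin_setE /= in_itv/= andbT r1 in r0.
rewrite (ge0_integral_prodm_swap _ _ mG G0) [RHS]integral_mkcond; apply: eq_integral => r _.
rewrite patchE /G /=; case: ifPn => r0.
  by rewrite inE /= in_itv/= andbT in r0; rewrite r0.
rewrite notin_setE /= in_itv/= andbT in r0; move/negP/negbTE : r0 => ->.
exact: integral0.
Qed.

(** The substitution [w = act a r y] has Jacobian [r^(n+2)], which cancels the power of
    [r] in [bkernel_chart]. *)
Lemma ge0_integral_bkernel (a : heis) r (F : cspace R n -> \bar R) : (0 < r)%R ->
  measurable_fun [set: cspace R n] F -> (forall z, 0 <= F z) ->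
  \int[dV R n]_(w in @siegel R n) ((bkernel (chart a r) w)%:E * F w) =
  \int[haarR]_y ((qker y)%:E * F (act a r y)).
Proof.
move=> r0 mF F0.
have zs : siegel (chart a r) by rewrite siegelE height_chart.
pose G w := (bkernel (chart a r) w)%:E * F w.
have G0 w : 0 <= G w by rewrite mule_ge0// lee_fin bkernel_ge0.
have mG : measurable_fun setT G.
  by apply: emeasurable_funM => //; apply/measurable_EFinP; exact: measurable_fun_bkernel.
pose K (y : heis * measurableTypeR R) := (qker y)%:E * F (act a r y).
have K0 y : 0 <= K y by rewrite mule_ge0// lee_fin qker_ge0.
have mK : measurable_fun setT K.
  apply: emeasurable_funM => //; first by apply/measurable_EFinP; exact: measurable_qker.
  by apply: (measurableT_comp mF); exact: measurable_fun_act.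
rewrite (ge0_integral_siegel_height mG G0) (ge0_integral_prodm _ _ mK K0).
rewrite (ge0_integral_prodm_swap _ _ mK K0).
have mI : measurable_fun [set: measurableTypeR R] (fun s => \int[haar]_h G (chart h s)).
  apply: (@measurable_ge0_integral _ _ _ _ _ haar (fun x : measurableTypeR R * heis => G (chart x.2 x.1))) => //.
  by apply: (measurableT_comp mG); exact: measurable_fun_chart.
have I0 s : 0 <= \int[haar]_h G (chart h s) by exact: integral_ge0.
rewrite (eq_mul_of_mulV r0 (ge0_integral_scale_pos r0 mI I0)).
rewrite -ge0_integralZl//; last 2 first.
- by apply: measurable_funTS; apply: (measurableT_comp mI); exact: measurable_funM.
- by rewrite lee_fin ltW.
rewrite [LHS]integral_mkcond; apply: eq_integral => x _.
rewrite patchE; case: ifPn => x0; last first.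
  rewrite notin_setE /= in_itv/= andbT in x0; move/negP/negbTE : x0 => x0.
  by rewrite /K /qker /= x0; under eq_integral do rewrite mul0e; rewrite integral0.
rewrite inE /= in_itv/= andbT in x0.
have mGx : measurable_fun [set: heis] (fun h => G (chart h (r * x)%R)).
  by apply: (measurableT_comp mG); exact: measurable_fun_chart.
have s0 : (0 < Num.sqrt r)%R by rewrite sqrtr_gt0.
have := ge0_integral_hmul_left a s0 mGx (fun h => G0 _).
rewrite exprM sqr_sqrtr; last exact: ltW.
have rn0 : (0 < r ^+ n.+1)%R by rewrite exprn_gt0.
move=> /(eq_mul_of_mulV rn0) ->; rewrite muleA -EFinM -exprS -ge0_integralZl//; last 2 first.
- by apply: (measurableT_comp mGx); exact: measurable_fun_hmul.
- by rewrite lee_fin exprn_ge0// ltW.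
apply: eq_integral => h _.
rewrite /G /K -/(act a r (h, x)) (@bkernel_chart a r (h, x))// muleA -EFinM mulrA divff ?mul1r//.
by rewrite expf_neq0// gt_eqF.
Qed.

End kernel.

(** * Calculus on the line and powers of the Cauchy density *)

Section calculus.
Variable R : realType.
Notation mu := (@lebesgue_measure R).
Implicit Types (f g F : R -> R) (a b x l : R).

Lemma derive_cst_fun (c x : R) : is_derive x 1 (fun _ : R => c) 0.
Proof. exact: is_derive_cst. Qed.

Lemma deriveD_fun f g x a b : is_derive x 1 f a -> is_derive x 1 g b ->
  is_derive x 1 (fun y => f y + g y) (a + b).
Proof. by move=> df dg; exact: is_deriveD. Qed.

Lemma deriveB_fun f g x a b : is_derive x 1 f a -> is_derive x 1 g b ->
  is_derive x 1 (fun y => f y - g y) (a - b).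
Proof. by move=> df dg; exact: is_deriveB. Qed.

Lemma deriveM_fun f g x a b : is_derive x 1 f a -> is_derive x 1 g b ->
  is_derive x 1 (fun y => f y * g y) (f x * b + g x * a).
Proof. by move=> df dg; exact: is_deriveM. Qed.

Lemma deriveMl_fun f k x a : is_derive x 1 f a -> is_derive x 1 (fun y => k * f y) (k * a).
Proof. by move=> df; exact: is_deriveZ. Qed.

Lemma deriveX_fun f m x a : is_derive x 1 f a ->
  is_derive x 1 (fun y => f y ^+ m.+1) (m.+1%:R * f x ^+ m * a).
Proof. move=> df; have d := @is_deriveX _ _ f m.+1 x 1 a df.
have -> : (fun y => f y ^+ m.+1) = f ^+ m.+1 by apply/funext => y; rewrite exprfctE.
by apply: (@is_derive_eq _ _ _ _ _ _ _ _ d). Qed.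

Lemma deriveV_fun f x a : f x != 0 -> is_derive x 1 f a ->
  is_derive x 1 (fun y => (f y)^-1) (- a / f x ^+ 2).
Proof.
move=> fx0 df; have := is_deriveV fx0 df; rewrite /GRing.scale/= => d.
by apply: is_derive_eq; rewrite mulrC mulNr mulrN.
Qed.

Lemma deriveXV_fun f m x a : f x != 0 -> is_derive x 1 f a ->
  is_derive x 1 (fun y => f y ^- m.+1) (- m.+1%:R * f x ^- m.+2 * a).
Proof.
move=> fx0 df; have /deriveV_fun := deriveX_fun m df.
move=> /(_ (expf_neq0 _ fx0)) d; apply: is_derive_eq.
by rewrite !exprS; field; rewrite fx0 expf_neq0.
Qed.

Lemma is_derive_continuous f x a : is_derive x 1 f a -> {for x, continuous f}.
Proof.
by move=> df; apply/differentiable_continuous/derivable1_diffP; exact: ex_derive.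
Qed.

Lemma FTC_cc f F a b : a < b ->
  (forall x, a <= x <= b -> {for x, continuous f}) ->
  (forall x, a <= x <= b -> is_derive x 1 F (f x)) ->
  (\int[mu]_(x in `[a, b]) (f x)%:E = (F b - F a)%:E)%E.
Proof.
move=> ab cf dF; rewrite (@continuous_FTC2 _ f F)//.
- by apply: continuous_in_subspaceT => x; rewrite inE /= in_itv/=; exact: cf.
- split.
  + by move=> x; rewrite in_itv/= => /andP[ax xb]; have := dF x; rewrite !ltW// => /(_ erefl) [].
  + by apply: cvg_at_right_filter; apply: (is_derive_continuous (dF a _)); rewrite lexx ltW.
  + by apply: cvg_at_left_filter; apply: (is_derive_continuous (dF b _)); rewrite lexx ltW.
- move=> x; rewrite in_itv/= => /andP[ax xb]; rewrite derive1E.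
  by have := dF x; rewrite !ltW// => /(_ erefl) [].
Qed.

Lemma FTC_cy f F a l : (forall x, a <= x -> 0 <= f x) ->
  (forall x, a <= x -> {for x, continuous f}) ->
  (forall x, a <= x -> is_derive x 1 F (f x)) ->
  F x @[x --> +oo] --> l ->
  (\int[mu]_(x in `[a, +oo[) (f x)%:E = (l - F a)%:E)%E.
Proof.
move=> f0 cf dF Fl; rewrite (@ge0_continuous_FTC2y _ f F a l)//.
- by apply: continuous_in_subspaceT => x; rewrite inE /= in_itv/= andbT; exact: cf.
- by move=> x /ltW ax; have [] := dF x ax.
- by apply: cvg_at_right_filter; apply: (is_derive_continuous (dF a _)).
- by move=> x; rewrite in_itv/= andbT => /ltW ax; rewrite derive1E; have [] := dF x ax.
Qed.

(** Exhausting [D] by segments allows integrands that are singular at either end. *)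
Lemma FTC_exhaustion f F (D : set R) (u v : R^nat) l L :
  (forall k, u k < v k) ->
  nonincreasing_seq u -> nondecreasing_seq v ->
  D = \bigcup_k `[u k, v k]%classic ->
  (forall x, D x -> 0 <= f x) ->
  (forall x, D x -> {for x, continuous f}) ->
  (forall x, D x -> is_derive x 1 F (f x)) ->
  F (u k) @[k --> \oo] --> l -> F (v k) @[k --> \oo] --> L ->
  (\int[mu]_(x in D) (f x)%:E = (L - l)%:E)%E.
Proof.
move=> uv niu ndv DE f0 cf dF Fl FL.
have DI k x : u k <= x <= v k -> D x by move=> h; rewrite DE; exists k => //=; rewrite in_itv.
have : (\int[mu]_(x in `[u k, v k]) (f x)%:E)%E @[k --> \oo] --> (\int[mu]_(x in D) (f x)%:E)%E.
  rewrite DE; apply: ge0_nondecreasing_set_cvg_integral.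
  - move=> m k mk; rewrite subsetEset => x /=; rewrite !in_itv/= => /andP[ux xv].
    by rewrite (le_trans (niu _ _ mk) ux) (le_trans xv (ndv _ _ mk)).
  - by move=> k; exact: measurable_itv.
  - move=> k; apply/measurable_EFinP; apply: subspace_continuous_measurable_fun => //.
    by apply: continuous_in_subspaceT => x; rewrite inE /= in_itv/= => h; apply: cf; apply: (DI k).
  - by move=> k x /=; rewrite in_itv/= => h; rewrite lee_fin f0//; exact: (DI k).
have -> : (fun k => \int[mu]_(x in `[u k, v k]) (f x)%:E)%E = (fun k => (F (v k) - F (u k))%:E).
  apply/funext => k; apply: FTC_cc => // x h.
  - by apply: cf; exact: (DI k).
  - by apply: dF; exact: (DI k).
move=> h; apply: (cvg_unique _ h) => //.
apply: cvg_EFin; first exact: nearW.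
by apply: cvgB.
Qed.

End calculus.

Section cauchy_powers.
Variable R : realType.
Notation mu := (@lebesgue_measure R).

(** Antiderivatives of [(1 + x^2)^-(k+1)], by the recursion that integration by parts
    gives. *)
Fixpoint cauchy_prim (k : nat) (x : R) : R :=
  if k is k'.+1 then
    (2 * k%:R)^-1 * ((2 * k'%:R + 1) * cauchy_prim k' x + x * (1 + x ^+ 2) ^- k)
  else atan x.

(** The integral of [(1 + x^2)^-(k+1)] over the line, a Wallis type constant. *)
Definition cauchy_const (k : nat) : R := pi * (2 * k)`!%:R / (4 ^+ k * k`!%:R ^+ 2).

Let oneDx2 (x : R) : 1 + x ^+ 2 != 0.
Proof. by rewrite gt_eqF// ltr_pwDl// sqr_ge0. Qed.

Let derive_oneDx2 (x : R) : is_derive x 1 (fun y => 1 + y ^+ 2) (2 * x).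
Proof.
have := deriveD_fun (derive_cst_fun 1 x) (@deriveX_fun R idfun 1 x 1 (is_derive_id x 1)).
by rewrite add0r expr1 mulr1.
Qed.

Lemma derive_cauchy_prim k (x : R) :
  is_derive x 1 (cauchy_prim k) ((1 + x ^+ 2) ^- k.+1).
Proof.
elim: k => [|k IH] /=; first by rewrite expr1; exact: is_derive1_atan.
have d1 := deriveMl_fun (2 * k%:R + 1) IH.
have d2 := @deriveM_fun R idfun _ x _ _ (is_derive_id x 1) (@deriveXV_fun R (fun y => 1 + y ^+ 2) k x _ (oneDx2 x) (derive_oneDx2 x)).
have d3 := deriveMl_fun (2 * k.+1%:R)^-1 (deriveD_fun d1 d2).
apply: (@is_derive_eq _ _ _ _ _ _ _ _ d3); rewrite /=.
have -> : idfun x * (- k.+1%:R * (1 + x ^+ 2) ^- k.+2 * (2 * x)) =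
    - (2 * k.+1%:R) * (1 + x ^+ 2) ^- k.+2 * ((1 + x ^+ 2) - 1) by rewrite /=; ring.
set y := 1 + x ^+ 2; have y0 : y != 0 by exact: oneDx2.
rewrite !exprS -[k.+1%:R]natr1; field.
by rewrite y0 expf_neq0//= natr1 pnatr_eq0.
Qed.

Lemma cvg_cauchy_prim k : cauchy_prim k x @[x --> +oo] --> cauchy_const k / 2.
Proof.
elim: k => [|k IH].
  rewrite /cauchy_const muln0 fact0 expr0 expr1n !mulr1 divr1; exact: cvgy_atan.
have -> : cauchy_const k.+1 / 2 =
    (2 * k.+1%:R)^-1 * ((2 * k%:R + 1) * (cauchy_const k / 2) + 0).
  rewrite /cauchy_const mulnS !factS !natrM exprS -[(2 * k).+2%:R]natr1.
  rewrite -[(2 * k).+1%:R]natr1 -[k.+1%:R]natr1 natrM.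
  have k0 : k`!%:R != 0 :> R by rewrite pnatr_eq0 -lt0n fact_gt0.
  have k1 : k%:R + 1 != 0 :> R by rewrite natr1 pnatr_eq0.
  have p4 : (4 : R) ^+ k != 0 by rewrite expf_neq0// pnatr_eq0.
  by field; rewrite k0 k1 p4.
rewrite /=; apply: cvgMr; apply: cvgD; first by apply: cvgMr.
apply: (@squeeze_cvgr _ _ _ _ (cst 0) (fun x => x^-1)).
- near=> x; have x0 : 0 < x by near: x; exact: nbhs_pinfty_gt.
  have y0 : 0 < 1 + x ^+ 2 by rewrite ltr_pwDl// sqr_ge0.
  apply/andP; split; first by rewrite mulr_ge0 ?invr_ge0 ?exprn_ge0 ?ltW.
  rewrite ler_pdivrMr ?exprn_gt0// -ler_pdivrMl ?invr_gt0// invrK -expr2.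
  rewrite (@le_trans _ _ (1 + x ^+ 2))//; first by rewrite lerDr.
  by rewrite -{1}[1 + x ^+ 2]expr1 ler_weXn2l// lerDl sqr_ge0.
- exact: cvg_cst.
- by apply/gtr0_cvgV0; [near=> x; near: x; exact: nbhs_pinfty_gt|exact: cvg_id].
Unshelve. all: by end_near. Qed.

Lemma integral_cauchy_power k :
  (\int[mu]_x ((1 + x ^+ 2) ^- k.+1)%:E = (cauchy_const k)%:E)%E.
Proof.
have c x : {for x, continuous (fun x : R => (1 + x ^+ 2) ^- k.+1)}.
  exact: is_derive_continuous (@deriveXV_fun R (fun y => 1 + y ^+ 2) k x _ (oneDx2 x) (derive_oneDx2 x)).
have p0 (x : R) : 0 <= (1 + x ^+ 2) ^- k.+1.
  by rewrite invr_ge0 exprn_ge0// addr_ge0// sqr_ge0.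
rewrite ge0_symfun_integralT//; last by move=> x /=; rewrite sqrrN.
rewrite -set_itvcy.
have -> : (\int[mu]_(x in `[0%R, +oo[) ((1 + x ^+ 2) ^- k.+1)%:E =
    (cauchy_const k / 2 - cauchy_prim k 0)%:E)%E.
  apply: FTC_cy => //; first by move=> x _; exact: derive_cauchy_prim.
  exact: cvg_cauchy_prim.
have -> : cauchy_prim k 0 = 0.
  by elim: k {c p0} => [|k IH] /=; [exact: atan0|rewrite IH mul0r mulr0 addr0 mulr0].
by rewrite subr0 -EFinM; congr EFin; field.
Qed.

End cauchy_powers.

(** * Integrals of the kernel over the Heisenberg group *)

Section kernel_integrals.
Variable R : realType.
Notation mu := (@lebesgue_measure R).

Lemma measurable_real_inv_pow d (T : measurableType d) (f : T -> R) k :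
  measurable_fun setT f -> measurable_fun setT (fun x => (f x ^- k)%:E).
Proof.
move=> mf; apply/measurable_EFinP; apply: measurable_fun_inv; exact: measurable_funX.
Qed.

Lemma integral_punctured (f : measurableTypeR R -> \bar R) : measurable_fun setT f ->
  (\int[mu]_(x in setT `\ 0%R) f x = \int[mu]_x f x)%E.
Proof.
move=> mf; apply: integral_setD1; first exact: measurableD.
by apply: measurable_funTS.
Qed.

Lemma integral_radial_half (B E : R) m : 0 < B -> 0 < E ->
  (\int[mu]_x (`|x| * (B + x ^+ 2 * E) ^- m.+2)%:E = ((E * m.+1%:R)^-1 * B ^- m.+1)%:E)%E.
Proof.
move=> B0 E0.
have p0 (x : R) : 0 < B + x ^+ 2 * E by rewrite ltr_pwDl// mulr_ge0 ?sqr_ge0// ltW.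
have d0 (x : R) : is_derive x 1 (fun y : R => B + y ^+ 2 * E) (2 * E * x).
  have := deriveD_fun (derive_cst_fun B x)
    (deriveMl_fun E (@deriveX_fun R idfun 1 x 1 (is_derive_id x 1))).
  rewrite (_ : (fun y => _) = (fun y : R => B + y ^+ 2 * E)); last first.
    by apply/funext => y /=; rewrite (mulrC E).
  by move=> h; apply: (@is_derive_eq _ _ _ _ _ _ _ _ h); rewrite /= expr1; ring.
have dp k x := @deriveXV_fun R (fun y : R => B + y ^+ 2 * E) k x _ (lt0r_neq0 (p0 x)) (d0 x).
have cp k x : {for x, continuous (fun y : R => (B + y ^+ 2 * E) ^- k.+1)}.
  exact: is_derive_continuous (dp k x).
rewrite ge0_symfun_integralT; last 3 first.
- by move=> x; rewrite mulr_ge0// invr_ge0 exprn_ge0// ltW.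
- by move=> x; apply: cvgM; [exact: norm_continuous|exact: cp].
- by move=> x /=; rewrite normrN sqrrN.
rewrite -set_itvcy.
pose F x := - (2 * E * m.+1%:R)^-1 * (B + x ^+ 2 * E) ^- m.+1.
have m0 : m.+1%:R != 0 :> R by rewrite pnatr_eq0.
have E1 : E != 0 by rewrite gt_eqF.
transitivity (2%:E * \int[mu]_(x in `[0%R, +oo[) (x * (B + x ^+ 2 * E) ^- m.+2)%:E)%E.
  congr (_ * _)%E; apply: eq_integral => x; rewrite inE/= in_itv/= andbT => x0.
  by rewrite ger0_norm.
have -> : (\int[mu]_(x in `[0%R, +oo[) (x * (B + x ^+ 2 * E) ^- m.+2)%:E = (0 - F 0)%:E)%E.
  apply: FTC_cy.
  - by move=> x x0; rewrite mulr_ge0// invr_ge0 exprn_ge0// ltW.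
  - by move=> x x0; apply: cvgM; [exact: cvg_id|exact: cp].
  - move=> x x0; have h := deriveMl_fun (- (2 * E * m.+1%:R)^-1) (dp m x).
    apply: (@is_derive_eq _ _ _ _ _ _ _ _ h) => /=.
    by move: (m.+1%:R) m0 => M M0; set Y := (_ ^+ _)^-1; field; rewrite M0 E1.
  - rewrite -[0](mulr0 (- (2 * E * m.+1%:R)^-1)); apply: cvgMr.
    apply: (@squeeze_cvgr _ _ _ _ (cst 0) (fun x => E^-1 * x^-1)).
    + near=> x; have x1 : 1 < x by near: x; exact: nbhs_pinfty_gt.
      have xE : E^-1 < x by near: x; apply: nbhs_pinfty_gt; exact: num_real.
      have x0 : 0 < x by rewrite (lt_trans ltr01).
      apply/andP; split; first by rewrite invr_ge0 exprn_ge0// ltW.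
      rewrite -invfM lef_pV2 ?posrE ?mulr_gt0 ?exprn_gt0//.
      have h1 : E * x <= x ^+ 2 * E by rewrite mulrC ler_pM2r// expr2 ler_peMr// ltW.
      have h2 : 1 <= E * x by rewrite -ler_pdivrMl// mulr1 ltW.
      have h3 : x ^+ 2 * E <= B + x ^+ 2 * E by rewrite lerDr ltW.
      apply: (le_trans (le_trans h1 h3)); rewrite -{1}[B + _]expr1 ler_weXn2l//.
      exact: le_trans h2 (le_trans h1 h3).
    + exact: cvg_cst.
    + rewrite -[0](mulr0 E^-1); apply: cvgMr.
      by apply/gtr0_cvgV0; [near=> x; near: x; exact: nbhs_pinfty_gt|exact: cvg_id].
rewrite /F -EFinM expr0n/= mul0r addr0; congr EFin; have B1 : B ^+ m.+1 != 0 by rewrite expf_neq0// gt_eqF.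
by move: (m.+1%:R) m0 => M M0; set Y := B ^+ _ in B1 *; field; rewrite M0 E1 B1.
Unshelve. all: by end_near. Qed.

(** In place of polar coordinates, the substitution [y = `|x| v] separates the
    variables: the inner integral in [x] becomes elementary and the outer one is that
    of [1 / (1 + v^2)]. *)
Lemma integral_radial (B : R) m : 0 < B ->
  (\int[lebesgueC R]_z ((B + (complex.Re z ^+ 2 + complex.Im z ^+ 2)) ^- m.+2)%:E =
   (pi / m.+1%:R * B ^- m.+1)%:E)%E.
Proof.
move=> B0.
rewrite ge0_integral_lebesgueC/=; last 2 first.
- apply: measurable_real_inv_pow; apply: measurable_funD => //.
  by apply: measurable_funD; apply: measurable_funX; [exact: measurable_Re|exact: measurable_Im].
- by move=> z; rewrite lee_fin invr_ge0 exprn_ge0// addr_ge0 ?(ltW B0)// addr_ge0// sqr_ge0.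
pose G (z : measurableTypeR R * measurableTypeR R) : \bar R :=
  (`|z.1| * (B + z.1 ^+ 2 * (1 + z.2 ^+ 2)) ^- m.+2)%:E.
have G0 z : (0 <= G z)%E.
  rewrite lee_fin mulr_ge0// invr_ge0 exprn_ge0// addr_ge0 ?(ltW B0)// mulr_ge0 ?sqr_ge0//.
  by rewrite addr_ge0// sqr_ge0.
have mG : measurable_fun setT G.
  apply/measurable_EFinP; apply: measurable_funM.
    exact: (measurableT_comp (@normr_measurable R setT) measurable_fst).
  apply: measurable_fun_inv; apply: measurable_funX; apply: measurable_funD => //.
  apply: measurable_funM; first by apply: measurable_funX; exact: measurable_fst.
  by apply: measurable_funD => //; apply: measurable_funX; exact: measurable_snd.
transitivity (\int[mu]_x \int[mu]_v G (x, v))%E.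
  have mF : measurable_fun [set: measurableTypeR R]
      (fun x : R => \int[mu]_y ((B + (x ^+ 2 + y ^+ 2)) ^- m.+2)%:E)%E.
    apply: (@measurable_ge0_integral _ _ _ _ _ mu
      (fun z : measurableTypeR R * measurableTypeR R => ((B + (z.1 ^+ 2 + z.2 ^+ 2)) ^- m.+2)%:E)).
      apply: measurable_real_inv_pow; apply: measurable_funD => //.
      by apply: measurable_funD; apply: measurable_funX; [exact: measurable_fst|exact: measurable_snd].
    by move=> z; rewrite lee_fin invr_ge0 exprn_ge0// addr_ge0 ?(ltW B0)// addr_ge0// sqr_ge0.
  (* The substitution y = |x| v is singular at x = 0, which is removed. *)
  rewrite -(integral_punctured mF).
  rewrite -(integral_punctured (@measurable_ge0_integral _ _ _ _ _ mu _ mG G0)).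
  apply: eq_integral => x; rewrite inE /= => -[_ /eqP x0].
  have nx0 : 0 < `|x| by rewrite normr_gt0.
  have mh : measurable_fun [set: measurableTypeR R]
      ((fun y : R => ((B + (x ^+ 2 + y ^+ 2)) ^- m.+2)%:E) : measurableTypeR R -> \bar R).
    apply: measurable_real_inv_pow; apply: measurable_funD => //.
    by apply: measurable_funD => //; apply: measurable_funX.
  have h0 (y : R) : (0 <= ((B + (x ^+ 2 + y ^+ 2)) ^- m.+2)%:E)%E.
    by rewrite lee_fin invr_ge0 exprn_ge0// addr_ge0 ?(ltW B0)// addr_ge0// sqr_ge0.
  have := eq_mul_of_mulV nx0 (@ge0_integral_affine _ `|x| 0 _ nx0 mh h0).
  move=> ->; rewrite -ge0_integralZl//; last first.
    apply: measurable_real_inv_pow; apply: measurable_funD => //.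
    apply: measurable_funD => //; apply: measurable_funX; exact: measurable_funD.
  apply: eq_integral => v _; rewrite /G /= -EFinM addr0 exprMn real_normK ?num_real//.
  by rewrite mulrDr mulr1.
rewrite (ge0_integral_prodm_swap _ _ mG G0).
transitivity (\int[mu]_v ((m.+1%:R^-1 * B ^- m.+1)%:E * ((1 + v ^+ 2) ^- 1)%:E))%E.
  apply: eq_integral => v _; rewrite /G/= integral_radial_half//; last first.
    by rewrite ltr_pwDl// sqr_ge0.
  by rewrite -EFinM expr1 invfM; congr EFin; ring.
rewrite ge0_integralZl//; last 3 first.
- by apply: measurable_real_inv_pow; apply: measurable_funD => //; apply: measurable_funX.
- by move=> v _; rewrite lee_fin invr_ge0 exprn_ge0// addr_ge0// sqr_ge0.
- by rewrite lee_fin mulr_ge0// invr_ge0// exprn_ge0// ltW.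
rewrite integral_cauchy_power /cauchy_const muln0 fact0 expr0 expr1n !mulr1 divr1.
by rewrite -EFinM; congr EFin; ring.
Qed.

Lemma nsq_cons n (z : R[i]) (u : n.-tuple R[i]) :
  nsq (cons_pair (z, u)) = complex.Re z ^+ 2 + complex.Im z ^+ 2 + nsq u.
Proof.
by rewrite /nsq big_ord_recl tnth0; congr (_ + _); apply: eq_bigr => j _; rewrite !tnthS.
Qed.

(** The coordinates are integrated out one at a time; each of them lowers the
    exponent by one. *)
Lemma integral_nsq n (B : R) m : 0 < B ->
  (\int[tuple_measure (lebesgueC R) n]_u ((B + nsq u) ^- (m + n).+1)%:E =
   (pi ^+ n * m`!%:R / (m + n)`!%:R * B ^- m.+1)%:E)%E.
Proof.
elim: n B m => [|n IH] B m B0.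
  rewrite ge0_integral_tuple0; last first.
    by apply: measurable_real_inv_pow; apply: measurable_funD => //; exact: measurable_fun_nsq.
  rewrite addn0 expr0 mul1r divff ?mul1r; last by rewrite pnatr_eq0 -lt0n fact_gt0.
  by rewrite /nsq big_ord0 addr0.
rewrite ge0_integral_tupleS; last 2 first.
- by apply: measurable_real_inv_pow; apply: measurable_funD => //; exact: measurable_fun_nsq.
- by move=> u; rewrite lee_fin invr_ge0 exprn_ge0// addr_ge0 ?(ltW B0)// nsq_ge0.
transitivity (\int[lebesgueC R]_z ((pi ^+ n * (m.+1)`!%:R / (m.+1 + n)`!%:R)%:E *
   ((B + (complex.Re z ^+ 2 + complex.Im z ^+ 2)) ^- m.+2)%:E))%E.
  apply: eq_integral => z _; rewrite -EFinM -IH; last first.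
    by rewrite ltr_pwDl// addr_ge0// sqr_ge0.
  by apply: eq_integral => u _; rewrite nsq_cons addrA addnS addSn.
rewrite ge0_integralZl//; last 3 first.
- apply: measurable_real_inv_pow; apply: measurable_funD => //.
  by apply: measurable_funD; apply: measurable_funX; [exact: measurable_Re|exact: measurable_Im].
- by move=> z _; rewrite lee_fin invr_ge0 exprn_ge0// addr_ge0 ?(ltW B0)// addr_ge0// sqr_ge0.
- by rewrite lee_fin mulr_ge0// ?invr_ge0// mulr_ge0// exprn_ge0// pi_ge0.
rewrite integral_radial// -EFinM addSnnS; congr EFin.
have f0 : (m + n.+1)`!%:R != 0 :> R by rewrite pnatr_eq0 -lt0n fact_gt0.
have m0 : m.+1%:R != 0 :> R by rewrite pnatr_eq0.
rewrite [m.+1`!]factS natrM [pi ^+ n.+1]exprS; set b := B ^- _.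
by move: (m.+1%:R) m0 => M m0; field; rewrite m0 f0.
Qed.

(** The central variable is scaled by [A + nsq u] and integrated first; the
    factorials then cancel against those of the Bergman kernel. *)
Lemma integral_haar_qker n (A : R) : 0 < A ->
  (\int[haar R n]_h (bconst R n / (((A + nsq h.1) ^+ 2 + h.2 ^+ 2) / 4) ^+ n.+2)%:E =
   (n.+2%:R * A ^- n.+3)%:E)%E.
Proof.
move=> A0.
have mF : measurable_fun setT (fun h : heis R n =>
    (bconst R n / (((A + nsq h.1) ^+ 2 + h.2 ^+ 2) / 4) ^+ n.+2)%:E).
  apply/measurable_EFinP; apply: measurable_funM => //; apply: measurable_fun_inv.
  apply: measurable_funX; apply: measurable_funM => //; apply: measurable_funD; apply: measurable_funX.
    by apply: measurable_funD => //; apply: measurable_fun_nsq; exact: measurable_fst.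
  exact: measurable_snd.
have F0 (h : heis R n) : (0 <= (bconst R n / (((A + nsq h.1) ^+ 2 + h.2 ^+ 2) / 4) ^+ n.+2)%:E)%E.
  by rewrite lee_fin divr_ge0 ?(ltW (bconst_gt0 _ _))// exprn_ge0// divr_ge0// addr_ge0// sqr_ge0.
rewrite (ge0_integral_prodm _ _ mF F0) /=.
have mF1 (A' : R) k : measurable_fun [set: measurableTypeR R] ((fun t : R => ((A' + t ^+ 2) ^- k)%:E) : measurableTypeR R -> \bar R).
  by apply: measurable_real_inv_pow; apply: measurable_funD => //; apply: measurable_funX.
transitivity (\int[tuple_measure (lebesgueC R) n]_u
    ((bconst R n * 4 ^+ n.+2 * cauchy_const R n.+1)%:E * ((A + nsq u) ^- (n.+2 + n).+1)%:E))%E.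
  apply: eq_integral => u _.
  have A'0 : 0 < A + nsq u by rewrite ltr_pwDl// nsq_ge0.
  move: (A + nsq u) A'0 => A' A'0.
  have F1 k (t : R) : (0 <= ((A' ^+ 2 + t ^+ 2) ^- k)%:E)%E.
    by rewrite lee_fin invr_ge0 exprn_ge0// addr_ge0// sqr_ge0.
  transitivity (\int[mu]_t ((bconst R n * 4 ^+ n.+2)%:E * ((A' ^+ 2 + t ^+ 2) ^- n.+2)%:E))%E.
    apply: eq_integral => t _; rewrite -EFinM; congr EFin.
    by rewrite expr_div_n invf_div mulrA.
  rewrite ge0_integralZl//; last by rewrite lee_fin mulr_ge0 ?exprn_ge0 ?(ltW (bconst_gt0 _ _)).
  rewrite (eq_mul_of_mulV A'0 (@ge0_integral_affine _ A' 0 _ A'0 (mF1 (A' ^+ 2) n.+2) (F1 _))).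
  rewrite [X in (_ * (_ * X))%E](_ : _ = ((A' ^- (2 * n.+2))%:E * (cauchy_const R n.+1)%:E)%E); last first.
    rewrite -integral_cauchy_power -ge0_integralZl//; last 2 first.
    - by move=> t _; rewrite lee_fin invr_ge0 exprn_ge0// addr_ge0// sqr_ge0.
    - by rewrite lee_fin invr_ge0 exprn_ge0// ltW.
    apply: eq_integral => t _; rewrite -EFinM addr0 exprMn -{1}[A' ^+ 2]mulr1 -mulrDr exprMn.
    by rewrite -exprM invfM.
  rewrite -!EFinM; congr EFin; rewrite (_ : (2 * n.+2 = (n.+2 + n).+2)%N); last by rewrite mul2n -addnn !addnS.
  have A1 : A' != 0 by rewrite gt_eqF.
  by rewrite [A' ^+ (_ + _).+2]exprS; field; rewrite A1 expf_neq0.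
rewrite ge0_integralZl//; last 3 first.
- by apply: measurable_real_inv_pow; apply: measurable_funD => //; exact: measurable_fun_nsq.
- by move=> u _; rewrite lee_fin invr_ge0 exprn_ge0// addr_ge0 ?(ltW A0)// nsq_ge0.
- rewrite lee_fin mulr_ge0//; first by rewrite mulr_ge0 ?exprn_ge0 ?(ltW (bconst_gt0 _ _)).
  by rewrite divr_ge0 ?mulr_ge0 ?pi_ge0 ?exprn_ge0.
rewrite integral_nsq// -EFinM; congr EFin; rewrite mulrA; congr (_ * _).
rewrite /bconst /cauchy_const.
have -> : (2 * n.+1 = n.+2 + n)%N by rewrite mul2n -addnn addnS.
have f1 k : k`!%:R != 0 :> R by rewrite pnatr_eq0 -lt0n fact_gt0.
have pi0 : pi != 0 :> R by rewrite gt_eqF// pi_gt0.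
rewrite [n.+2`!]factS natrM !(exprS pi) !(exprS 4).
have pn : pi ^+ n != 0 :> R by rewrite expf_neq0.
have qn : 4 ^+ n != 0 :> R by rewrite expf_neq0// pnatr_eq0.
move: (f1 n.+1) (f1 (n.+2 + n)%N); move: (_ `!%:R) (_ `!%:R) (n.+2%:R) => a b c a0 b0.
move: pi0 pn qn; move: (4 ^+ n) => Q; move: (@pi R) => t; move: (t ^+ n) => P pi0 pn qn.
by field; rewrite ?a0 ?b0 ?pi0 ?pn ?qn.
Qed.

Lemma integral_qker n (g : measurableTypeR R -> \bar R) :
  measurable_fun setT g -> (forall x, 0 <= g x)%E ->
  (\int[haarR R n]_y ((qker y)%:E * g y.2) =
   \int[mu]_(x in `]0%R, +oo[) ((n.+2%:R * (1 + x) ^- n.+3)%:E * g x))%E.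
Proof.
move=> mg g0.
have mK : measurable_fun setT (fun y : heis R n * measurableTypeR R => ((qker y)%:E * g y.2)%E).
  apply: emeasurable_funM; first by apply/measurable_EFinP; exact: measurable_qker.
  exact: (measurableT_comp mg measurable_snd).
have K0 (y : heis R n * measurableTypeR R) : (0 <= (qker y)%:E * g y.2)%E.
  by rewrite mule_ge0// lee_fin qker_ge0.
rewrite (ge0_integral_prodm _ _ mK K0) (ge0_integral_prodm_swap _ _ mK K0) [RHS]integral_mkcond.
apply: eq_integral => x _; rewrite patchE; case: ifPn => x0; last first.
  rewrite notin_setE /= in_itv/= andbT in x0; move/negP/negbTE : x0 => x0.
  by rewrite /qker /= x0; under eq_integral do rewrite mul0e; rewrite integral0.
rewrite inE /= in_itv/= andbT in x0.
rewrite [LHS](_ : _ = \int[haar R n]_h ((qker (h, x))%:E * g x))%E//.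
rewrite ge0_integralZr//; last 2 first.
- apply/measurable_EFinP.
  have mp : measurable_fun setT (fun h : heis R n => (h, x : measurableTypeR R)) by exact: measurable_fun_pair.
  exact: (measurableT_comp (@measurable_qker R n) mp).
- by move=> h _; rewrite lee_fin qker_ge0.
congr (_ * _)%E; rewrite -integral_haar_qker; last by rewrite addr_gt0.
by apply: eq_integral => h _; rewrite /qker /= x0.
Qed.

End kernel_integrals.

(** * The partial fraction expansion of the cosecant *)

Section cosecant.
Variable R : realType.
Implicit Types (s x y l : R).

Lemma MVT_pos (f df : R -> R) x : 0 < x ->
  (forall y, is_derive y 1 f (df y)) ->
  exists2 c, 0 < c < x & f x - f 0 = df c * x.
Proof.
move=> x0 d; have [|c] := @MVT R f df 0 x x0 (fun y _ => d y).
  by apply: continuous_subspaceT => y; exact: is_derive_continuous (d y).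
by rewrite in_itv/= subr0 => h1 h2; exists c.
Qed.

Lemma norm_sin_le x : 0 <= x -> `|sin x| <= x.
Proof.
rewrite le_eqVlt => /predU1P[<-|x0]; first by rewrite sin0 normr0.
have [c _] := MVT_pos x0 (@is_derive_sin R).
by rewrite sin0 subr0 => ->; rewrite normrM (gtr0_norm x0) ler_piMl ?cos_max// ltW.
Qed.

Lemma one_sub_cos_le x : 0 <= x -> `|cos x - 1| <= x ^+ 2 / 2.
Proof.
move=> x0; have -> : cos x - 1 = - (2 * sin (x / 2) ^+ 2).
  have -> : cos x = cos ((x / 2) *+ 2) by rewrite -mulr_natr; congr cos; field.
  by rewrite cos_mulr2n cos2sin2; ring.
rewrite normrN normrM normrX ger0_norm//.
have h : `|sin (x / 2)| <= x / 2 by apply: norm_sin_le; rewrite divr_ge0.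
have -> : x ^+ 2 / 2 = 2 * (x / 2) ^+ 2 by field.
by rewrite ler_pM2l// lerXn2r// nnegrE// divr_ge0.
Qed.

(** A weak form of the Jordan inequality; only the positivity of the constant matters. *)
Lemma sin_half_ge x : 0 < x <= pi -> x / 4 <= sin (x / 2).
Proof.
move=> /andP[x0 xpi].
have pi0 : 0 < pi :> R := pi_gt0 R.
have c2 : 2 * cos (pi / 4) ^+ 2 = 1 :> R.
  have := cos_pihalf R; rewrite (_ : pi / 2 = (pi / 4) *+ 2); last first.
    by rewrite -mulr_natr; field.
  by rewrite cos_mulr2n => /eqP; rewrite subr_eq0 -mulr_natl => /eqP.
have c0 : 0 <= cos (pi / 4) :> R by apply: cos_ge0_pihalf; apply/andP; split; lra.
have cle y : 0 <= y <= pi / 4 -> cos (pi / 4) <= cos y.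
  move=> /andP[y0 y1]; case: (ltgtP y (pi / 4)) => [yl||->//].
    by rewrite ltW// ltr_cos// in_itv/=; apply/andP; split; lra.
  by move=> h; have := lt_le_trans h y1; rewrite ltxx.
have x40 : 0 < x / 4 by rewrite divr_gt0.
have -> : sin (x / 2) = 2 * (cos (x / 4) * sin (x / 4)).
  rewrite -(_ : (x / 4) *+ 2 = x / 2); last by rewrite -mulr_natr; field.
  by rewrite sin_mulr2n -mulr_natl.
have [c /andP[cl cr]] := MVT_pos x40 (@is_derive_sin R).
rewrite sin0 subr0 => ->.
have h1 : cos (pi / 4) <= cos (x / 4) by apply: cle; apply/andP; split; lra.
have h2 : cos (pi / 4) <= cos c by apply: cle; apply/andP; split; lra.
have h3 : cos (pi / 4) ^+ 2 <= cos (x / 4) * cos c by rewrite expr2 ler_pM.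
have h4 : 1 <= 2 * (cos (x / 4) * cos c) by lra.
by rewrite [cos _ * (_ * _)]mulrA mulrA ler_peMl// ltW.
Qed.

(** The Dirichlet kernel [1 + 2 cos x + ... + 2 cos (K x)]. *)
Fixpoint dirichlet (K : nat) x : R :=
  if K is K'.+1 then dirichlet K' x + 2 * cos (K%:R * x) else 1.

Lemma sin_dirichlet K x : sin (x / 2) * dirichlet K x = sin ((K%:R + 2^-1) * x).
Proof.
elim: K => [|K IH] /=; first by rewrite mulr1 add0r mulrC.
rewrite mulrDr IH.
have -> : (K%:R + 2^-1) * x = K.+1%:R * x - x / 2 by rewrite -natr1; field.
have -> : (K.+1%:R + 2^-1) * x = K.+1%:R * x + x / 2 by field.
by rewrite sinB sinD; ring.
Qed.

(** The antiderivative of [(cos (s x) - 1) D_K(x)] that vanishes at 0. The factor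
    [cos (s x) - 1] absorbs the singularity of [1 / sin (x / 2)] in the kernel. *)
Fixpoint dirichlet_prim s (K : nat) x : R :=
  if K is K'.+1 then
    dirichlet_prim s K' x + (sin ((s + K%:R) * x) / (s + K%:R) + sin ((s - K%:R) * x) / (s - K%:R)
      - 2 * (sin (K%:R * x) / K%:R))
  else sin (s * x) / s - x.

(** Partial sums of the expansion of [pi / sin (pi s)] in partial fractions. *)
Fixpoint cosec_sum s (K : nat) : R :=
  if K is K'.+1 then cosec_sum s K' + (-1) ^+ K * ((s + K%:R)^-1 + (s - K%:R)^-1) else s^-1.

Lemma is_derive_sinl c x : is_derive x 1 (fun y => sin (c * y)) (c * cos (c * x)).
Proof.
have d1 := deriveMl_fun c (is_derive_id x (1 : R)).
have d2 := @is_derive1_comp _ sin (fun y : R => c * y) x _ _ (is_derive_sin (c * x)) d1.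
by apply: (@is_derive_eq _ _ _ _ _ _ _ _ d2); ring.
Qed.

Lemma is_derive_cosl c x : is_derive x 1 (fun y => cos (c * y)) (- (c * sin (c * x))).
Proof.
have d1 := deriveMl_fun c (is_derive_id x (1 : R)).
have d2 := @is_derive1_comp _ cos (fun y : R => c * y) x _ _ (is_derive_cos (c * x)) d1.
by apply: (@is_derive_eq _ _ _ _ _ _ _ _ d2); ring.
Qed.

Lemma is_derive_sinZ c x : c != 0 -> is_derive x 1 (fun y => sin (c * y) / c) (cos (c * x)).
Proof.
move=> c0; have d3 := deriveMl_fun c^-1 (is_derive_sinl c x).
rewrite (_ : (fun y => _) = (fun y : R => c^-1 * sin (c * y))); last first.
  by apply/funext => y /=; rewrite mulrC.
by apply: (@is_derive_eq _ _ _ _ _ _ _ _ d3); field.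
Qed.

Lemma derive_dirichlet_prim s K x : 0 < s < 1 ->
  is_derive x 1 (dirichlet_prim s K) ((cos (s * x) - 1) * dirichlet K x).
Proof.
move=> /andP[s0 s1]; elim: K => [|K IH] /=.
  by rewrite mulr1; exact: (deriveB_fun (is_derive_sinZ x (lt0r_neq0 s0)) (is_derive_id x (1 : R))).
have K0 : (0 : R) < K.+1%:R by rewrite ltr0n.
have K1 : (1 : R) <= K.+1%:R by rewrite ler1n.
have n1 : s + K.+1%:R != 0 by rewrite gt_eqF// addr_gt0.
have n2 : s - K.+1%:R != 0 by rewrite lt_eqF// subr_lt0 (lt_le_trans s1).
have d := deriveD_fun IH (deriveB_fun (deriveD_fun (is_derive_sinZ x n1) (is_derive_sinZ x n2))
  (deriveMl_fun 2 (is_derive_sinZ x (lt0r_neq0 K0)))).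
apply: (@is_derive_eq _ _ _ _ _ _ _ _ d).
by rewrite [(s + _) * x]mulrDl [(s - _) * x]mulrBl cosD cosB; ring.
Qed.

Lemma dirichlet_prim0 s K : dirichlet_prim s K 0 = 0.
Proof. by elim: K => [|K IH] /=; rewrite ?IH !mulr0 sin0 !mul0r ?mulr0 ?subr0 ?addr0. Qed.

Lemma sin_addnpi x K : sin (x + K%:R * pi) = (-1) ^+ K * sin x.
Proof.
elim: K => [|K IH]; first by rewrite mul0r addr0 expr0 mul1r.
by rewrite -natr1 mulrDl mul1r addrA sinDpi IH exprS; ring.
Qed.

Lemma sin_subnpi x K : sin (x - K%:R * pi) = (-1) ^+ K * sin x.
Proof.
have := sin_addnpi (x - K%:R * pi) K; rewrite subrK => ->.
by rewrite mulrA -exprD addnn -mul2n exprM sqrrN expr1n expr1n mul1r.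
Qed.

Lemma sin_npi K : sin (K%:R * pi) = 0 :> R.
Proof. by have := sin_addnpi 0 K; rewrite add0r sin0 mulr0. Qed.

(** The sines at the multiples of [pi] turn the antiderivative into a partial sum of
    the cosecant series. *)
Lemma dirichlet_prim_pi s K : dirichlet_prim s K pi = sin (pi * s) * cosec_sum s K - pi.
Proof.
elim: K => [|K IH] /=; first by rewrite [s * pi]mulrC.
rewrite IH [(s + _) * pi]mulrDl [(s - _) * pi]mulrBl sin_npi sin_addnpi sin_subnpi.
by rewrite [s * pi]mulrC; ring.
Qed.

(** A quantitative Riemann-Lebesgue lemma. The derivative is [g(x) sin (l x)], with [g]
    bounded and of bounded derivative up to 0. Adding the boundary term
    [g(x) cos (l x) / l] leaves a function with derivative [g'(x) cos (l x) / l], to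
    which the mean value theorem applies. *)
Lemma dirichlet_prim_pi_le s K : 0 < s < 1 ->
  `|dirichlet_prim s K pi| <= (2 + 8 * pi) / (K%:R + 2^-1).
Proof.
move=> s01; have /andP[s0 s1] := s01.
have pi0 : 0 < pi :> R := pi_gt0 R.
set l := K%:R + 2^-1; have l0 : 0 < l by rewrite ltr_wpDl.
pose g x := (cos (s * x) - 1) / sin (x / 2).
pose dg x := (- s * sin (s * x)) / sin (x / 2) - (cos (s * x) - 1) * (cos (x / 2) / 2) / sin (x / 2) ^+ 2.
have S0 x : 0 < x <= pi -> 0 < sin (x / 2).
  by move=> x0; apply: lt_le_trans (sin_half_ge x0); case/andP: x0 => x0 _; rewrite divr_gt0.
have dsin x : is_derive x 1 (fun y : R => sin (y / 2)) (cos (x / 2) / 2).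
  rewrite (_ : (fun y => _) = (fun y : R => sin (2^-1 * y))); last first.
    by apply/funext => y; rewrite mulrC.
  have h := is_derive_sinl 2^-1 x.
  by apply: (@is_derive_eq _ _ _ _ _ _ _ _ h); rewrite mulrC [_ * x]mulrC.
have dcos x : is_derive x 1 (fun y : R => cos (s * y) - 1) (- s * sin (s * x)).
  have d3 := deriveB_fun (is_derive_cosl s x) (derive_cst_fun 1 x).
  by apply: (@is_derive_eq _ _ _ _ _ _ _ _ d3); ring.
have dgE x : 0 < x <= pi -> is_derive x 1 g (dg x).
  move=> x0; have d := deriveM_fun (dcos x) (deriveV_fun (lt0r_neq0 (S0 _ x0)) (dsin x)).
  by apply: (@is_derive_eq _ _ _ _ _ _ _ _ d); rewrite /dg; field; exact: lt0r_neq0 (S0 _ x0).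
have sx2 x : 0 < x -> `|cos (s * x) - 1| <= x ^+ 2 / 2.
  move=> x0; have sx0 : 0 <= s * x by rewrite mulr_ge0// ltW.
  rewrite (le_trans (one_sub_cos_le sx0))// ler_pM2r// exprMn ler_piMl ?sqr_ge0//.
  by rewrite exprn_ile1// ltW.
have gle x : 0 < x <= pi -> `|g x| <= 2 * x.
  move=> x0p; have /andP[x0 _] := x0p.
  rewrite normrM normrV ?unitfE ?gt_eqF ?S0// (gtr0_norm (S0 _ x0p)) ler_pdivrMr ?S0//.
  rewrite (le_trans (sx2 _ x0))// (_ : x ^+ 2 / 2 = 2 * x * (x / 4)); last by field.
  by rewrite ler_pM2l ?mulr_gt0// sin_half_ge.
have dgle x : 0 < x <= pi -> `|dg x| <= 8.
  move=> x0p; have /andP[x0 _] := x0p; have Sx := S0 _ x0p; have Sge := sin_half_ge x0p.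
  rewrite (le_trans (ler_normB _ _))//; apply: (@le_trans _ _ (4 + 4)); last by lra.
  apply: lerD.
    rewrite normrM normrV ?unitfE ?gt_eqF// (gtr0_norm Sx) ler_pdivrMr//.
    apply: (@le_trans _ _ x); last by rewrite -ler_pdivrMl// mulrC.
    rewrite normrM normrN (gtr0_norm s0) -[leRHS]mul1r ler_pM ?(ltW s0) ?(ltW s1)//.
    rewrite (le_trans (norm_sin_le _)) ?mulr_ge0 ?(ltW s0) ?(ltW x0)//.
    by rewrite ler_piMl ?(ltW x0) ?(ltW s1).
  rewrite normrM normrV ?unitfE ?expf_neq0 ?gt_eqF// normrX (gtr0_norm Sx) ler_pdivrMr ?exprn_gt0//.
  apply: (@le_trans _ _ (x ^+ 2 / 4)).
    rewrite normrM (_ : x ^+ 2 / 4 = x ^+ 2 / 2 * 2^-1); last by field.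
    by rewrite ler_pM ?sx2// normrM [`|2^-1|]ger0_norm ?invr_ge0// ler_piMl ?cos_max// invr_ge0.
  rewrite (_ : x ^+ 2 / 4 = 4 * (x / 4) ^+ 2); last by field.
  by rewrite ler_pM2l// lerXn2r ?nnegrE ?divr_ge0 ?(ltW x0) ?(ltW Sx).
(* The boundary term makes the oscillating part of the derivative cancel. *)
pose H x := dirichlet_prim s K x + g x * (cos (l * x) / l).
have g0 : g 0 = 0 by rewrite /g mulr0 cos0 subrr mul0r.
have gpi : `|g pi| <= 2.
  rewrite /g sin_pihalf divr1 (le_trans (ler_normB _ _))// normr1.
  by rewrite -[leRHS]/(1 + 1) lerD2r cos_max.
have dcl x : is_derive x 1 (fun y => cos (l * y) / l) (- sin (l * x)).
  have h := deriveM_fun (is_derive_cosl l x) (derive_cst_fun l^-1 x).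
  by apply: (@is_derive_eq _ _ _ _ _ _ _ _ h); field; exact: lt0r_neq0.
have dH x : 0 < x <= pi -> is_derive x 1 H (dg x * (cos (l * x) / l)).
  move=> x0; have h := deriveD_fun (derive_dirichlet_prim K x s01) (deriveM_fun (dgE _ x0) (dcl x)).
  apply: (@is_derive_eq _ _ _ _ _ _ _ _ h).
  rewrite -sin_dirichlet /g; have := lt0r_neq0 (S0 _ x0).
  by move: (dg x) (cos (l * x) / l) (sin (x / 2)) => u v S Sn0; field.
have [c cI] : exists2 c, 0 < c < pi & H pi - H 0 = (dg c * (cos (l * c) / l)) * pi.
  have [||c cI E] := @MVT R H (fun x => dg x * (cos (l * x) / l)) 0 pi pi0.
  - by move=> x; rewrite in_itv/= => /andP[x0 /ltW x1]; apply: dH; rewrite x0.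
  - apply/(continuous_within_itvP _ pi0); split.
    + by move=> x; rewrite in_itv/= => /andP[x0 /ltW x1]; apply: is_derive_continuous (dH x _); rewrite x0.
    + have c1 : dirichlet_prim s K x @[x --> 0^'+] --> dirichlet_prim s K 0.
        by apply: cvg_at_right_filter; exact: is_derive_continuous (derive_dirichlet_prim K 0 s01).
      have c2 : cos (l * x) / l @[x --> 0^'+] --> cos (l * 0) / l.
        by apply: cvg_at_right_filter; exact: is_derive_continuous (dcl 0).
      have c3 : g x @[x --> 0^'+] --> g 0.
        rewrite g0; apply/norm_cvg0P.
        apply: (@squeeze_cvgr _ _ _ _ (cst 0) (fun x => 2 * x)).
        * near=> x; rewrite normr_ge0/= gle//; apply/andP; split; near: x.
            exact: nbhs_right_gt.
          exact: nbhs_right_le.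
        * exact: cvg_cst.
        * rewrite -[0 in X in _ --> X](mulr0 2); apply: cvgMr; apply: cvg_at_right_filter; exact: cvg_id.
      by apply: cvgD => //; apply: cvgM.
    + by apply: cvg_at_left_filter; apply: is_derive_continuous (dH pi _); rewrite pi0 lexx.
  - by exists c; [rewrite in_itv in cI|rewrite E subr0].
rewrite {1}/H {1}/H dirichlet_prim0 g0 mul0r addr0 subr0 => E.
have -> : dirichlet_prim s K pi = dg c * (cos (l * c) / l) * pi - g pi * (cos (l * pi) / l).
  by rewrite -E; ring.
have cosl x : `|cos (l * x) / l| <= l^-1.
  by rewrite normrM [`|l^-1|]gtr0_norm ?invr_gt0// ler_piMl ?cos_max// invr_ge0 ltW.
apply: (le_trans (ler_normB _ _)); rewrite [leLHS]addrC [leRHS]mulrDl; apply: lerD.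
  by rewrite normrM ler_pM.
rewrite [leRHS]mulrAC normrM (gtr0_norm pi0) ler_pM2r// normrM ler_pM// dgle//.
by case/andP: cI => -> /ltW ->.
Unshelve. all: by end_near. Qed.

End cosecant.

(** * The beta integral *)

Section beta_integrals.
Variable R : realType.
Notation mu := (@lebesgue_measure R).
Implicit Types (s t x a : R).

(** Integration by parts between two nonnegative integrals that are not known to be
    finite: the boundary terms have equal limits, so they cancel. *)
Lemma FTC_balance (f g F : R -> R) (D : set R) (u v : R^nat) (l : R) :
  (forall k, u k < v k) ->
  nonincreasing_seq u -> nondecreasing_seq v ->
  D = \bigcup_k `[u k, v k]%classic ->
  (forall x, D x -> 0 <= f x) -> (forall x, D x -> 0 <= g x) ->
  (forall x, D x -> {for x, continuous f}) ->
  (forall x, D x -> {for x, continuous g}) ->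
  (forall x, D x -> is_derive x 1 F (f x - g x)) ->
  F (u k) @[k --> \oo] --> l -> F (v k) @[k --> \oo] --> l ->
  (\int[mu]_(x in D) (f x)%:E = \int[mu]_(x in D) (g x)%:E)%E.
Proof.
move=> uv niu ndv DE f0 g0 cf cg dF Fl FL.
have DI k x : u k <= x <= v k -> D x by move=> h; rewrite DE; exists k => //=; rewrite in_itv.
have cW k (h : R -> R) : (forall x, D x -> {for x, continuous h}) -> {within `[u k, v k], continuous h}.
  by move=> ch; apply: continuous_in_subspaceT => x; rewrite inE /= in_itv/= => hx; apply: ch; exact: (DI k).
have cvgI (h : R -> R) : (forall x, D x -> 0 <= h x) -> (forall x, D x -> {for x, continuous h}) ->
    (\int[mu]_(x in `[u k, v k]) (h x)%:E)%E @[k --> \oo] --> (\int[mu]_(x in D) (h x)%:E)%E.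
  move=> h0 ch; rewrite DE; apply: ge0_nondecreasing_set_cvg_integral.
  - move=> m k mk; rewrite subsetEset => x /=; rewrite !in_itv/= => /andP[ux xv].
    by rewrite (le_trans (niu _ _ mk) ux) (le_trans xv (ndv _ _ mk)).
  - by move=> k; exact: measurable_itv.
  - move=> k; apply/measurable_EFinP; apply: subspace_continuous_measurable_fun => //.
    exact: cW.
  - by move=> k x /=; rewrite in_itv/= => h1; rewrite lee_fin h0//; exact: (DI k).
have inth k (h : R -> R) : (forall x, D x -> {for x, continuous h}) ->
    mu.-integrable `[u k, v k] (EFin \o h).
  by move=> ch; apply: continuous_compact_integrable; [exact: segment_compact|exact: cW].
have E k : (\int[mu]_(x in `[u k, v k]) (f x)%:E =
    \int[mu]_(x in `[u k, v k]) (g x)%:E + (F (v k) - F (u k))%:E)%E.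
  have <- : (\int[mu]_(x in `[u k, v k]) (f x - g x)%:E = (F (v k) - F (u k))%:E)%E.
    apply: FTC_cc => // x hx.
      by apply: cvgB; [apply: cf|apply: cg]; exact: (DI k).
    by apply: dF; exact: (DI k).
  rewrite -integralD//=.
  - by apply: eq_integral => x _; rewrite -EFinD addrC subrK.
  - exact: inth.
  - by apply: (inth k (fun x => f x - g x)) => x Dx; apply: cvgB; [exact: cf|exact: cg].
have c1 := cvgI _ f0 cf; have c2 := cvgI _ g0 cg.
have c3 : (F (v k) - F (u k))%:E @[k --> \oo] --> (0%R)%:E.
  by apply: cvg_EFin; [exact: nearW|rewrite -(subrr l); exact: cvgB].
have c4 := cvgeD (fin_num_adde_defl _ (isT : 0%:E \is a fin_num)) c2 c3.
rewrite adde0 in c4; rewrite (funext E) in c1; exact: (cvg_unique _ c1 (c4 _)).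
Qed.

Let h (k : nat) : R := k.+2%:R^-1.

Lemma cvg_inv_seq : h k @[k --> \oo] --> (0 : R).
Proof.
have := @cvg_harmonic R; rewrite -(cvg_shiftS (@harmonic R)).
by apply: cvg_trans.
Qed.

Lemma cvg_powR_inv_seq t : 0 < t -> h k `^ t @[k --> \oo] --> (0 : R).
Proof.
move=> t0; have /cvg_at_rightP := powR_cvg0 t0; apply; split; last exact: cvg_inv_seq.
by move=> k; rewrite invr_gt0 ltr0n.
Qed.

Lemma h_gt0 k : 0 < h k. Proof. by rewrite invr_gt0 ltr0n. Qed.

Lemma h_ni : nonincreasing_seq h.
Proof. by move=> m k mk; rewrite /h lef_pV2 ?posrE ?ltr0n// ler_nat !ltnS. Qed.

Lemma inv_seq_powRN k t : k.+2%:R `^ (- t) = h k `^ t.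
Proof. by rewrite /h -powR_inv1 // -powRrM mulN1r. Qed.

Lemma itv_0y_bigcup : `]0, +oo[%classic = \bigcup_k `[h k, k.+2%:R]%classic :> set R.
Proof.
apply/seteqP; split => x /=; last first.
  by move=> [k _] /=; rewrite !in_itv/= andbT => /andP[hx _]; exact: lt_le_trans (h_gt0 k) hx.
rewrite in_itv/= andbT => x0.
pose m := maxn (Num.truncn x) (Num.truncn x^-1); exists m => //=; rewrite in_itv/=.
have xm : x < m.+1%:R.
  by rewrite (lt_le_trans (truncnS_gt x))// ler_nat ltnS leq_maxl.
have xim : x^-1 < m.+1%:R.
  by rewrite (lt_le_trans (truncnS_gt _))// ler_nat ltnS leq_maxr.
have m12 : m.+1%:R <= m.+2%:R :> R by rewrite ler_nat.
apply/andP; split; last exact: ltW (lt_le_trans xm m12).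
rewrite /h -[leRHS]invrK lef_pV2 ?posrE ?invr_gt0 ?ltr0n//.
exact: ltW (lt_le_trans xim m12).
Qed.

Lemma itv_01_bigcup : `]0, 1]%classic = \bigcup_k `[h k, 1]%classic :> set R.
Proof.
apply/seteqP; split => x /=; last first.
  by move=> [k _] /=; rewrite !in_itv/= => /andP[hx ->]; rewrite (lt_le_trans (h_gt0 k) hx).
rewrite in_itv/= => /andP[x0 x1]; have : `]0, +oo[%classic x by rewrite /= in_itv/= x0.
rewrite itv_0y_bigcup => -[k _] /=; rewrite in_itv/= => /andP[hx _].
by exists k => //=; rewrite in_itv/= hx x1.
Qed.

Lemma itv_1y_bigcup : `[1, +oo[%classic = \bigcup_k `[1, k.+2%:R]%classic :> set R.
Proof.
apply/seteqP; split => x /=; last first.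
  by move=> [k _] /=; rewrite !in_itv/= andbT => /andP[].
rewrite in_itv/= andbT => x1; have : `]0, +oo[%classic x.
  by rewrite /= in_itv/= andbT (lt_le_trans ltr01).
rewrite itv_0y_bigcup => -[k _] /=; rewrite in_itv/= => /andP[_ hx].
by exists k => //=; rewrite in_itv/= hx x1.
Qed.

Lemma is_derive_powR a x : 0 < x -> is_derive x 1 (fun y => y `^ a) (a * x `^ (a - 1)).
Proof. by move=> x0; exact: is_derive1_powR. Qed.

Lemma continuous_powR a x : 0 < x -> {for x, continuous (fun y => y `^ a)}.
Proof. by move=> x0; exact: is_derive_continuous (is_derive_powR a x0). Qed.

Lemma integral_powR01 t : 0 < t ->
  (\int[mu]_(x in `]0%R, 1%R]) (x `^ (t - 1))%:E = (t^-1)%:E)%E.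
Proof.
move=> t0; rewrite -[t^-1]subr0.
apply: (@FTC_exhaustion _ _ (fun x => t^-1 * x `^ t) _ h (fun=> 1)).
- by move=> k; rewrite /h invf_lt1 ?ltr0n// ltr1n.
- exact: h_ni.
- by move=> *.
- exact: itv_01_bigcup.
- by move=> x _; exact: powR_ge0.
- by move=> x /=; rewrite in_itv/= => /andP[x0 _]; exact: continuous_powR.
- move=> x /=; rewrite in_itv/= => /andP[x0 _].
  have d := deriveMl_fun t^-1 (is_derive_powR t x0).
  by apply: (@is_derive_eq _ _ _ _ _ _ _ _ d); rewrite mulrA mulVf ?mul1r// gt_eqF.
- by rewrite -(mulr0 t^-1); apply: cvgMr; exact: cvg_powR_inv_seq.
- by rewrite powR1 mulr1; exact: cvg_cst.
Qed.

Lemma integral_powR1y t : 0 < t ->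
  (\int[mu]_(x in `[1%R, +oo[) (x `^ (- t - 1))%:E = (t^-1)%:E)%E.
Proof.
move=> t0.
rewrite -[t^-1]opprK -[- - _]add0r.
apply: (@FTC_exhaustion _ _ (fun x => - t^-1 * x `^ (- t)) _ (fun=> 1) (fun k => k.+2%:R)).
- by move=> k; rewrite ltr1n.
- by move=> *.
- by move=> m k mk; rewrite ler_nat !ltnS.
- exact: itv_1y_bigcup.
- by move=> x _; exact: powR_ge0.
- by move=> x /=; rewrite in_itv/= andbT => /(lt_le_trans ltr01) x0; exact: continuous_powR.
- move=> x /=; rewrite in_itv/= andbT => /(lt_le_trans ltr01) x0.
  have d := deriveMl_fun (- t^-1) (is_derive_powR (- t) x0).
  by apply: (@is_derive_eq _ _ _ _ _ _ _ _ d); rewrite mulrA mulrNN mulVf ?mul1r// gt_eqF.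
- by rewrite powR1 mulr1; exact: cvg_cst.
- rewrite -(mulr0 (- t^-1)); apply: cvgMr.
  under eq_fun do rewrite inv_seq_powRN.
  exact: cvg_powR_inv_seq.
Qed.

Lemma measurable_powR_div (D : set R) a k : measurable_fun D
  (fun x : R => (x `^ a * (1 + x) ^- k)%:E).
Proof.
apply: measurable_funTS; apply/measurable_EFinP; apply: measurable_funM.
  exact: measurable_powR.
by apply: measurable_fun_inv; apply: measurable_funX; exact: measurable_funD.
Qed.

(** The two halves of the reflection integral at the point 1. Each satisfies
    [F(t) + F(t+1) = 1/t], which iterated gives the partial fractions. *)
Let IA t := (\int[mu]_(x in `]0%R, 1%R]) (x `^ (t - 1) * (1 + x) ^- 1)%:E)%E.
Let IB t := (\int[mu]_(x in `[1%R, +oo[) (x `^ (- t) * (1 + x) ^- 1)%:E)%E.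

Let pos_fun a k x : 0 < x -> (0 <= (x `^ a * (1 + x) ^- k)%:E)%E.
Proof. by move=> x0; rewrite lee_fin mulr_ge0 ?powR_ge0// invr_ge0 exprn_ge0// addr_ge0// ltW. Qed.

Lemma IA_step t : 0 < t -> (IA t + IA (t + 1)%R = (t^-1)%:E)%E.
Proof.
move=> t0; rewrite /IA -integral_powR01// -ge0_integralD//; last 4 first.
- by move=> x /=; rewrite in_itv/= => /andP[x0 _]; exact: pos_fun.
- exact: measurable_powR_div.
- by move=> x /=; rewrite in_itv/= => /andP[x0 _]; exact: pos_fun.
- exact: measurable_powR_div.
apply: eq_integral => x; rewrite inE /= in_itv/= => /andP[x0 _]; rewrite -EFinD; congr EFin.
rewrite (_ : t + 1 - 1 = (t - 1) + 1); last by ring.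
rewrite [x `^ (_ + 1)]powRD; last by rewrite (gt_eqF x0) implybT.
by rewrite powRr1 ?ltW// expr1; field; rewrite gt_eqF// addr_gt0.
Qed.

Lemma IB_step t : 0 < t -> (IB t + IB (t + 1)%R = (t^-1)%:E)%E.
Proof.
have pos x : (`[1, +oo[%classic) x -> 0 < x.
  by rewrite /= in_itv/= andbT; exact: lt_le_trans ltr01.
move=> t0; rewrite /IB -integral_powR1y// -ge0_integralD//; last 4 first.
- by move=> x /pos x0; exact: pos_fun.
- exact: measurable_powR_div.
- by move=> x /pos x0; exact: pos_fun.
- exact: measurable_powR_div.
apply: eq_integral => x; rewrite inE => /pos x0; rewrite -EFinD; congr EFin.
rewrite (_ : - (t + 1) = - t - 1); last by ring.
rewrite [in LHS]powRD; last by rewrite (gt_eqF x0) implybT.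
rewrite powRD; last by rewrite (gt_eqF x0) implybT.
by rewrite powR_inv1 ?ltW// expr1; field; rewrite !gt_eqF// addr_gt0.
Qed.

(** Nonnegativity and the functional equation alone force finiteness and the decay
    [F(t) <= 1/t], hence the remainder of the expansion tends to 0. *)
Lemma step_fin (F : R -> \bar R) t : (forall t, (0 <= F t)%E) ->
  (forall t, 0 < t -> (F t + F (t + 1)%R = (t^-1)%:E)%E) -> 0 < t ->
  exists2 r, F t = r%:E & 0 <= r <= t^-1.
Proof.
move=> F0 Fs t0; have := Fs t t0; have := F0 t; have := F0 (t + 1).
case: (F t) => [r| |]; case: (F (t + 1)) => [r'| |] //= r'0 r0 [] E.
by exists r => //; rewrite -E lerDl; apply/andP; split; rewrite -lee_fin.
Qed.

(** Both the integral and [pi / sin (pi s)] are within [O(1/K)] of the same partial sum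
    of the partial fraction expansion. *)
Lemma reflection_integral s : 0 < s < 1 ->
  (\int[mu]_(x in `]0%R, +oo[) (x `^ (s - 1) * (1 + x) ^- 1)%:E =
   (pi / sin (pi * s))%:E)%E.
Proof.
move=> s01; have /andP[s0 s1] := s01.
have IA0 t : (0 <= IA t)%E.
  by apply: integral_ge0 => x /=; rewrite in_itv/= => /andP[x0 _]; exact: pos_fun.
have IB0 t : (0 <= IB t)%E.
  by apply: integral_ge0 => x /=; rewrite in_itv/= andbT => /(lt_le_trans ltr01); exact: pos_fun.
have Afin t := @step_fin IA t IA0 IA_step; have Bfin t := @step_fin IB t IB0 IB_step.
pose A t := fine (IA t); pose B t := fine (IB t).
have AE t : 0 < t -> IA t = (A t)%:E by move=> /Afin[r E _]; rewrite /A E.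
have BE t : 0 < t -> IB t = (B t)%:E by move=> /Bfin[r E _]; rewrite /B E.
have Ale t : 0 < t -> 0 <= A t <= t^-1 by move=> /Afin[r E rle]; rewrite /A E.
have Ble t : 0 < t -> 0 <= B t <= t^-1 by move=> /Bfin[r E rle]; rewrite /B E.
have As t : 0 < t -> A t = t^-1 - A (t + 1).
  by move=> t0; have := IA_step t0; rewrite (AE _ t0) (AE _ (addr_gt0 t0 ltr01)) => -[E]; rewrite -E addrK.
have Bs t : 0 < t -> B t = t^-1 - B (t + 1).
  by move=> t0; have := IB_step t0; rewrite (BE _ t0) (BE _ (addr_gt0 t0 ltr01)) => -[E]; rewrite -E addrK.
transitivity (IA s + IB (1 - s)%R)%E.
  (* The two halves have the parameters s and 1 - s. *)
  have -> : `]0, +oo[%classic = `]0, 1]%classic `|` `]1, +oo[%classic :> set R.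
    by rewrite -itv_bndbnd_setU// bnd_simp.
  rewrite ge0_integral_setU; [|exact: measurable_itv|exact: measurable_itv| | |]; last 3 first.
  - exact: measurable_powR_div.
  - move=> x /=; rewrite !in_itv/= => -[/andP[x0 _]|]; first exact: pos_fun.
    by rewrite andbT => /(lt_trans ltr01); exact: pos_fun.
  - apply/disj_setPS => x /= []; rewrite !in_itv/= => /andP[_ x1]; by rewrite andbT ltNge x1.
  congr (_ + _)%E; rewrite /IB opprB integral_itv_obnd_cbnd//.
  exact: measurable_powR_div.
rewrite AE// BE ?subr_gt0// -EFinD; congr EFin.
have s10 : 0 < 1 - s by rewrite subr_gt0.
have sk k : 0 < s + k.+1%:R by rewrite addr_gt0.
(* K + 1 uses of the functional equation, with the remainder written exactly. *)
have key K : A s + B (1 - s) = cosec_sum s K + (-1) ^+ K.+1 *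
    ((s - K.+1%:R)^-1 + A (s + K.+1%:R) + B (1 - s + K.+1%:R)).
  elim: K => [|K IH] /=.
    rewrite As// (Bs (1 - s))// expr1 (_ : s - 1 = - (1 - s)); last by ring.
    by rewrite invrN; ring.
  rewrite IH (As _ (sk K)) (Bs _ (addr_gt0 s10 (ltr0Sn R K))).
  rewrite -(addrA s) -(addrA (1 - s)) natr1.
  have -> : 1 - s + K.+1%:R = - (s - K.+2%:R) by rewrite -natr1; ring.
  by rewrite invrN !exprS; ring.
pose J := A s + B (1 - s).
have sinle : `|sin (pi * s)| <= 1 := sin_max _.
have bound K : `|sin (pi * s) * J - pi| <= (2 + 8 * pi + 3) / K.+1%:R.
  have K0 : 0 < K.+1%:R :> R by rewrite ltr0n.
  rewrite /J (key K.+1) mulrDr addrAC -dirichlet_prim_pi [leRHS]mulrDl.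
  apply: (le_trans (ler_normD _ _)); apply: lerD.
    apply: (le_trans (dirichlet_prim_pi_le _ s01)).
    rewrite ler_pM2l; last by rewrite addr_gt0// mulr_gt0 ?pi_gt0.
    by rewrite lef_pV2 ?posrE ?addr_gt0// lerDl.
  rewrite normrM -[leRHS]mul1r; apply: ler_pM => //.
  rewrite normrM normrX normrN1 expr1n mul1r.
  rewrite (_ : 3 / K.+1%:R = K.+1%:R^-1 + K.+1%:R^-1 + K.+1%:R^-1 :> R); last by ring.
  have le1 x : K.+1%:R <= x -> x^-1 <= K.+1%:R^-1.
    by move=> h1; rewrite lef_pV2 ?posrE// (lt_le_trans K0).
  apply: (le_trans (ler_normD _ _)); apply: lerD; first apply: (le_trans (ler_normD _ _)); first apply: lerD.
  - rewrite (_ : s - K.+2%:R = - (K.+2%:R - s)); last by ring.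
    rewrite invrN normrN ger0_norm; first by apply: le1; rewrite -[K.+2%:R]natr1; lra.
    by rewrite invr_ge0 -[K.+2%:R]natr1; lra.
  - have /andP[h1 h2] := Ale _ (sk K.+1); rewrite ger0_norm//; apply: (le_trans h2).
    by apply: le1; rewrite -[K.+2%:R]natr1; lra.
  - have h0 : 0 < 1 - s + K.+2%:R by rewrite addr_gt0.
    have /andP[h1 h2] := Ble _ h0; rewrite ger0_norm//; apply: (le_trans h2).
    by apply: le1; rewrite -[K.+2%:R]natr1; lra.
have sin0 : 0 < sin (pi * s).
  by apply: sin_gt0_pi; rewrite mulr_gt0 ?pi_gt0//= -ltr_pdivlMl ?pi_gt0// mulVf// gt_eqF// pi_gt0.
have : sin (pi * s) * J - pi = 0.
  apply/eqP/negPn/negP; rewrite -normr_gt0 => X0.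
  have := bound (Num.truncn ((2 + 8 * pi + 3) / `|sin (pi * s) * J - pi|)).
  rewrite ler_pdivlMr ?ltr0n// -ler_pdivlMl// mulrC leNgt.
  by rewrite truncnS_gt.
by move/eqP; rewrite subr_eq0 mulrC => /eqP /(canRL (mulfK (lt0r_neq0 sin0))).
Qed.

(** The derivative of [x^(a+1) (1+x)^-(m+1)] is the difference of the two integrands,
    and this function vanishes at both ends. *)
Lemma integral_beta_step a m : -1 < a < 0 ->
  (m.+1%:R%:E * \int[mu]_(x in `]0%R, +oo[) (x `^ a * (1 + x) ^- m.+2)%:E =
   (m%:R - a)%:E * \int[mu]_(x in `]0%R, +oo[) (x `^ a * (1 + x) ^- m.+1)%:E)%E.
Proof.
move=> /andP[a1 a0].
have xgt0 x : `]0, +oo[%classic x -> 0 < x by rewrite /= in_itv/= andbT.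
have ma0 : 0 <= m%:R - a by rewrite subr_ge0 (le_trans (ltW a0)).
have pow0 k x : 0 < x -> 0 <= x `^ a * (1 + x) ^- k.
  by move=> x0; rewrite mulr_ge0 ?powR_ge0// invr_ge0 exprn_ge0// addr_ge0// ltW.
have d1x x : is_derive x 1 (fun y : R => 1 + y) 1.
  by have := deriveD_fun (derive_cst_fun 1 x) (is_derive_id x (1 : R)); rewrite add0r.
have x1n x : 0 < x -> 1 + x != 0 by move=> x0; rewrite gt_eqF// addr_gt0.
have dXV k x : 0 < x -> is_derive x 1 (fun y : R => (1 + y) ^- k.+1) (- k.+1%:R * (1 + x) ^- k.+2 * 1).
  by move=> x0; exact: (@deriveXV_fun R (fun y => 1 + y) k x 1 (x1n x x0) (d1x x)).
have cpow k x : 0 < x -> {for x, continuous (fun x => x `^ a * (1 + x) ^- k.+1)}.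
  move=> x0; apply: cvgM; first exact: continuous_powR.
  exact: is_derive_continuous (dXV k x x0).
rewrite -!ge0_integralZl//; last 4 first.
- exact: measurable_powR_div.
- by move=> x /xgt0 x0; rewrite lee_fin pow0.
- exact: measurable_powR_div.
- by move=> x /xgt0 x0; rewrite lee_fin pow0.
under eq_integral do rewrite -EFinM; under [RHS]eq_integral do rewrite -EFinM.
have Fle t k x : 0 < x -> 0 <= x `^ t * (1 + x) ^- k <= x `^ t.
  move=> x0; rewrite mulr_ge0 ?powR_ge0 ?invr_ge0 ?exprn_ge0 ?addr_ge0 ?(ltW x0)//=.
  by rewrite ler_piMr ?powR_ge0// invf_le1 ?exprn_gt0 ?addr_gt0// exprn_ege1// lerDl ltW.
apply: (@FTC_balance _ _ (fun x => x `^ (a + 1) * (1 + x) ^- m.+1) _ h (fun k => k.+2%:R) 0).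
- by move=> k; rewrite (@lt_trans _ _ 1) ?ltr1n// /h invf_lt1 ?ltr0n// ltr1n.
- exact: h_ni.
- by move=> k k' kk'; rewrite ler_nat !ltnS.
- exact: itv_0y_bigcup.
- by move=> x /xgt0 x0; rewrite mulr_ge0// pow0.
- by move=> x /xgt0 x0; rewrite mulr_ge0// pow0.
- by move=> x /xgt0 x0; apply: cvgMr; exact: cpow.
- by move=> x /xgt0 x0; apply: cvgMr; exact: cpow.
- move=> x /xgt0 x0; have d := deriveM_fun (is_derive_powR (a + 1) x0) (dXV m x x0).
  apply: (@is_derive_eq _ _ _ _ _ _ _ _ d).
  rewrite addrK [x `^ (a + 1)]powRD; last by rewrite (gt_eqF x0) implybT.
  rewrite powRr1 ?ltW// -[m.+1%:R]natr1 [(1 + x) ^+ m.+2]exprS.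
  have y0 : (1 + x) ^+ m.+1 != 0 by rewrite expf_neq0// x1n.
  have := x1n x x0; move: (x `^ a) ((1 + x) ^+ m.+1) y0 => u w w0 z0.
  by field; rewrite w0 z0.
- apply: (@squeeze_cvgr _ _ _ _ (cst 0) (fun k => h k `^ (a + 1))).
  + by apply: nearW => k; exact: Fle (h_gt0 k).
  + exact: cvg_cst.
  + by apply: cvg_powR_inv_seq; rewrite -ltrBlDr sub0r.
- apply: (@squeeze_cvgr _ _ _ _ (cst 0) (fun k => h k `^ (- a))).
  + apply: nearW => k; have v0 : 0 < k.+2%:R :> R by rewrite ltr0n.
    have /andP[h1 h2] := Fle a m _ v0; rewrite -inv_seq_powRN opprK.
    have e : k.+2%:R `^ (a + 1) * (1 + k.+2%:R) ^- m.+1 =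
        k.+2%:R `^ a * (1 + k.+2%:R) ^- m * (k.+2%:R / (1 + k.+2%:R)).
      rewrite powRD; last by rewrite (gt_eqF v0) implybT.
      by rewrite powRr1 ?ltW// exprSr invfM; ring.
    have /(_ _ v0)/andP[q0 q1] (V : R) : 0 < V -> 0 <= V / (1 + V) <= 1.
      move=> V0; have V1 : 0 < 1 + V by rewrite addr_gt0.
      by rewrite divr_ge0 ?(ltW V0) ?(ltW V1)//= ler_pdivrMr// mul1r lerDr.
    rewrite /= e mulr_ge0//=; apply: le_trans h2.
    by rewrite ler_piMr.
  + exact: cvg_cst.
  + by apply: cvg_powR_inv_seq; rewrite oppr_gt0.
Qed.

Lemma integral_beta a m : -1 < a < 0 ->
  (\int[mu]_(x in `]0%R, +oo[) (x `^ a * (1 + x) ^- m.+1)%:E =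
   (pi / sin (pi * (a + 1)) * \prod_(k < m) ((k%:R - a) / k.+1%:R))%:E)%E.
Proof.
move=> a01; have /andP[a1 a0] := a01; elim: m => [|m IH].
  rewrite big_ord0 mulr1 -reflection_integral; last by apply/andP; split; lra.
  by apply: eq_integral => x _; rewrite addrK.
have m0 : 0 < m.+1%:R :> R by rewrite ltr0n.
have := integral_beta_step m a01; rewrite IH -EFinM.
move=> /(congr1 (fun z => (m.+1%:R^-1)%:E * z)%E); rewrite muleA -!EFinM mulVf ?gt_eqF// mul1e => ->.
by rewrite big_ord_recr/=; congr EFin; ring.
Qed.

Lemma prod_shift n (r : R) : r != 0 ->
  n.+2%:R * \prod_(k < n.+2) ((k%:R + r^-1) / k.+1%:R) =
  r^-1 * \prod_(1 <= k < n.+2) (1 + 1 / (k%:R * r)).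
Proof.
move=> r0; elim: n => [|n IH].
  by rewrite 2!big_ord_recr big_ord0 big_nat1 /= add0r divr1; field.
rewrite big_nat_recr//= big_ord_recr/= [in RHS]mulrA -IH.
move: (\prod_(_ < _) _) => P.
have n2 : n.+2%:R != 0 :> R by rewrite pnatr_eq0.
have n3 : n.+3%:R != 0 :> R by rewrite pnatr_eq0.
by move: (n.+2%:R) (n.+3%:R) n2 n3 => u v u0 v0; field; rewrite u0 v0 r0.
Qed.

Definition berezin_norm n (r : R) : R :=
  pi / (r * sin (pi / r)) * \prod_(1 <= k < n.+2) (1 + 1 / (k%:R * r)).

Lemma integral_berezin_norm n r : 1 < r ->
  (\int[mu]_(x in `]0%R, +oo[) ((n.+2%:R * (1 + x) ^- n.+3)%:E * (x `^ (- r^-1))%:E) =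
   (berezin_norm n r)%:E)%E.
Proof.
move=> r1; have r0 : 0 < r by rewrite (lt_trans ltr01).
have i1 : 0 < r^-1 < 1 by rewrite invr_gt0 r0 invf_lt1.
have a01 : -1 < - r^-1 < 0 by lra.
transitivity (n.+2%:R%:E * \int[mu]_(x in `]0%R, +oo[) (x `^ (- r^-1) * (1 + x) ^- n.+3)%:E)%E.
  rewrite -ge0_integralZl//; last 2 first.
  - exact: measurable_powR_div.
  - by move=> x /=; rewrite in_itv/= andbT => x0; exact: pos_fun.
  by apply: eq_integral => x _; rewrite -!EFinM; congr EFin; ring.
rewrite integral_beta// -EFinM; congr EFin; rewrite /berezin_norm.
have -> : sin (pi * (- r^-1 + 1)) = sin (pi / r).
  by rewrite mulrDr mulr1 mulrN sinDpi sinN opprK.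
have -> : \prod_(k < n.+2) ((k%:R - - r^-1) / k.+1%:R) =
    \prod_(k < n.+2) ((k%:R + r^-1) / k.+1%:R) by apply: eq_bigr => k _; rewrite opprK.
rewrite mulrCA prod_shift ?gt_eqF// invfM; ring.
Qed.

End beta_integrals.

(** * The upper bound *)

Section upper_bound.
Variables (R : realType).
Local Open Scope ereal_scope.

(** Hoelder's inequality for the functions [Q^(1/q)] and [Q^(1/r) G]. *)
Lemma jensen_powR d (T : measurableType d) (m : {measure set T -> \bar R}) (Q G : T -> R) (r : R) :
  (1 < r)%R -> measurable_fun setT Q -> measurable_fun setT G ->
  (forall x, 0 <= Q x)%R -> (forall x, 0 <= G x)%R ->
  (\int[m]_x (Q x * G x)%:E) `^ r <=
  (\int[m]_x (Q x)%:E) `^ (r - 1) * \int[m]_x (Q x * G x `^ r)%:E.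
Proof.
move=> r1 mQ mG Q0 G0.
have r0 : (0 < r)%R by rewrite (lt_trans _ r1).
have s0 : (0 < r - 1)%R by rewrite subr_gt0.
have rN0 : r != 0%R by rewrite gt_eqF.
have sN0 : (r - 1)%R != 0%R by rewrite gt_eqF.
pose q := (r / (r - 1))%R.
have q0 : (0 < q)%R by rewrite divr_gt0.
have qr : (q^-1 + r^-1 = 1)%R by rewrite /q; field; rewrite rN0 sN0.
pose f x := (Q x `^ q^-1)%R.
pose g x := (Q x `^ r^-1 * G x)%R.
have mf : measurable_fun setT f by exact: (measurableT_comp (@measurable_powR R q^-1) mQ).
have mg : measurable_fun setT g.
  by apply: measurable_funM => //; exact: (measurableT_comp (@measurable_powR R r^-1) mQ).
have f0 x : (0 <= f x)%R by exact: powR_ge0.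
have g0 x : (0 <= g x)%R by rewrite mulr_ge0// powR_ge0.
have fg x : (f x * g x = Q x * G x)%R.
  rewrite /f /g mulrA -powRD ?qr ?powRr1//.
  by rewrite oner_eq0.
have := hoelder m mf mg q0 r0 qr.
rewrite Lnorm1 => H.
have eL : \int[m]_x `|(EFin \o (f \* g)%R) x| = \int[m]_x (Q x * G x)%:E.
  by apply: eq_integral => x _; rewrite /= fg ger0_norm// mulr_ge0.
rewrite eL in H.
apply: le_trans (gt0_ler_poweR (ltW r0) _ _ H) _; rewrite ?in_itv/= ?leey ?andbT.
- by apply: integral_ge0 => x _; rewrite lee_fin mulr_ge0.
- by rewrite mule_ge0// Lnorm_ge0.
rewrite poweRM ?Lnorm_ge0// poweR_Lnorm//.
have -> : 'N[m]_q%:E[EFin \o f] `^ r = ('N[m]_q%:E[EFin \o f] `^ q) `^ (r - 1).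
  by rewrite -poweRrM; congr (_ `^ _); rewrite /q; field.
rewrite poweR_Lnorm ?gt_eqF//.
apply: lee_pmul; try by rewrite ?poweR_ge0//; apply: integral_ge0 => x _; exact: poweR_ge0.
  rewrite le_eqVlt; apply/orP; left; apply/eqP; congr (_ `^ _); apply: eq_integral => x _.
  rewrite /= ger0_norm// /f -powRrM mulVf ?gt_eqF// powRr1//.
rewrite le_eqVlt; apply/orP; left; apply/eqP; apply: eq_integral => x _.
rewrite /= ger0_norm// /g powRM// ?powR_ge0// -powRrM mulVf// powRr1//.
Qed.

Variable n : nat.
Notation heis := (heis R n).
Notation haar := (haar R n).
Notation haarR := (haarR R n).
Notation cspace := (cspace R n).

(** The Berezin transform of a nonnegative function, possibly infinite. In this form
    it is defined and measurable on the whole space. *)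
Definition avg (F : cspace -> R) (z : cspace) : \bar R :=
  \int[haarR]_y (qker y * F (act (base z) (height z) y))%:E.

Lemma avg_ge0 F z : (forall w, 0 <= F w)%R -> 0 <= avg F z.
Proof. by move=> F0; apply: integral_ge0 => y _; rewrite lee_fin mulr_ge0// qker_ge0. Qed.

Lemma measurable_act2 : measurable_fun setT (fun x : cspace * (heis * measurableTypeR R) =>
  act (base x.1) (height x.1) x.2).
Proof.
apply: measurable_fun_act.
- by apply: measurable_fun_base; exact: measurable_fst.
- by apply: measurable_fun_height; exact: measurable_fst.
- exact: measurable_snd.
Qed.

Lemma measurable_avg (F : cspace -> R) : measurable_fun setT F -> (forall w, 0 <= F w)%R ->
  measurable_fun setT (avg F).
Proof.
move=> mF F0.
apply: (@measurable_ge0_integral _ _ _ _ _ haarR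
  (fun x : cspace * (heis * measurableTypeR R) => (qker x.2 * F (act (base x.1) (height x.1) x.2))%:E)).
- apply/measurable_EFinP; apply: measurable_funM.
    exact: (measurableT_comp (@measurable_qker R n) measurable_snd).
  exact: (measurableT_comp mF measurable_act2).
- by move=> x; rewrite lee_fin mulr_ge0// qker_ge0.
Qed.

Lemma avgE (F : cspace -> R) z : measurable_fun setT F -> (forall w, 0 <= F w)%R -> siegel z ->
  \int[dV R n]_(w in @siegel R n) (bkernel z w * F w)%:E = avg F z.
Proof.
move=> mF F0 zs.
have z0 : (0 < height z)%R by rewrite -siegelE.
have mF' : measurable_fun setT (EFin \o F) by exact/measurable_EFinP.
have := @ge0_integral_bkernel R n (base z) _ (EFin \o F) z0 mF' (fun w => F0 w).
rewrite chart_base; under eq_integral do rewrite -EFinM; move=> ->.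
by apply: eq_integral => y _; rewrite -EFinM.
Qed.

(** In Heisenberg coordinates [z |-> act z y] is right translation by the dilate of
    [y.1] and scaling of the height by [y.2]. *)
Lemma ge0_integral_siegel_act (y : heis * measurableTypeR R) (F : cspace -> \bar R) : (0 < y.2)%R ->
  measurable_fun setT F -> (forall z, 0 <= F z) ->
  \int[dV R n]_(z in @siegel R n) F (act (base z) (height z) y) =
  (y.2^-1)%:E * \int[dV R n]_(z in @siegel R n) F z.
Proof.
move=> y0 mF F0.
have mA : measurable_fun setT (fun z : cspace => act (base z) (height z) y).
  by apply: measurable_fun_act => //; [exact: measurable_fun_base|exact: measurable_fun_height].
rewrite (ge0_integral_siegel_height (measurableT_comp mF mA) (fun z => F0 _)).
rewrite (ge0_integral_siegel_height mF F0).
have mI : measurable_fun [set: measurableTypeR R] (fun s => \int[haar]_h F (chart h s)).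
  apply: (@measurable_ge0_integral _ _ _ _ _ haar (fun x : measurableTypeR R * heis => F (chart x.2 x.1))) => //.
  by apply: (measurableT_comp mF); exact: measurable_fun_chart.
rewrite -(@ge0_integral_scale_pos R _ _ y0 mI (fun s => integral_ge0 _ (fun h _ => F0 _))).
apply: eq_integral => r _.
have mFr : measurable_fun [set: heis] (fun h => F (chart h (y.2 * r)%R)).
  by apply: (measurableT_comp mF); exact: measurable_fun_chart.
rewrite -(@ge0_integral_hmul_right R n (Num.sqrt r) y.1 _ mFr (fun h => F0 _)).
by apply: eq_integral => h _; rewrite /act /= base_chart height_chart [in RHS]mulrC.
Qed.

Lemma ge0_integral_siegel_swap d (T : measurableType d) (m : {sigma_finite_measure set T -> \bar R})
  (F : cspace * T -> \bar R) : measurable_fun setT F -> (forall x, 0 <= F x) ->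
  \int[dV R n]_(z in @siegel R n) \int[m]_y F (z, y) =
  \int[m]_y \int[dV R n]_(z in @siegel R n) F (z, y).
Proof.
move=> mF F0.
pose G (x : cspace * T) := if (0 < height x.1)%R then F x else 0.
have mG : measurable_fun setT G.
  apply: measurable_fun_ifT => //; apply: measurable_fun_ltr => //.
  by apply: measurable_fun_height; exact: measurable_fst.
have G0 x : 0 <= G x by rewrite /G; case: ifP.
transitivity (\int[dV R n]_z \int[m]_y G (z, y)).
  rewrite integral_mkcond; apply: eq_integral => z _; rewrite patchE /G /=.
  case: ifPn => [|]; first by rewrite inE siegelE => ->.
  by rewrite notin_setE siegelE => /negP/negbTE ->; rewrite integral0.
rewrite (ge0_integral_prodm_swap _ _ mG G0); apply: eq_integral => y _.
rewrite [RHS]integral_mkcond; apply: eq_integral => z _; rewrite patchE /G /=.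
case: ifPn => [z0|]; first by rewrite ifT// inE siegelE.
by move=> z0; rewrite ifF//; apply/negbTE; rewrite notin_setE siegelE; exact/negP.
Qed.

Lemma berezin_norm_ge0 (r : R) : (1 < r)%R -> (0 <= berezin_norm n r)%R.
Proof.
move=> r1; rewrite -lee_fin -integral_berezin_norm//; apply: integral_ge0 => x.
by rewrite /= in_itv/= andbT => x0; rewrite lee_fin !mulr_ge0 ?powR_ge0// invr_ge0 exprn_ge0// addr_ge0// ltW.
Qed.

Lemma integral_qker_powR (r : R) : (1 < r)%R ->
  \int[haarR]_y (qker y * y.2 `^ (- r^-1))%:E = (berezin_norm n r)%:E.
Proof.
move=> r1; rewrite -integral_berezin_norm//.
under eq_integral do rewrite EFinM.
rewrite (@integral_qker R n (fun x => (x `^ (- r^-1))%:E))//.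
- by apply/measurable_EFinP; exact: measurable_powR.
- by move=> x; rewrite lee_fin powR_ge0.
Qed.

(** Jensen's inequality with the weight [qker(y) y.2^(-1/r)], whose total mass is
    the sharp constant; the factor [y.2^(1/r)] that is left in the integrand cancels the
    Jacobian of [act] after its [r]-th power is taken. *)
Lemma le_integral_avg (r : R) (F : cspace -> R) : (1 < r)%R -> measurable_fun setT F -> (forall w, 0 <= F w)%R ->
  \int[dV R n]_(z in @siegel R n) avg F z `^ r <=
  (berezin_norm n r `^ r)%:E * \int[dV R n]_(z in @siegel R n) (F z `^ r)%:E.
Proof.
move=> r1 mF F0.
have r0 : (0 < r)%R by rewrite (lt_trans _ r1).
have rN0 : r != 0%R by rewrite gt_eqF.
pose Q (y : heis * measurableTypeR R) := (qker y * y.2 `^ (- r^-1))%R.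
have Q0 y : (0 <= Q y)%R by rewrite mulr_ge0 ?qker_ge0 ?powR_ge0.
have mQ : measurable_fun setT Q.
  apply: measurable_funM; first exact: measurable_qker.
  exact: (measurableT_comp (@measurable_powR R _) measurable_snd).
have mP (s : R) : measurable_fun setT (fun y : heis * measurableTypeR R => (y.2 `^ s)%R).
  exact: (measurableT_comp (@measurable_powR R _) measurable_snd).
have mFr : measurable_fun setT (fun z => F z `^ r)%R.
  exact: (measurableT_comp (@measurable_powR R _) mF).
pose K (x : cspace * (heis * measurableTypeR R)) :=
  (Q x.2 * (x.2.2 * F (act (base x.1) (height x.1) x.2) `^ r))%:E.
have mK : measurable_fun setT K.
  apply/measurable_EFinP; apply: measurable_funM.
    exact: (measurableT_comp mQ measurable_snd).
  apply: measurable_funM; first by apply: measurable_fun_snd2; exact: measurable_snd.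
  exact: (measurableT_comp mFr measurable_act2).
have K0 x : 0 <= K x.
  rewrite lee_fin; have [y0|y0] := ltP 0%R x.2.2; last by rewrite /Q /qker ltNge y0 /= !mul0r.
  by rewrite mulr_ge0// mulr_ge0 ?powR_ge0// ltW.
have b0 := berezin_norm_ge0 r1.
have step z : avg F z `^ r <= (berezin_norm n r `^ (r - 1))%:E * \int[haarR]_y K (z, y).
  have mA : measurable_fun setT (fun y : heis * measurableTypeR R => F (act (base z) (height z) y)).
    by apply: (measurableT_comp mF); exact: measurable_fun_act.
  pose G (y : heis * measurableTypeR R) := (y.2 `^ r^-1 * F (act (base z) (height z) y))%R.
  have G0 y : (0 <= G y)%R by rewrite mulr_ge0// powR_ge0.
  have mG : measurable_fun setT G by apply: measurable_funM.
  have := @jensen_powR _ _ haarR Q G r r1 mQ mG Q0 G0.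
  have -> : \int[haarR]_y (Q y * G y)%:E = avg F z.
    apply: eq_integral => y _; congr (_%:E); rewrite /Q /G /qker; case: ifPn => y0; last by rewrite !mul0r.
    by rewrite powRN -[LHS]mulrA mulKf ?gt_eqF ?powR_gt0.
  rewrite integral_qker_powR// poweR_EFin => /le_trans; apply.
  rewrite le_eqVlt; apply/orP; left; apply/eqP; congr (_ * _); apply: eq_integral => y _.
  rewrite /K /G /=; congr (_%:E); rewrite /Q /qker; case: ifPn => y0; last by rewrite !mul0r.
  by rewrite powRM ?powR_ge0// -powRrM mulVf// powRr1// ltW.
have mKi : measurable_fun setT (fun z => \int[haarR]_y K (z, y)).
  exact: (@measurable_ge0_integral _ _ _ _ _ haarR K mK K0).
have Ki0 z : 0 <= \int[haarR]_y K (z, y) by apply: integral_ge0 => y _; exact: K0.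
have mS := @measurable_siegel R n.
apply: (@le_trans _ _ (\int[dV R n]_(z in @siegel R n) ((berezin_norm n r `^ (r - 1))%:E * \int[haarR]_y K (z, y)))).
  apply: ge0_le_integral; first exact: mS.
  - by move=> z _; exact: poweR_ge0.
  - by apply: measurable_funTS; exact: (measurableT_comp (measurable_poweR r) (measurable_avg mF F0)).
  - by apply: measurable_funTS; apply: emeasurable_funM.
  - by move=> z _; exact: step.
rewrite ge0_integralZl; [|exact: mS|exact: measurable_funTS|by move=> z _; exact: Ki0|by rewrite lee_fin powR_ge0].
rewrite (ge0_integral_siegel_swap _ mK K0).
pose N := \int[dV R n]_(z in @siegel R n) (F z `^ r)%:E.
have N0 : 0 <= N by apply: integral_ge0 => z _; rewrite lee_fin powR_ge0.
have -> : \int[haarR]_y \int[dV R n]_(z in @siegel R n) K (z, y) = \int[haarR]_y ((Q y)%:E * N).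
  apply: eq_integral => y _; rewrite /K /=.
  have [y0|y0] := ltP 0%R y.2; last first.
    rewrite /Q /qker ltNge y0 /= mul0r mul0e.
    by under eq_integral do rewrite !mul0r; rewrite integral0.
  under eq_integral do rewrite mulrA EFinM.
  have mFz : measurable_fun setT (fun z => (F z `^ r)%:E) by exact/measurable_EFinP.
  have mFA : measurable_fun setT (fun z : cspace => (F (act (base z) (height z) y) `^ r)%:E).
    apply: (measurableT_comp mFz).
    by apply: measurable_fun_act => //; [exact: measurable_fun_base|exact: measurable_fun_height].
  rewrite ge0_integralZl; [|exact: mS|exact: measurable_funTS|by move=> z _; rewrite lee_fin powR_ge0|]; last first.
    by rewrite lee_fin mulr_ge0// ltW.
  rewrite (@ge0_integral_siegel_act y (fun z => (F z `^ r)%:E) y0 mFz)//; last first.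
    by move=> z; rewrite lee_fin powR_ge0.
  by rewrite muleA -EFinM mulfK ?gt_eqF.
rewrite ge0_integralZr; [|exact: measurableT|exact/measurable_EFinP|by move=> y _; rewrite lee_fin|exact: N0].
rewrite integral_qker_powR// muleA -EFinM.
have -> : (berezin_norm n r `^ (r - 1) * berezin_norm n r = berezin_norm n r `^ r)%R.
  rewrite -{2}[berezin_norm n r]powRr1// -powRD; first by rewrite subrK.
  by rewrite subrK (negbTE rN0).
by [].
Qed.

End upper_bound.

(** * Convergence and measurability of the Berezin transform *)

Section convergence.
Variables (R : realType) (n : nat).
Notation mu := (@lebesgue_measure R).
Notation haarR := (haarR R n).
Notation cspace := (cspace R n).
Notation siegel := (@siegel R n).
Notation dV := (dV R n).

Lemma redot_le (a u : n.-tuple R[i]) : 2 * redot a u <= nsq a + nsq u.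
Proof.
rewrite /redot /nsq mulr_sumr -big_split /=; apply: ler_sum => j _.
rewrite -subr_ge0.
set x := complex.Re (tnth a j); set y := complex.Im (tnth a j).
set c := complex.Re (tnth u j); set d := complex.Im (tnth u j).
have -> : x ^+ 2 + y ^+ 2 + (c ^+ 2 + d ^+ 2) - 2 * (x * c + y * d) =
  (x - c) ^+ 2 + (y - d) ^+ 2 by ring.
by rewrite addr_ge0// sqr_ge0.
Qed.

Lemma rho2_ge (z w : cspace) : siegel z -> siegel w -> (height z / 2) ^+ 2 <= rho2 z w.
Proof.
rewrite !siegelE => z0 w0.
have le2 := redot_le z.1 w.1.
rewrite /rho2 -[leLHS]addr0 lerD ?sqr_ge0//.
rewrite ler_pXn2r// ?nnegrE; rewrite /height in z0 w0 *; lra.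
Qed.

(** The kernel is bounded in [w] for fixed [z], since [rho] cannot be small. *)
Lemma bkernel_le (z : cspace) : siegel z ->
  exists2 C : R, 0 <= C & forall w, siegel w -> bkernel z w <= C.
Proof.
move=> zs; have z0 : 0 < height z by rewrite -siegelE.
have b0 := @bconst_gt0 R n.
have A0 : 0 <= bconst R n * height z ^+ n.+2 by rewrite mulr_ge0 ?exprn_ge0 ?ltW.
exists (bconst R n * height z ^+ n.+2 / ((height z / 2) ^+ 2) ^+ n.+2).
  by apply: divr_ge0 => //; rewrite exprn_ge0// sqr_ge0.
move=> w ws; rewrite /bkernel; apply: ler_wpM2l => //.
have h0 : 0 < (height z / 2) ^+ 2 by rewrite exprn_gt0// divr_gt0.
have r0 : 0 < rho2 z w := lt_le_trans h0 (rho2_ge zs ws).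
rewrite lef_pV2 ?posrE; [|by rewrite exprn_gt0..].
by rewrite ler_pXn2r ?nnegrE ?rho2_ge0 ?sqr_ge0// rho2_ge.
Qed.

Definition cabs (x : R[i]) : R := Num.sqrt (complex.Re x ^+ 2 + complex.Im x ^+ 2).

Lemma Re_norm (x : R[i]) : complex.Re `|x| = cabs x.
Proof. by case: x. Qed.

Lemma cabs_ge0 x : 0 <= cabs x. Proof. exact: sqrtr_ge0. Qed.

Lemma cabs_real (x : R) : 0 <= x -> cabs (x%:C)%C = x.
Proof. by move=> x0; rewrite /cabs /= expr0n addr0 sqrtr_sqr ger0_norm. Qed.

Lemma cabs_dot (a b : R) (x : R[i]) :
  a * complex.Re x + b * complex.Im x <= cabs (a +i* b)%C * cabs x.
Proof.
rewrite /cabs /= -sqrtrM ?addr_ge0 ?sqr_ge0//.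
apply: le_trans (ler_norm _) _; rewrite -sqrtr_sqr; apply: ler_wsqrtr.
case: x => c d /=; rewrite -subr_ge0.
have -> : (a ^+ 2 + b ^+ 2) * (c ^+ 2 + d ^+ 2) - (a * c + b * d) ^+ 2 = (a * d - b * c) ^+ 2 by ring.
exact: sqr_ge0.
Qed.

Lemma Re_le_cabs (x : R[i]) : `|complex.Re x| <= cabs x.
Proof. by rewrite -sqrtr_sqr ler_wsqrtr// lerDl sqr_ge0. Qed.

Lemma Im_le_cabs (x : R[i]) : `|complex.Im x| <= cabs x.
Proof. by rewrite -sqrtr_sqr ler_wsqrtr// lerDr sqr_ge0. Qed.

Lemma measurable_fun_cabs d (T : measurableType d) (D : set T) (f : T -> R[i]) :
  measurable_fun D f -> measurable_fun D (fun x => cabs (f x)).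
Proof.
move=> mf; apply: (measurableT_comp (continuous_measurable_fun (@sqrt_continuous R))).
by apply: measurable_funD; apply: measurable_funX; [exact: measurable_fun_Re|exact: measurable_fun_Im].
Qed.

Definition on_siegel (g : cspace -> R) (w : cspace) : R := if 0 < height w then g w else 0.

Lemma on_siegelT g w : siegel w -> on_siegel g w = g w.
Proof. by rewrite siegelE /on_siegel => ->. Qed.

Lemma on_siegel_ge0 g : (forall w, 0 <= g w) -> forall w, 0 <= on_siegel g w.
Proof. by move=> g0 w; rewrite /on_siegel; case: ifP. Qed.

Lemma measurable_on_siegel g : measurable_fun siegel g -> measurable_fun setT (on_siegel g).
Proof.
move=> mg; have := (measurable_restrictT (g : cspace -> R) (@measurable_siegel R n)).1 mg.
congr (measurable_fun _ _); apply/funext => w; rewrite patchE /on_siegel.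
case: ifPn; first by rewrite inE siegelE => ->.
by rewrite notin_setE siegelE => /negP/negbTE ->.
Qed.

Definition modulus (f : cspace -> R[i]) : cspace -> R := on_siegel (fun w => cabs (f w)).

Lemma modulus_ge0 f w : 0 <= modulus f w.
Proof. by apply: on_siegel_ge0 => ?; exact: cabs_ge0. Qed.

Lemma measurable_modulus f : measurable_fun siegel f -> measurable_fun setT (modulus f).
Proof. by move=> mf; apply: measurable_on_siegel; exact: measurable_fun_cabs. Qed.

Local Open Scope ereal_scope.

(** The density [(n+2) (1+x)^-(n+3)] of the height ratio has total mass 1. *)
Lemma integral_avg1 z : avg (cst 1%R : cspace -> R) z = 1.
Proof.
rewrite /avg /=.
have E := @integral_qker R n (cst 1) (measurable_cst _) (fun _ => lee01).
transitivity (\int[haarR]_y ((qker y)%:E * 1)).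
  by apply: eq_integral => y _; rewrite mulr1 mule1.
rewrite [LHS]E /=; under eq_integral do rewrite mule1.
pose f (x : R) := (n.+2%:R * (1 + x) ^- n.+3)%R.
have dp m (x : R) : (0 <= x)%R ->
    is_derive x 1%R (fun y : R => (1 + y) ^- m.+1)%R (- m.+1%:R * (1 + x) ^- m.+2 * 1)%R.
  move=> x0; apply: deriveXV_fun; first by rewrite gt_eqF// ltr_pwDl.
  by have d := deriveD_fun (derive_cst_fun 1%R x) (@is_derive_id _ _ x 1%R); rewrite add0r in d.
have cf x : (0 <= x)%R -> {for x, continuous f}.
  by move=> x0; exact: (is_derive_continuous (deriveMl_fun n.+2%:R (dp n.+2 x x0))).
rewrite integral_itv_obnd_cbnd; last first.
  apply/measurable_EFinP; apply: measurable_funTS; apply: measurable_funM => //.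
  by apply: measurable_fun_inv; apply: measurable_funX; exact: measurable_funD.
have -> : \int[mu]_(x in `[0%R, +oo[) (f x)%:E = (0 - (- (1 + 0) ^- n.+2))%:E.
  apply: (@FTC_cy R f (fun x => - (1 + x) ^- n.+2)%R).
  - by move=> x x0; rewrite mulr_ge0// invr_ge0 exprn_ge0// addr_ge0.
  - exact: cf.
  - move=> x x0; have h := deriveMl_fun (-1)%R (dp n.+1 x x0).
    rewrite (_ : (fun _ => _) = (fun y : R => -1 * (1 + y) ^- n.+2)%R); last first.
      by apply/funext => y; rewrite mulN1r.
    by apply: (@is_derive_eq _ _ _ _ _ _ _ _ h); rewrite /f mulr1 mulNr mulrNN mul1r.
  - rewrite -[X in _ --> X]oppr0; apply: cvgN.
    apply: (@squeeze_cvgr _ _ _ _ (cst 0%R) (fun x : R => x^-1)%R); last 2 first.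
    + exact: cvg_cst.
    + by apply/gtr0_cvgV0; [near=> x; near: x; exact: nbhs_pinfty_gt|exact: cvg_id].
    near=> x; have x1 : (1 < x)%R by near: x; exact: nbhs_pinfty_gt.
    have x0 : (0 < x)%R by rewrite (lt_trans ltr01).
    apply/andP; split; first by rewrite invr_ge0 exprn_ge0// addr_ge0// ltW.
    rewrite lef_pV2 ?posrE ?exprn_gt0 ?addr_gt0//.
    rewrite exprS (@le_trans _ _ (1 + x)%R)// ?lerDr// ler_peMr ?addr_ge0 ?(ltW x0)//.
    by rewrite exprn_ege1// lerDl ltW.
by rewrite addr0 expr1n invr1 opprK add0r.
Unshelve. all: by end_near. Qed.

(** [F <= 1 + F^r], and the kernel is both integrable and bounded. *)
Lemma avg_le_Lp (r : R) (F : cspace -> R) z : (1 < r)%R -> siegel z ->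
  measurable_fun setT F -> (forall w, 0 <= F w)%R ->
  \int[dV]_(w in siegel) (F w `^ r)%:E < +oo -> avg F z < +oo.
Proof.
move=> r1 zs mF F0 Ioo.
have [C C0 kC] := bkernel_le zs.
have mS := @measurable_siegel R n.
have mk : measurable_fun setT (fun w : cspace => bkernel z w).
  by apply: measurable_fun_bkernel.
have mFr : measurable_fun setT (fun w => F w `^ r)%R.
  exact: (measurableT_comp (@measurable_powR R _) mF).
rewrite -avgE//.
apply: (@le_lt_trans _ _ (\int[dV]_(w in siegel) ((bkernel z w * 1)%:E + C%:E * (F w `^ r)%:E))).
  apply: ge0_le_integral; first exact: mS.
  - by move=> w _; rewrite lee_fin mulr_ge0// bkernel_ge0.
  - by apply/measurable_EFinP; apply: measurable_funTS; exact: measurable_funM.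
  - apply: measurable_funTS; apply: emeasurable_funD.
      by apply/measurable_EFinP; exact: measurable_funM.
    by apply: emeasurable_funM => //; exact/measurable_EFinP.
  - move=> w ws; rewrite -EFinM -EFinD lee_fin.
    have k0 := bkernel_ge0 w zs.
    apply: (@le_trans _ _ (bkernel z w * (1 + F w `^ r))%R).
      apply: ler_wpM2l => //.
      have [F1|F1] := leP (F w) 1%R; first by rewrite (le_trans F1)// lerDl powR_ge0.
      by rewrite (@le_trans _ _ (F w `^ r)%R)// ?lerDr// le1r_powR// ltW.
    by rewrite mulrDr lerD2l ler_wpM2r ?powR_ge0// kC.
rewrite ge0_integralD; [|exact: mS| | | |]; last 4 first.
- by move=> w _; rewrite lee_fin mulr_ge0// bkernel_ge0.
- by apply/measurable_EFinP; apply: measurable_funTS; exact: measurable_funM.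
- by move=> w _; rewrite -EFinM lee_fin mulr_ge0// powR_ge0.
- by apply: measurable_funTS; apply: emeasurable_funM => //; exact/measurable_EFinP.
rewrite (@avgE _ _ (cst 1%R))// integral_avg1.
rewrite ge0_integralZl; [|exact: mS| | |]; last 3 first.
- by apply: measurable_funTS; exact/measurable_EFinP.
- by move=> w _; rewrite lee_fin powR_ge0.
- by rewrite lee_fin.
by rewrite lte_add_pinfty ?ltry// lte_mul_pinfty.
Qed.

Lemma avg_le_sup (M : R) (F : cspace -> R) z : (0 <= M)%R -> siegel z ->
  measurable_fun setT F -> (forall w, 0 <= F w)%R ->
  (\forall w \ae dV, siegel w -> (F w <= M)%R) -> avg F z <= M%:E.
Proof.
move=> M0 zs mF F0 FM.
have mS := @measurable_siegel R n.
have mk : measurable_fun setT (fun w : cspace => bkernel z w) by apply: measurable_fun_bkernel.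
have -> : M%:E = \int[dV]_(w in siegel) (M%:E * (bkernel z w * 1)%:E).
  rewrite ge0_integralZl; [|exact: mS| | |]; last 3 first.
  - by apply/measurable_EFinP; apply: measurable_funTS; exact: measurable_funM.
  - by move=> w _; rewrite lee_fin mulr_ge0// bkernel_ge0.
  - by rewrite lee_fin.
  by rewrite (@avgE _ _ (cst 1%R))// integral_avg1 mule1.
rewrite -avgE//; apply: ae_ge0_le_integral; first exact: mS.
- by move=> w _; rewrite lee_fin mulr_ge0// bkernel_ge0.
- by apply/measurable_EFinP; apply: measurable_funTS; exact: measurable_funM.
- by move=> w _; rewrite -EFinM lee_fin mulr1 mulr_ge0// bkernel_ge0.
- apply: measurable_funTS; apply: emeasurable_funM => //.
  by apply/measurable_EFinP; exact: measurable_funM.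
- apply: filterS FM => w FM ws; rewrite -EFinM lee_fin mulr1 mulrC ler_wpM2r ?bkernel_ge0//.
  exact: FM.
Qed.

Lemma integrable_bkernel (g : cspace -> R) F z : siegel z -> measurable_fun siegel g ->
  measurable_fun setT F -> (forall w, siegel w -> `|g w| <= F w)%R -> (forall w, 0 <= F w)%R ->
  avg F z < +oo -> dV.-integrable siegel (fun w => (bkernel z w * g w)%:E).
Proof.
move=> zs mg mF gF F0 Foo.
have mS := @measurable_siegel R n.
have mk : measurable_fun setT (fun w : cspace => bkernel z w) by apply: measurable_fun_bkernel.
have mkF : measurable_fun siegel (fun w => (bkernel z w * F w)%:E).
  by apply/measurable_EFinP; apply: measurable_funTS; exact: measurable_funM.
apply: (@le_integrable _ _ _ dV siegel mS _ (fun w => (bkernel z w * F w)%:E)).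
- by apply/measurable_EFinP; apply: measurable_funM => //; exact: measurable_funTS.
- move=> w ws; have k0 := bkernel_ge0 w zs.
  by rewrite lee_fin !normrM ler_wpM2l// (ger0_norm (F0 w)) gF.
- apply/integrableP; split => //.
  under eq_integral.
    move=> w; rewrite inE => ws; rewrite gee0_abs; last by rewrite lee_fin mulr_ge0// bkernel_ge0.
    over.
  by rewrite avgE.
Qed.

Lemma berezinE f z : siegel z ->
  berezin f z = ((\int[dV]_(w in siegel) (bkernel z w * complex.Re (f w)))%R +i*
                 (\int[dV]_(w in siegel) (bkernel z w * complex.Im (f w)))%R)%C.
Proof.
move=> zs; rewrite /berezin; congr (_ +i* _)%C; congr fine; apply: eq_integral => w _;
  by rewrite berezin_integrandE//=; case: (f w) => a b /=; congr EFin; ring.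
Qed.

Lemma berezin_cvg_avg f z : siegel z -> measurable_fun siegel f -> avg (modulus f) z < +oo ->
  berezin_cvg f z.
Proof.
move=> zs mf foo; have mm := measurable_modulus mf.
split.
  rewrite (_ : (fun _ => _) = (fun w => (bkernel z w * complex.Re (f w))%:E)); last first.
    apply/funext => w; rewrite berezin_integrandE//; case: (f w) => a b /=; congr EFin; ring.
  apply: (integrable_bkernel zs _ mm) => //; first exact: measurable_fun_Re.
  - by move=> w ws; rewrite /modulus on_siegelT// Re_le_cabs.
  - exact: modulus_ge0.
rewrite (_ : (fun _ => _) = (fun w => (bkernel z w * complex.Im (f w))%:E)); last first.
  apply/funext => w; rewrite berezin_integrandE//; case: (f w) => a b /=; congr EFin; ring.
apply: (integrable_bkernel zs _ mm) => //; first exact: measurable_fun_Im.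
- by move=> w ws; rewrite /modulus on_siegelT// Im_le_cabs.
- exact: modulus_ge0.
Qed.

(** The triangle inequality for a complex integral. *)
Lemma modulus_berezin_le f z : siegel z -> measurable_fun siegel f -> avg (modulus f) z < +oo ->
  (modulus (berezin f) z)%:E <= avg (modulus f) z.
Proof.
move=> zs mf foo; have mm := measurable_modulus mf.
have mS := @measurable_siegel R n.
have iRe : dV.-integrable siegel (fun w => (bkernel z w * complex.Re (f w))%:E).
  apply: (integrable_bkernel zs _ mm) => //; first exact: measurable_fun_Re.
  - by move=> w ws; rewrite /modulus on_siegelT// Re_le_cabs.
  - exact: modulus_ge0.
have iIm : dV.-integrable siegel (fun w => (bkernel z w * complex.Im (f w))%:E).
  apply: (integrable_bkernel zs _ mm) => //; first exact: measurable_fun_Im.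
  - by move=> w ws; rewrite /modulus on_siegelT// Im_le_cabs.
  - exact: modulus_ge0.
have im : dV.-integrable siegel (fun w => (bkernel z w * modulus f w)%:E).
  apply: (integrable_bkernel zs _ mm) => //.
  - exact: measurable_funTS.
  - by move=> w ws; rewrite ger0_norm// modulus_ge0.
  - exact: modulus_ge0.
rewrite {1}/modulus on_siegelT// berezinE//.
set A := Rintegral _ _ _; set B := Rintegral _ _ _.
pose T := (\int[dV]_(w in siegel) (bkernel z w * modulus f w))%R.
have TE : T%:E = avg (modulus f) z.
  rewrite /T /Rintegral fineK; last exact: integrable_fin_num.
  by rewrite avgE//; exact: modulus_ge0.
rewrite -TE lee_fin; set N := cabs _.
have N0 : (0 <= N)%R by exact: cabs_ge0.
have T0 : (0 <= T)%R by rewrite -lee_fin TE avg_ge0//; exact: modulus_ge0.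
have iZ (c : R) (g : cspace -> R) : dV.-integrable siegel (fun w => (g w)%:E) ->
    dV.-integrable siegel (fun w => (c * g w)%:E).
  by move=> ig; under eq_fun do rewrite EFinM; exact: integrableZl.
(* N^2 = A^2 + B^2 is the integral of the scalar product of f with (A, B). *)
have NNT : (N * N <= N * T)%R.
  have -> : (N * N = A * A + B * B)%R.
    by rewrite -expr2 /N /cabs /= sqr_sqrtr ?addr_ge0 ?sqr_ge0// !expr2.
  rewrite {2}/A {2}/B -!RintegralZl// -RintegralD//; [|exact: iZ..].
  apply: le_Rintegral => //.
  - exact: (integrableD mS (iZ A _ iRe) (iZ B _ iIm)).
  - exact: iZ.
  move=> w ws; have k0 := bkernel_ge0 w zs.
  rewrite mulrCA [X in (_ + X)%R]mulrCA -mulrDr [leRHS]mulrCA ler_wpM2l//.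
  by rewrite /modulus on_siegelT//; exact: cabs_dot.
have [N00|Nn0] := eqVneq N 0%R; first by rewrite N00.
by rewrite -(@ler_pM2l _ N)// lt_def Nn0.
Qed.

(** A real function is split into its positive and negative parts, to which the
    measurability of [avg] applies. Where the integral diverges the junk values agree. *)
Lemma measurable_integral_bkernel (g : cspace -> R) : measurable_fun siegel g ->
  exists2 G : cspace -> R, measurable_fun setT G &
    forall z, siegel z -> (\int[dV]_(w in siegel) (bkernel z w * g w))%R = G z.
Proof.
move=> mg.
pose gp := on_siegel (fun w => Num.max (g w) 0)%R.
pose gm := on_siegel (fun w => Num.max (- g w) 0)%R.
have mgp : measurable_fun setT gp.
  by apply: measurable_on_siegel; apply: measurable_maxr.
have mgm : measurable_fun setT gm.
  by apply: measurable_on_siegel; apply: measurable_maxr => //; exact: measurableT_comp.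
have gp0 w : (0 <= gp w)%R by apply: on_siegel_ge0 => ?; rewrite le_max lexx orbT.
have gm0 w : (0 <= gm w)%R by apply: on_siegel_ge0 => ?; rewrite le_max lexx orbT.
exists (fun z => fine (avg gp z - avg gm z)).
  apply: (measurableT_comp (fine_measurable measurableT)).
  by apply: emeasurable_funB; exact: measurable_avg.
move=> z zs; rewrite /Rintegral integralE -!avgE//; congr (fine (_ - _)).
  apply: eq_integral => w; rewrite inE => ws; rewrite funeposE /gp on_siegelT//.
  by rewrite -EFin_max maxr_pMr ?bkernel_ge0// mulr0.
apply: eq_integral => w; rewrite inE => ws; rewrite funenegE /gm on_siegelT//.
by rewrite -EFinN -EFin_max -mulrN maxr_pMr ?bkernel_ge0// mulr0.
Qed.

Lemma measurable_berezin f : measurable_fun siegel f -> measurable_fun siegel (@berezin R n f).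
Proof.
move=> mf.
have [A mA AE] := measurable_integral_bkernel (measurable_fun_Re mf).
have [B mB BE] := measurable_integral_bkernel (measurable_fun_Im mf).
apply: (@eq_measurable_fun _ _ _ _ _ (fun z => A z +i* B z)%C).
  by move=> z; rewrite inE => zs; rewrite berezinE// AE// BE.
by apply: measurable_funTS; exact: measurable_mkcomplex.
Qed.

End convergence.

(** * A bump function on the Heisenberg group *)

Section bumps.
Variables (R : realType) (n : nat).
Notation heis := (heis R n).

Lemma imdot_le (a u : n.-tuple R[i]) : 2 * `|imdot a u| <= nsq a + nsq u.
Proof.
have key (e : R) : e ^+ 2 = 1 -> 2 * (e * imdot a u) <= nsq a + nsq u.
  move=> e2; rewrite /imdot /nsq !mulr_sumr -big_split /=; apply: ler_sum => j _.
  rewrite -subr_ge0.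
  set x := complex.Re (tnth a j); set y := complex.Im (tnth a j).
  set c := complex.Re (tnth u j); set d := complex.Im (tnth u j).
  have -> : x ^+ 2 + y ^+ 2 + (c ^+ 2 + d ^+ 2) - 2 * (e * (y * c - x * d)) =
    (x + e * d) ^+ 2 + (y - e * c) ^+ 2 + (1 - e ^+ 2) * (c ^+ 2 + d ^+ 2) by ring.
  by rewrite e2 subrr mul0r addr0 addr_ge0// sqr_ge0.
have [i0|i0] := leP 0 (imdot a u).
  by rewrite ger0_norm//; have := key 1; rewrite expr1n mul1r; apply.
by rewrite ltr0_norm//; have := key (-1); rewrite sqrrN expr1n mulN1r; apply.
Qed.

(** The denominator in the limit of [qker] at height 0, up to a factor and a power. *)
Definition gauge (h : heis) : R := (1 + nsq h.1) ^+ 2 + h.2 ^+ 2.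

(** Controls, to first order in [d], the effect on [gauge] of a translation by the
    dilate of [h] by [d]. *)
Definition spread (h : heis) : R := 1 + 2 * nsq h.1 + `|h.2|.

Lemma gauge_gt0 h : 0 < gauge h.
Proof. by rewrite ltr_pwDl ?sqr_ge0// exprn_gt0// ltr_pwDl ?nsq_ge0. Qed.

Lemma spread_ge0 h : 0 <= spread h.
Proof. by rewrite addr_ge0// addr_ge0// mulr_ge0// nsq_ge0. Qed.

(** A translation by the dilate of [y] by [d] changes the gauge by a factor [1 + O(d)],
    uniformly in the point: cross terms are at most [d] times the gauge. *)
Lemma gauge_hmul_le d (h y : heis) : 0 <= d <= 1 ->
  gauge (hmul d h y) <= (1 + 2 * d * spread y) ^+ 2 * gauge h.
Proof.
case/andP=> d0 d1; rewrite /gauge /hmul /= nsq_taxpy.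
set P := 1 + nsq h.1; set c := spread y.
have u0 := nsq_ge0 h.1; have v0 := nsq_ge0 y.1.
have P1 : 1 <= P by rewrite lerDl.
(* The hypothesis d <= 1 serves to absorb the quadratic terms. *)
have dd : d ^+ 2 <= d by rewrite expr2 ler_piMl.
have c0 : 0 <= c := spread_ge0 y.
have hP : 1 + (nsq h.1 + 2 * d * redot h.1 y.1 + d ^+ 2 * nsq y.1) <= P * (1 + d * c).
  have e1 : 2 * d * redot h.1 y.1 <= d * (nsq h.1 + nsq y.1).
    by rewrite -mulrA mulrCA ler_wpM2l// redot_le.
  have e2 : d ^+ 2 * nsq y.1 <= d * nsq y.1 by rewrite ler_wpM2r.
  have e3 : nsq h.1 + nsq y.1 + nsq y.1 <= P * c.
    have : (1 + nsq h.1) * (1 + 2 * nsq y.1) <= P * c.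
      by rewrite ler_wpM2l ?(le_trans _ P1)// lerDl.
    have : 0 <= nsq h.1 * nsq y.1 by rewrite mulr_ge0.
    by nra.
  have e4 : d * (nsq h.1 + nsq y.1 + nsq y.1) <= d * (P * c) by rewrite ler_wpM2l.
  by rewrite /P in e4 *; lra.
have hT : `|d ^+ 2 * y.2 + (h.2 + 2 * d * imdot h.1 y.1)| <= `|h.2| + d * (P * c).
  apply: le_trans (ler_normD _ _) _.
  rewrite normrM (ger0_norm (sqr_ge0 d)).
  have e0 := ler_normD h.2 (2 * d * imdot h.1 y.1).
  have e1 : `|2 * d * imdot h.1 y.1| <= d * (nsq h.1 + nsq y.1).
    by rewrite !normrM (ger0_norm d0) ger0_norm// -mulrA mulrCA ler_wpM2l// imdot_le.
  have e2 : d ^+ 2 * `|y.2| <= d * `|y.2| by rewrite ler_wpM2r.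
  have e3 : nsq h.1 + nsq y.1 + `|y.2| <= P * c.
    rewrite /P /c /spread; have t0 := normr_ge0 y.2.
    have : 0 <= nsq h.1 * nsq y.1 by rewrite mulr_ge0.
    have : 0 <= nsq h.1 * `|y.2| by rewrite mulr_ge0.
    by nra.
  have e4 : d * (nsq h.1 + nsq y.1 + `|y.2|) <= d * (P * c) by rewrite ler_wpM2l.
  by lra.
have hP2 : (1 + (nsq h.1 + 2 * d * redot h.1 y.1 + d ^+ 2 * nsq y.1)) ^+ 2 <= (P * (1 + d * c)) ^+ 2.
  rewrite ler_pXn2r ?nnegrE//.
    by have := nsq_ge0 (taxpy d h.1 y.1); rewrite nsq_taxpy => ?; rewrite addr_ge0.
  by rewrite mulr_ge0 ?(le_trans _ P1)// addr_ge0// mulr_ge0.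
have hT2 : (d ^+ 2 * y.2 + (h.2 + 2 * d * imdot h.1 y.1)) ^+ 2 <= (`|h.2| + d * (P * c)) ^+ 2.
  by rewrite -[leLHS]real_normK ?num_real// ler_pXn2r ?nnegrE// addr_ge0// !mulr_ge0// (le_trans _ P1).
apply: le_trans (lerD hP2 hT2) _.
have hn : h.2 ^+ 2 = `|h.2| ^+ 2 by rewrite real_normK ?num_real.
rewrite hn; set t := `|h.2|; set x := d * c.
have x0 : 0 <= x by rewrite mulr_ge0.
rewrite -subr_ge0.
have -> : (1 + 2 * d * c) ^+ 2 * (P ^+ 2 + t ^+ 2) - ((P * (1 + d * c)) ^+ 2 + (t + d * (P * c)) ^+ 2) =
  x * (P - t) ^+ 2 + x * P ^+ 2 + 2 * x ^+ 2 * P ^+ 2 + 3 * x * t ^+ 2 + 4 * x ^+ 2 * t ^+ 2 by rewrite /x; ring.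
by repeat first [exact: sqr_ge0|done|apply: addr_ge0|apply: mulr_ge0].
Qed.

(** The limit of [qker] at height 0: its integral over the Heisenberg group is known, and
    it decays slowly enough for a Harnack inequality. *)
Definition bump (h : heis) : R := bconst R n / (gauge h / 4) ^+ n.+2.

Lemma bump_gt0 h : 0 < bump h.
Proof. by rewrite divr_gt0 ?bconst_gt0// exprn_gt0// divr_gt0// gauge_gt0. Qed.

Definition damp (d : R) (y : heis) : R := (1 + 2 * d * spread y) ^- (2 * n.+2).

Lemma damp_base_ge1 d y : 0 <= d -> 1 <= 1 + 2 * d * spread y.
Proof. by move=> d0; rewrite lerDl !mulr_ge0// spread_ge0. Qed.

Lemma damp_gt0 d y : 0 <= d -> 0 < damp d y.
Proof. by move=> d0; rewrite invr_gt0 exprn_gt0// (lt_le_trans _ (damp_base_ge1 y d0)). Qed.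

Lemma damp_le1 d y : 0 <= d -> damp d y <= 1.
Proof. by move=> d0; rewrite invf_le1 ?exprn_ege1 ?exprn_gt0 ?damp_base_ge1// (lt_le_trans _ (damp_base_ge1 y d0)). Qed.

Lemma le_damp d d' y : 0 <= d -> d <= d' -> damp d' y <= damp d y.
Proof.
move=> d0 dd; have d'0 := le_trans d0 dd.
have l1 := damp_base_ge1 y d0; have l2 := damp_base_ge1 y d'0.
have p1 := lt_le_trans ltr01 l1; have p2 := lt_le_trans ltr01 l2.
rewrite /damp lef_pV2 ?posrE ?exprn_gt0//; apply: lerXn2r; rewrite ?nnegrE ?(ltW p1) ?(ltW p2)//.
by rewrite lerD2l ler_wpM2r ?spread_ge0// ler_wpM2l.
Qed.

Lemma continuous_damp0 y : {for (0 : R), continuous (fun d => damp d y)}.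
Proof.
have d1 := deriveD_fun (derive_cst_fun 1 (0 : R)) (deriveMl_fun (2 * spread y) (@is_derive_id _ _ (0 : R) 1)).
have := @deriveXV_fun R _ (2 * n.+2).-1 _ _ _ d1.
rewrite mulr0 addr0 oner_eq0 => /(_ erefl) /is_derive_continuous.
rewrite (_ : (fun d => _) = (fun d => damp d y))//.
by apply/funext => d; rewrite /damp prednK// mulrAC.
Qed.

Lemma bump_hmul_ge d (h y : heis) : 0 <= d <= 1 ->
  bump h * damp d y <= bump (hmul d h y).
Proof.
move=> d01; have g := gauge_hmul_le h y d01; case/andP: d01 => d0 d1.
have g0 := gauge_gt0 h; have g1 := gauge_gt0 (hmul d h y).
have l1 := damp_base_ge1 y d0.
rewrite /bump -mulrA; apply: ler_wpM2l; first by rewrite ltW ?bconst_gt0.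
have p1 := lt_le_trans ltr01 l1.
rewrite /damp exprM -invfM -exprMn lef_pV2 ?posrE; last 2 first.
- by rewrite exprn_gt0// mulr_gt0 ?divr_gt0// exprn_gt0.
- by rewrite exprn_gt0// divr_gt0.
apply: lerXn2r; rewrite ?nnegrE.
- by rewrite divr_ge0// ltW.
- by rewrite mulr_ge0 ?divr_ge0 ?(ltW g0)// exprn_ge0// ltW.
by rewrite mulrAC ler_wpM2r// mulrC.
Qed.

End bumps.

(** * The lower bound *)

Section lower_bound.
Variables (R : realType) (n : nat).
Notation mu := (@lebesgue_measure R).
Notation heis := (heis R n).
Notation haar := (haar R n).
Notation haarR := (haarR R n).
Notation cspace := (cspace R n).
Notation siegel := (@siegel R n).
Notation dV := (dV R n).
Variable r : R.
Hypothesis r1 : 1 < r.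

Let r0 : 0 < r. Proof. exact: lt_trans ltr01 r1. Qed.
Let rN0 : r != 0. Proof. by rewrite gt_eqF. Qed.

(** A truncated eigenfunction [height^(-1/r)], times a bump to the power [1/r]. *)
Definition test_fun (a b : R) (w : cspace) : R :=
  if a <= height w <= b then ((height w)^-1 * bump (base w)) `^ r^-1 else 0.

(** What remains of the integrand of the sharp constant after the losses at the cuts
    and in the Harnack inequality. *)
Definition damped (t d : R) (y : heis * measurableTypeR R) : R :=
  qker y * y.2 `^ (- r^-1) * (if t^-1 <= y.2 <= t then damp d y.1 else 0).

Definition gain (t d : R) : \bar R := (\int[haarR]_y (damped t d y)%:E)%E.

Lemma test_fun_ge0 a b w : 0 <= test_fun a b w.
Proof. by rewrite /test_fun; case: ifP => // _; exact: powR_ge0. Qed.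

Lemma measurable_fun_bump d (T : measurableType d) (h : T -> heis) :
  measurable_fun setT h -> measurable_fun setT (fun x => bump (h x)).
Proof.
move=> mh; apply: measurable_funM => //; apply: measurable_fun_inv.
apply: measurable_funX; apply: measurable_funM => //; apply: measurable_funD; apply: measurable_funX.
  by apply: measurable_funD => //; apply: measurable_fun_nsq; exact: measurable_fun_fst1.
exact: measurable_fun_snd2.
Qed.

Lemma measurable_test_fun a b : measurable_fun setT (test_fun a b).
Proof.
have mh : measurable_fun setT (fun w : cspace => height w) by exact: measurable_fun_height.
apply: measurable_fun_ifT => //.
  by apply: measurable_and; exact: measurable_fun_ler.
apply: (measurableT_comp (@measurable_powR R _)); apply: measurable_funM.
  exact: measurable_fun_inv.
by apply: measurable_fun_bump; exact: measurable_fun_base.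
Qed.

Lemma damped_ge0 t d y : 0 <= d -> 0 <= damped t d y.
Proof.
move=> d0; rewrite mulr_ge0//; last by case: ifP => // _; exact/ltW/damp_gt0.
by rewrite mulr_ge0 ?qker_ge0// powR_ge0.
Qed.

Lemma measurable_damped t d : measurable_fun setT (damped t d).
Proof.
apply: measurable_funM.
  apply: measurable_funM; first exact: measurable_qker.
  exact: (measurableT_comp (@measurable_powR R _) measurable_snd).
apply: measurable_fun_ifT => //.
  by apply: measurable_and; apply: measurable_fun_ler => //; exact: measurable_snd.
apply: measurable_fun_inv; apply: measurable_funX; apply: measurable_funD => //.
apply: measurable_funM => //; apply: measurable_funD.
  apply: measurable_funD => //; apply: measurable_funM => //.
  by apply: measurable_fun_nsq; apply: measurable_fun_fst1; exact: measurable_fst.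
apply: (measurableT_comp (@normr_measurable R setT)).
by apply: measurable_fun_snd2; exact: measurable_fst.
Qed.

Lemma test_fun_powR a b w : 0 < a ->
  test_fun a b w `^ r = if a <= height w <= b then (height w)^-1 * bump (base w) else 0.
Proof.
move=> a0; rewrite /test_fun; case: ifP => [/andP[ah _]|_]; last by rewrite powR0.
rewrite -powRrM mulVf// powRr1//.
by rewrite mulr_ge0 ?invr_ge0 ?(ltW (bump_gt0 _))// (le_trans (ltW a0)).
Qed.

(** Away from the two cuts by a factor [t], every ratio [y.2] in [[1/t, t]] stays
    inside the support. The power [1/r] of the loss [damp] is at least [damp], as
    [damp <= 1]. *)
Lemma test_fun_act_ge a b t d (z : cspace) (y : heis * measurableTypeR R) :
  0 < a -> 0 < t -> 0 <= d <= 1 -> b <= d ^+ 2 ->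
  test_fun (a * t) b z * damped t d y <= qker y * test_fun a (b * t) (act (base z) (height z) y).
Proof.
move=> a0 t0 /andP[d0 d1] bd; rewrite {1}/test_fun; case: ifPn => [/andP[az zb]|_]; last first.
  by rewrite mul0r mulr_ge0 ?qker_ge0 ?test_fun_ge0.
rewrite /damped; case: ifPn => [/andP[ty yt]|_]; last first.
  by rewrite !mulr0 mulr_ge0 ?qker_ge0 ?test_fun_ge0.
have y0 : 0 < y.2 by rewrite (lt_le_trans _ ty)// invr_gt0.
have z0 : 0 < height z by rewrite (lt_le_trans _ az)// mulr_gt0.
rewrite /test_fun /act height_chart base_chart.
have -> : a <= height z * y.2 <= b * t.
  apply/andP; split; last by apply: ler_pM => //; exact: ltW.
  have -> : a = a * t * t^-1 by rewrite mulfK// gt_eqF.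
  by apply: ler_pM => //; [rewrite mulr_ge0 ?ltW|rewrite invr_ge0 ltW].
rewrite mulrCA -[leLHS]mulrA ler_wpM2l ?qker_ge0//.
have s0 : 0 <= Num.sqrt (height z) by exact: sqrtr_ge0.
have sd : Num.sqrt (height z) <= d.
  by rewrite -[leRHS]ger0_norm// -sqrtr_sqr ler_wsqrtr// (le_trans zb).
have dp := damp_gt0 y.1 d0.
have hb := bump_hmul_ge (base z) y.1 (_ : 0 <= Num.sqrt (height z) <= 1).
have {hb} hb := hb ltac:(by rewrite s0 (le_trans sd)).
have hb2 : bump (base z) * damp d y.1 <= bump (hmul (Num.sqrt (height z)) (base z) y.1).
  by apply: le_trans hb; rewrite ler_wpM2l ?(ltW (bump_gt0 _))//; exact: le_damp.
have zy0 : 0 <= (height z * y.2)^-1 by rewrite invr_ge0 mulr_ge0// ltW.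
have B0 : 0 <= bump (base z) by rewrite ltW// bump_gt0.
apply: (@le_trans _ _ (((height z * y.2)^-1 * (bump (base z) * damp d y.1)) `^ r^-1)); last first.
  rewrite ge0_ler_powR ?nnegrE ?invr_ge0 ?(ltW r0)//.
  - by rewrite mulr_ge0// mulr_ge0// ltW.
  - by rewrite mulr_ge0// ltW// bump_gt0.
  - by rewrite ler_wpM2l.
move: (bump (base z)) (damp d y.1) B0 dp (damp_le1 y.1 d0) => B D B0 D0 D1.
have -> : ((height z * y.2)^-1 * (B * D)) `^ r^-1 =
    ((height z)^-1 * B) `^ r^-1 * (y.2^-1 `^ r^-1 * D `^ r^-1).
  by rewrite invfM mulrACA -!powRM ?mulr_ge0 ?invr_ge0 ?(ltW z0) ?(ltW y0) ?(ltW D0).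
rewrite mulrCA ler_wpM2l ?powR_ge0//.
have -> : (y.2 ^-1) `^ r^-1 = y.2 `^ (- r^-1).
  by rewrite -(powR_inv1 (ltW y0)) -powRrM mulN1r.
rewrite ler_wpM2l ?powR_ge0// -{1}[D]powRr1 ?(ltW D0)//.
by apply: ger_powR; [rewrite D0|rewrite invf_le1// ltW].
Qed.

Local Open Scope ereal_scope.

Lemma gain_ge0 t d : (0 <= d)%R -> 0 <= gain t d.
Proof. by move=> d0; apply: integral_ge0 => y _; rewrite lee_fin damped_ge0. Qed.

Lemma avg_test_fun_ge a b t d z : (0 < a)%R -> (0 < t)%R -> (0 <= d <= 1)%R -> (b <= d ^+ 2)%R ->
  (test_fun (a * t) b z)%:E * gain t d <= avg (test_fun a (b * t)) z.
Proof.
move=> a0 t0 d01 bd; have d0 : (0 <= d)%R by case/andP: d01.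
rewrite /gain -ge0_integralZl; [|exact: measurableT| | |]; last 3 first.
- by apply/measurable_EFinP; exact: measurable_damped.
- by move=> y _; rewrite lee_fin damped_ge0.
- by rewrite lee_fin test_fun_ge0.
apply: ge0_le_integral; first exact: measurableT.
- by move=> y _; rewrite -EFinM lee_fin mulr_ge0 ?test_fun_ge0 ?damped_ge0.
- apply: emeasurable_funM; first exact: measurable_cst.
  by apply/measurable_EFinP; exact: measurable_damped.
- apply/measurable_EFinP; apply: measurable_funM; first exact: measurable_qker.
  by apply: (measurableT_comp (measurable_test_fun _ _)); exact: measurable_fun_act.
- by move=> y _; rewrite -EFinM lee_fin; exact: test_fun_act_ge.
Qed.

Lemma integral_test_fun a b : (0 < a)%R -> (a < b)%R ->
  \int[dV]_(w in siegel) (test_fun a b w `^ r)%:E = (n.+2%:R * (ln b - ln a))%:E.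
Proof.
move=> a0 ab.
have mT : measurable_fun setT (fun w => (test_fun a b w `^ r)%:E).
  apply/measurable_EFinP.
  exact: (measurableT_comp (@measurable_powR R _) (measurable_test_fun a b)).
rewrite (ge0_integral_siegel_height mT); last by move=> z; rewrite lee_fin powR_ge0.
have mB : measurable_fun setT (fun h : heis => (bump h)%:E).
  by apply/measurable_EFinP; exact: measurable_fun_bump.
have mi : measurable_fun setT (fun x : measurableTypeR R => (x^-1)%:E).
  by apply/measurable_EFinP; exact: measurable_inv.
transitivity (\int[mu]_(x in `[a, b]) (n.+2%:R%:E * (x^-1)%:E)).
  rewrite [LHS]integral_mkcond [RHS]integral_mkcond; apply: eq_integral => x _.
  rewrite !patchE; case: ifPn => x0; last first.
    rewrite notin_setE /= in_itv/= andbT in x0.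
    rewrite ifF//; apply/negbTE; rewrite notin_setE /= in_itv/= => /andP[ax _].
    by apply: x0; rewrite (lt_le_trans a0).
  rewrite inE /= in_itv/= andbT in x0.
  under eq_integral do rewrite test_fun_powR// height_chart base_chart.
  case: ifPn => xab; last first.
    rewrite notin_setE /= in_itv/= in xab; move/negP/negbTE : xab => ->.
    exact: integral0.
  rewrite inE /= in_itv/= in xab; rewrite xab.
  under eq_integral do rewrite EFinM.
  rewrite ge0_integralZl; [|exact: measurableT|exact: mB| |]; last 2 first.
  - by move=> h _; rewrite lee_fin ltW// bump_gt0.
  - by rewrite lee_fin invr_ge0 ltW.
  have -> : \int[haar]_h (bump h)%:E = n.+2%:R%:E.
    by have := @integral_haar_qker R n 1%R ltr01; rewrite expr1n invr1 mulr1.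
  exact: muleC.
rewrite ge0_integralZl; [|exact: measurable_itv| | |]; last 3 first.
- exact: measurable_funTS.
- by move=> x; rewrite /= in_itv/= => /andP[ax _]; rewrite lee_fin invr_ge0 (le_trans (ltW a0)).
- by rewrite lee_fin.
have -> : \int[mu]_(x in `[a, b]) (x^-1)%:E = (ln b - ln a)%:E.
  apply: (@FTC_cc R (fun x => x^-1)%R (@ln R) a b ab).
    move=> x /andP[ax _]; have x0 := lt_le_trans a0 ax.
    by apply: (is_derive_continuous (deriveV_fun _ (@is_derive_id _ _ x 1%R))); rewrite gt_eqF.
  by move=> x /andP[ax _]; apply: is_derive1_ln; exact: lt_le_trans ax.
by rewrite -EFinM.
Qed.

Lemma gain_le_berezin_norm t d : (0 <= d)%R -> gain t d <= (berezin_norm n r)%:E.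
Proof.
move=> d0; rewrite -integral_qker_powR//; apply: ge0_le_integral; first exact: measurableT.
- by move=> y _; rewrite lee_fin damped_ge0.
- by apply/measurable_EFinP; exact: measurable_damped.
- apply/measurable_EFinP; apply: measurable_funM; first exact: measurable_qker.
  exact: (measurableT_comp (@measurable_powR R _) measurable_snd).
move=> y _; rewrite lee_fin /damped ler_piMr ?mulr_ge0 ?qker_ge0 ?powR_ge0//.
by case: ifP => // _; exact: damp_le1.
Qed.

Variable m : R.
Hypothesis m0 : (0 <= m)%R.
Hypothesis Hm : forall F : cspace -> R, measurable_fun setT F -> (forall w, 0 <= F w)%R ->
  \int[dV]_(w in siegel) (F w `^ r)%:E < +oo ->
  \int[dV]_(z in siegel) avg F z `^ r <= (m `^ r)%:E * \int[dV]_(w in siegel) (F w `^ r)%:E.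

(** The [r]-th power of the norm of the test function is proportional to the length of
    its height interval on the logarithmic scale, and away from the cuts the average
    multiplies it by at least [gain t d]. With [x] the length that remains, [gain^r x <= m^r (x + 2 ln t)], where [x] is arbitrary. *)
Lemma gain_le t d : (1 <= t)%R -> (0 < d <= 1)%R -> gain t d <= m%:E.
Proof.
move=> t1 /andP[d0 d1]; have t0 := lt_le_trans ltr01 t1.
have gl := gain_le_berezin_norm t (ltW d0); have g0 := gain_ge0 t (ltW d0).
have gfin : gain t d \is a fin_num by rewrite ge0_fin_numE// (le_lt_trans gl)// ltry.
rewrite -(fineK gfin) lee_fin; set l := fine _.
have l0 : (0 <= l)%R by rewrite fine_ge0.
(* The heights run from a to b * t, where b = d ^ 2 makes sqrt (height) <= d and a is
   chosen so that ln b - ln (a * t) = x. *)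
have key x : (0 < x)%R -> (l `^ r * x <= m `^ r * (x + 2 * ln t))%R.
  move=> x0; have [b bE] : exists b, b = (d ^+ 2)%R by exists (d ^+ 2)%R.
  pose a := (b * expR (- x) / t)%R.
  have b0 : (0 < b)%R by rewrite bE exprn_gt0.
  have a0 : (0 < a)%R by rewrite divr_gt0// mulr_gt0// expR_gt0.
  have atE : (a * t = b * expR (- x))%R by rewrite /a mulfVK// gt_eqF.
  move: (a) a0 atE => {}a a0 atE.
  have atb : (a * t < b)%R by rewrite atE -[ltRHS]mulr1 ltr_pM2l// -expR0 ltr_expR oppr_lt0.
  have abt : (a < b * t)%R.
    rewrite (le_lt_trans (_ : _ <= a * t)%R) ?ler_peMr ?(ltW a0)//.
    by rewrite (lt_le_trans atb)// ler_peMr// ltW.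
  have lnat : ln (a * t) = (ln b - x)%R by rewrite atE lnM ?posrE ?expR_gt0// expRK.
  have lna : ln a = (ln b - x - ln t)%R by rewrite -lnat lnM ?posrE// addrK.
  have E1 := integral_test_fun a0 abt.
  have E2 := integral_test_fun (mulr_gt0 a0 t0) atb.
  have := Hm (measurable_test_fun a (b * t)) (test_fun_ge0 a (b * t)).
  rewrite E1 ltry => /(_ erefl) H.
  have L : (l `^ r)%:E * \int[dV]_(w in siegel) (test_fun (a * t) b w `^ r)%:E <=
      \int[dV]_(z in siegel) avg (test_fun a (b * t)) z `^ r.
    have mT : measurable_fun setT (fun w => (test_fun (a * t) b w `^ r)%:E).
      apply/measurable_EFinP.
      exact: (measurableT_comp (@measurable_powR R _) (measurable_test_fun _ _)).
    rewrite -ge0_integralZl; [|exact: measurable_siegel| | |]; last 3 first.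
    - exact: measurable_funTS.
    - by move=> w _; rewrite lee_fin powR_ge0.
    - by rewrite lee_fin powR_ge0.
    apply: ge0_le_integral; first exact: measurable_siegel.
    - by move=> w _; rewrite -EFinM lee_fin mulr_ge0// powR_ge0.
    - by apply: measurable_funTS; apply: emeasurable_funM => //; exact: measurable_cst.
    - apply: measurable_funTS; apply: (measurableT_comp (measurable_poweR r)).
      by apply: measurable_avg; [exact: measurable_test_fun|exact: test_fun_ge0].
    move=> z _; rewrite -EFinM -powRM ?test_fun_ge0// -poweR_EFin.
    apply: (gt0_ler_poweR (ltW r0)); rewrite ?in_itv/= ?leey ?andbT.
    - by rewrite lee_fin mulr_ge0// test_fun_ge0.
    - by apply: avg_ge0; exact: test_fun_ge0.
    - rewrite mulrC EFinM /l fineK//; apply: avg_test_fun_ge => //.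
        by rewrite (ltW d0).
      by rewrite bE.
  have := le_trans L H; rewrite E2 -!EFinM lee_fin lnat lna lnM ?posrE//.
  rewrite mulrCA [leRHS]mulrCA ler_pM2l//.
  by congr (_ * _ <= _ * _)%R; ring.
have lm : (l `^ r <= m `^ r)%R.
  rewrite leNgt; apply/negP => ml; have e0 : (0 < l `^ r - m `^ r)%R by rewrite subr_gt0.
  have c0 : (0 <= m `^ r * (2 * ln t))%R by rewrite !mulr_ge0 ?powR_ge0// ln_ge0.
  have x0 : (0 < (m `^ r * (2 * ln t) + 1) / (l `^ r - m `^ r))%R.
    by rewrite divr_gt0// ltr_pwDr.
  have := key _ x0; rewrite [(m `^ r * (_ / _ + _))%R]mulrDr -lerBlDl -mulrBl mulrC divfK ?gt_eqF//.
  by lra.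
rewrite leNgt; apply/negP => ml.
by have := gt0_ltr_powR r0 m0 l0 ml; rewrite ltNge lm.
Qed.

(** Monotone convergence of [gain t d] as [t] tends to infinity and [d] to 0. *)
Lemma berezin_norm_le : (berezin_norm n r <= m)%R.
Proof.
(* t = k + 1 and d = 1 / (k + 1). *)
pose g k (y : heis * measurableTypeR R) := (damped k.+1%:R k.+1%:R^-1 y)%:E.
have h0 k : (0 <= k.+1%:R^-1 :> R)%R by rewrite invr_ge0.
have mg k : measurable_fun setT (g k) by apply/measurable_EFinP; exact: measurable_damped.
have g0 k y : setT y -> 0 <= g k y by move=> _; rewrite lee_fin damped_ge0.
have ndg y : setT y -> {homo g^~ y : k k' / (k <= k')%N >-> k <= k'}.
  move=> _ k k' kk; rewrite lee_fin /damped ler_wpM2l ?mulr_ge0 ?qker_ge0 ?powR_ge0//.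
  have kkR : (k.+1%:R <= k'.+1%:R :> R)%R by rewrite ler_nat.
  have kkV : (k'.+1%:R^-1 <= k.+1%:R^-1 :> R)%R by rewrite lef_pV2 ?posrE.
  case: ifPn => [/andP[ky yk]|_]; last by case: ifP => // _; exact/ltW/damp_gt0.
  by rewrite (le_trans kkV ky) (le_trans yk kkR) /=; exact: le_damp.
have := @cvg_monotone_convergence _ _ _ haarR _ measurableT _ mg g0 ndg.
have limg y : limn (g^~ y) = (qker y * y.2 `^ (- r^-1))%:E.
  apply/cvg_lim => //.
  have [y0|y0] := ltP 0%R y.2; last first.
    rewrite (_ : g^~ y = cst (qker y * y.2 `^ (- r^-1))%:E); first exact: cvg_cst.
    by apply/funext => k; rewrite /g /damped /qker ltNge y0 /= !mul0r.
  apply/cvg_EFin; first by near=> k.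
  have dl : damp k.+1%:R^-1 y.1 @[k --> \oo] --> (1 : R)%R.
    have e0 : damp 0%R y.1 = 1%R by rewrite /damp mulr0 mul0r addr0 expr1n invr1.
    have := cvg_comp _ _ (@cvg_harmonic R) (@continuous_damp0 R n y.1).
    by rewrite /= e0.
  apply: (@cvg_trans _ ((qker y * y.2 `^ (- r^-1) * damp k.+1%:R^-1 y.1)%R @[k --> \oo])).
    apply: near_eq_cvg; near=> k; rewrite /g /damped /= ifT//; apply/andP; split.
      rewrite ltW//; near: k; exact: (near_infty_natSinv_lt (PosNum y0)).
    have : (y.2 <= k%:R)%R by near: k; exact: nbhs_infty_ger.
    by move=> /le_trans; apply; rewrite ler_nat.
  by have H := cvgM (cvg_cst (qker y * y.2 `^ (- r^-1))%R) dl; rewrite mulr1 in H; exact: H.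
under [X in _ --> X -> _]eq_integral do rewrite limg.
rewrite integral_qker_powR// => gc.
rewrite -lee_fin; apply: (cvge_to_le gc); near=> k; apply: gain_le; first by rewrite ler1n.
by rewrite invr_gt0 ltr0n /= invf_le1// ler1n.
Unshelve. all: by end_near. Qed.

End lower_bound.

(** * Operator norms *)

Section operator_norms.
Variables (R : realType) (n : nat).
Notation heis := (heis R n).
Notation cspace := (cspace R n).
Notation siegel := (@siegel R n).
Notation dV := (dV R n).
Notation berezin := (@berezin R n).
Implicit Types f : cspace -> R[i].
Local Open Scope ereal_scope.

Lemma patch_modulus f : (fun z => (complex.Re `|f z|)%:E) \_ siegel = EFin \o modulus f.
Proof.
apply/funext => z; rewrite patchE /modulus /on_siegel [(EFin \o _) z]/=.
case: ifPn; first by rewrite inE siegelE Re_norm => ->.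
by rewrite notin_setE siegelE => /negP/negbTE ->.
Qed.

Lemma Lpnorm_ge0 p f : 0 <= Lpnorm p f.
Proof. exact: Lnorm_ge0. Qed.

Lemma Lpnorm_powR (r : R) f : (0 < r)%R ->
  Lpnorm r%:E f `^ r = \int[dV]_(z in siegel) (modulus f z `^ r)%:E.
Proof.
move=> r0; rewrite /Lpnorm patch_modulus poweR_Lnorm; last by rewrite gt_eqF.
rewrite [RHS]integral_mkcond.
apply: eq_integral => z _; rewrite patchE /=; case: ifPn.
  by rewrite ger0_norm// modulus_ge0.
rewrite notin_setE siegelE => /negP/negbTE z0.
by rewrite /modulus /on_siegel z0 normr0 powR0// gt_eqF.
Qed.

Lemma Lpnorm_root (r : R) f : (0 < r)%R ->
  Lpnorm r%:E f = (\int[dV]_(z in siegel) (modulus f z `^ r)%:E) `^ r^-1.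
Proof.
move=> r0; rewrite -Lpnorm_powR// -poweRrM mulfV ?gt_eqF// poweRe1//.
exact: Lpnorm_ge0.
Qed.

Lemma Lpnorm_le_powR (r : R) f (c : \bar R) : (0 < r)%R -> 0 <= c ->
  (Lpnorm r%:E f <= c) = (\int[dV]_(z in siegel) (modulus f z `^ r)%:E <= c `^ r).
Proof.
move=> r0 c0; rewrite -Lpnorm_powR//; apply/idP/idP => h.
  by apply: (gt0_ler_poweR (ltW r0)); rewrite ?in_itv/= ?leey ?andbT ?Lpnorm_ge0.
have := Lpnorm_ge0 r%:E f => N0.
have ri : (0 <= r^-1)%R by rewrite invr_ge0 ltW.
have := gt0_ler_poweR ri _ _ h; rewrite -!poweRrM mulfV ?gt_eqF// !poweRe1//.
by apply; rewrite in_itv/= leey ?andbT poweR_ge0.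
Qed.

Lemma Lpnorm_lty (r : R) f : (0 < r)%R -> Lpnorm r%:E f < +oo ->
  \int[dV]_(z in siegel) (modulus f z `^ r)%:E < +oo.
Proof. by move=> r0 foo; rewrite -Lpnorm_powR//; exact: poweR_lty. Qed.

Lemma integral_modulus_berezin_le (r : R) f : (1 < r)%R -> Lp r%:E f ->
  \int[dV]_(z in siegel) (modulus (berezin f) z `^ r)%:E <=
  \int[dV]_(z in siegel) avg (modulus f) z `^ r.
Proof.
move=> r1 [mf foo]; have r0 := lt_trans ltr01 r1.
have mm := measurable_modulus mf; have m0 := @modulus_ge0 R n f.
apply: ge0_le_integral; first exact: measurable_siegel.
- by move=> z _; rewrite lee_fin powR_ge0.
- apply: measurable_funTS; apply/measurable_EFinP.
  apply: (measurableT_comp (@measurable_powR R _)).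
  by apply: measurable_modulus; exact: measurable_berezin.
- by apply: measurable_funTS; exact: (measurableT_comp (measurable_poweR r) (measurable_avg mm m0)).
move=> z zs; rewrite -poweR_EFin.
apply: (gt0_ler_poweR (ltW r0)); rewrite ?in_itv/= ?leey ?andbT ?lee_fin ?modulus_ge0 ?avg_ge0//.
apply: modulus_berezin_le => //; apply: (avg_le_Lp r1) => //.
exact: Lpnorm_lty.
Qed.

Lemma Lp_berezin (r : R) f : (1 < r)%R -> Lp r%:E f ->
  (forall z, siegel z -> berezin_cvg f z) /\
  Lpnorm r%:E (berezin f) <= (berezin_norm n r)%:E * Lpnorm r%:E f.
Proof.
move=> r1 Lf; have [mf foo] := Lf; have r0 := lt_trans ltr01 r1.
have mm := measurable_modulus mf; have m0 := @modulus_ge0 R n f.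
split.
  move=> z zs; apply: berezin_cvg_avg => //; apply: (avg_le_Lp r1) => //.
  exact: Lpnorm_lty.
have b0 := berezin_norm_ge0 n r1.
rewrite Lpnorm_le_powR ?mule_ge0 ?lee_fin ?Lpnorm_ge0//.
apply: (le_trans (integral_modulus_berezin_le r1 Lf)).
by rewrite poweRM ?lee_fin ?Lpnorm_ge0// Lpnorm_powR// poweR_EFin le_integral_avg.
Qed.

Lemma modulus_berezin_real (F : cspace -> R) z : siegel z -> measurable_fun setT F ->
  (forall w, 0 <= F w)%R -> avg F z < +oo ->
  (modulus (berezin (fun w => ((F w)%:C)%C)) z)%:E = avg F z.
Proof.
move=> zs mF F0 Foo; rewrite /modulus on_siegelT// berezinE//=.
have -> : (\int[dV]_(w in siegel) (bkernel z w * 0))%R = 0%R.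
  by rewrite /Rintegral; under eq_integral do rewrite mulr0; rewrite integral0.
rewrite cabs_real /Rintegral avgE// ?fine_ge0 ?avg_ge0//.
by rewrite fineK// ge0_fin_numE// avg_ge0.
Qed.

Lemma measurable_real_complex (F : cspace -> R) : measurable_fun setT F ->
  measurable_fun siegel (fun w => ((F w)%:C)%C).
Proof. by move=> mF; apply: measurable_funTS; exact: measurable_mkcomplex. Qed.

Lemma integral_modulus_real (r : R) (F : cspace -> R) : (forall w, 0 <= F w)%R ->
  \int[dV]_(z in siegel) (modulus (fun w => ((F w)%:C)%C) z `^ r)%:E =
  \int[dV]_(z in siegel) (F z `^ r)%:E.
Proof.
move=> F0; apply: eq_integral => z; rewrite inE => zs.
by rewrite /modulus on_siegelT// cabs_real.
Qed.

Lemma avg_scale (c : R) (F : cspace -> R) z : (0 <= c)%R -> measurable_fun setT F ->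
  (forall w, 0 <= F w)%R -> avg (fun w => c * F w)%R z = c%:E * avg F z.
Proof.
move=> c0 mF F0; rewrite /avg -ge0_integralZl; [|exact: measurableT| | |].
- by apply: eq_integral => y _; rewrite -EFinM mulrCA.
- apply/measurable_EFinP; apply: measurable_funM; first exact: measurable_qker.
  by apply: (measurableT_comp mF); exact: measurable_fun_act.
- by move=> y _; rewrite lee_fin mulr_ge0// qker_ge0.
- by rewrite lee_fin.
Qed.

(** A bound on the operator norm, freed from the normalisation of the functions. *)
Lemma opnorm_avg (r m : R) (F : cspace -> R) : (1 < r)%R -> (0 <= m)%R ->
  opnorm r%:E berezin <= m%:E -> measurable_fun setT F -> (forall w, 0 <= F w)%R ->
  \int[dV]_(w in siegel) (F w `^ r)%:E < +oo ->
  \int[dV]_(z in siegel) avg F z `^ r <= (m `^ r)%:E * \int[dV]_(w in siegel) (F w `^ r)%:E.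
Proof.
move=> r1 m0 opm mF F0 Foo; have r0 := lt_trans ltr01 r1.
set I := \int[dV]_(w in siegel) (F w `^ r)%:E.
have I0 : 0 <= I by apply: integral_ge0 => z _; rewrite lee_fin powR_ge0.
have Ifin : I \is a fin_num by rewrite ge0_fin_numE.
(* A null function cannot be normalised; the upper bound covers it. *)
have [IE|In0] := eqVneq I 0.
  by have := le_integral_avg r1 mF F0; rewrite -/I IE !mule0.
have iE : I = (fine I)%:E by rewrite fineK.
set N := fine I in iE.
have N0 : (0 < N)%R by rewrite lt_def fine_ge0// andbT; apply: contra In0 => /eqP N0; rewrite iE -/N N0.
pose c := (N `^ (- r^-1))%R.
have c0 : (0 < c)%R by rewrite powR_gt0.
have cr : (c `^ r = N^-1)%R.
  by rewrite /c -powRrM mulNr mulVf ?gt_eqF// powR_inv1// ltW.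
pose G w := (c * F w)%R; pose g w := ((G w)%:C)%C.
have G0 w : (0 <= G w)%R by rewrite mulr_ge0// ltW.
have mG : measurable_fun setT G by exact: measurable_funM.
have IG : \int[dV]_(w in siegel) (G w `^ r)%:E = 1.
  under eq_integral do rewrite powRM ?(ltW c0)// EFinM.
  rewrite ge0_integralZl; [|exact: measurable_siegel| | |]; last 3 first.
  - apply/measurable_EFinP; apply: measurable_funTS.
    exact: (measurableT_comp (@measurable_powR R _) mF).
  - by move=> w _; rewrite lee_fin powR_ge0.
  - by rewrite lee_fin powR_ge0.
  by rewrite -/I iE cr -EFinM mulVf ?gt_eqF.
have Ng : Lpnorm r%:E g = 1 by rewrite Lpnorm_root// integral_modulus_real// IG poweR1r.
have Lg : Lp r%:E g by split; [exact: measurable_real_complex|rewrite Ng ltry].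
have : Lpnorm r%:E (berezin g) <= m%:E.
  by apply: le_trans opm; apply: ereal_sup_ubound; exists g => //; split; rewrite ?Ng.
rewrite Lpnorm_le_powR ?lee_fin// => H.
have E : \int[dV]_(z in siegel) (modulus (berezin g) z `^ r)%:E =
    (c `^ r)%:E * \int[dV]_(z in siegel) avg F z `^ r.
  rewrite -ge0_integralZl; [|exact: measurable_siegel| | |]; last 3 first.
  - by apply: measurable_funTS; exact: (measurableT_comp (measurable_poweR r) (measurable_avg mF F0)).
  - by move=> z _; exact: poweR_ge0.
  - by rewrite lee_fin powR_ge0.
  apply: eq_integral => z; rewrite inE => zs.
  have Fz : avg F z < +oo by exact: avg_le_Lp Foo.
  have Gz : avg G z < +oo by rewrite avg_scale ?(ltW c0)// lte_mul_pinfty// lee_fin ltW.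
  rewrite -poweR_EFin /g modulus_berezin_real// avg_scale ?(ltW c0)// poweRM ?lee_fin ?(ltW c0) ?avg_ge0//.
rewrite E cr in H.
have NN0 : (0 <= N)%R by rewrite ltW.
have := lee_wpmul2l (_ : 0 <= N%:E) H; rewrite lee_fin => /(_ NN0).
by rewrite muleA -EFinM mulfV ?gt_eqF// mul1e muleC iE poweR_EFin.
Qed.

Lemma opnorm_real (r : R) : (1 < r)%R -> opnorm r%:E berezin = (berezin_norm n r)%:E.
Proof.
move=> r1; have r0 := lt_trans ltr01 r1; have b0 := berezin_norm_ge0 n r1.
have ub : opnorm r%:E berezin <= (berezin_norm n r)%:E.
  apply: ub_ereal_sup => _ [f [Lf f1] <-].
  apply: (le_trans (Lp_berezin r1 Lf).2).
  by rewrite -[leRHS]mule1 lee_wpmul2l// lee_fin.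
apply/eqP; rewrite eq_le ub /=.
have lb : 0 <= opnorm r%:E berezin.
  apply: (@le_trans _ _ (Lpnorm r%:E (berezin (cst 0%R)))); first exact: Lpnorm_ge0.
  apply: ereal_sup_ubound; exists (cst 0%R) => //.
  have N0 : Lpnorm r%:E (cst 0%R : cspace -> R[i]) = 0.
    rewrite Lpnorm_root//.
    rewrite (_ : \int[dV]_(z in siegel) _ = 0) ?poweR0r ?invr_eq0 ?gt_eqF//.
    rewrite (integral_modulus_real r (F := cst 0%R))//.
    under eq_integral do rewrite /= powR0 ?gt_eqF//.
    exact: integral0.
  split; rewrite ?N0//; split; rewrite ?N0 ?ltry//.
have ofin : opnorm r%:E berezin \is a fin_num by rewrite ge0_fin_numE// (le_lt_trans ub)// ltry.
rewrite -(fineK ofin) lee_fin; apply: (@berezin_norm_le R n r r1 _ (fine_ge0 lb)) => F mF F0 Foo.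
by apply: opnorm_avg => //; rewrite ?fine_ge0// fineK.
Qed.

(** If the whole space were null, the function 1 would vanish almost everywhere and so
    would its average, which is 1. *)
Lemma dV_gt0 : 0 < dV setT.
Proof.
rewrite lt0e measure_ge0 andbT; apply/eqP => V0.
pose z : cspace := chart (([tuple 0%R | _ < n], 0%R) : heis) 1%R.
have zs : siegel z by rewrite siegelE height_chart.
have := @avg_le_sup R n 0%R (cst 1%R) z (lexx _) zs (measurable_cst _) (fun _ => ler01).
rewrite integral_avg1 => /(_ _)/wrap[]; last by rewrite lee_fin ler10.
by exists setT; split.
Qed.

Lemma Lpnorm_oo f : Lpnorm +oo f = ess_sup dV (EFin \o modulus f).
Proof.
rewrite /Lpnorm patch_modulus unlock dV_gt0; congr (ess_sup dV _).
by apply/funext => z /=; rewrite ger0_norm// modulus_ge0.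
Qed.

Lemma berezin_oo f : Lp +oo f ->
  (forall z, siegel z -> berezin_cvg f z) /\ Lpnorm +oo (berezin f) <= Lpnorm +oo f.
Proof.
move=> [mf foo]; have N0 := Lpnorm_ge0 +oo f.
have Nfin : Lpnorm +oo f \is a fin_num by rewrite ge0_fin_numE.
have M0 := fine_ge0 N0.
have mm := measurable_modulus mf; have m0 := @modulus_ge0 R n f.
have fM : \forall w \ae dV, siegel w -> (modulus f w <= fine (Lpnorm +oo f))%R.
  have := ess_sup_ge dV (EFin \o modulus f); rewrite -Lpnorm_oo; apply: filterS => w.
  by rewrite -{1}(fineK Nfin) lee_fin.
have aM z : siegel z -> avg (modulus f) z <= (fine (Lpnorm +oo f))%:E.
  by move=> zs; apply: avg_le_sup.
have aoo z : siegel z -> avg (modulus f) z < +oo.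
  by move=> zs; rewrite (le_lt_trans (aM z zs))// ltry.
split; first by move=> z zs; apply: berezin_cvg_avg => //; exact: aoo.
rewrite [leLHS]Lpnorm_oo; apply/ess_supP/nearW => z /=.
have [zs|zs] := pselect (siegel z).
  rewrite -[leRHS](fineK Nfin); apply: le_trans (aM z zs).
  by apply: modulus_berezin_le => //; exact: aoo.
by rewrite /modulus /on_siegel; move: zs; rewrite siegelE => /negP/negbTE ->.
Qed.

(** The constant 1 is a fixed point. *)
Lemma opnorm_oo : opnorm +oo berezin = 1.
Proof.
apply/eqP; rewrite eq_le; apply/andP; split.
  by apply: ub_ereal_sup => _ [f [Lf f1] <-]; exact: le_trans (berezin_oo Lf).2 f1.
pose f (w : cspace) : R[i] := (1%:C)%C.
have m1 : measurable_fun setT (cst 1%R : cspace -> R) by exact: measurable_cst.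
have Bf z : siegel z -> modulus (berezin f) z = 1%R.
  move=> zs; apply: EFin_inj.
  by rewrite (modulus_berezin_real zs m1)// integral_avg1// ltry.
have f1 : Lpnorm +oo f <= 1.
  rewrite Lpnorm_oo; apply/ess_supP/nearW => z /=.
  rewrite lee_fin /modulus /on_siegel; case: ifP => // _.
  by rewrite /f cabs_real.
have Lf : Lp +oo f.
  by split; [exact: measurable_real_complex m1|rewrite (le_lt_trans f1)// ltry].
apply: (@le_trans _ _ (Lpnorm +oo (berezin f))); last first.
  by apply: ereal_sup_ubound; exists f.
have N0 := Lpnorm_ge0 +oo (berezin f).
have Nfin : Lpnorm +oo (berezin f) \is a fin_num.
  by rewrite ge0_fin_numE// (le_lt_trans (berezin_oo Lf).2)// (le_lt_trans f1)// ltry.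
have fM : \forall w \ae dV, siegel w ->
    (modulus (berezin f) w <= fine (Lpnorm +oo (berezin f)))%R.
  have := ess_sup_ge dV (EFin \o modulus (berezin f)); rewrite -Lpnorm_oo; apply: filterS => w.
  by rewrite -{1}(fineK Nfin) lee_fin.
pose z : cspace := chart (([tuple 0%R | _ < n], 0%R) : heis) 1%R.
have zs : siegel z by rewrite siegelE height_chart.
have mm : measurable_fun setT (modulus (berezin f)).
  by apply: measurable_modulus; apply: measurable_berezin; case: Lf.
have m0 := @modulus_ge0 R n (berezin f).
have := avg_le_sup (fine_ge0 N0) zs mm m0 fM.
rewrite fineK// => /(le_trans _); apply.
rewrite -(@integral_avg1 R n z) -!avgE// le_eqVlt; apply/orP; left; apply/eqP.
by apply: eq_integral => w; rewrite inE => ws; rewrite Bf.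
Qed.

End operator_norms.

Theorem corollary3 (R : realType) (n : nat) (p : \bar R) (hp : (1 < p)%E) :
  (forall f : cspace R n -> R[i], Lp p f ->
    (forall z, siegel z -> berezin_cvg f z) /\ Lp p (@berezin R n f)) /\
  opnorm p (@berezin R n) =
    (if p is r%:E then
       pi / (r * sin (pi / r)) * \prod_(1 <= k < n.+2) (1 + 1 / (k%:R * r))
     else 1)%:E.
Proof.
case: p hp => [r| |] //= hp.
  have r1 : 1 < r by rewrite -lte_fin.
  split; last exact: opnorm_real.
  move=> f Lf; have [cf nf] := Lp_berezin r1 Lf; split => //.
  case: Lf => mf foo; split; first exact: measurable_berezin.
  rewrite (le_lt_trans nf)// lte_mul_pinfty// lee_fin; exact: berezin_norm_ge0.
split; last exact: opnorm_oo.
move=> f Lf; have [cf nf] := berezin_oo Lf; split => //.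
case: Lf => mf foo; split; first exact: measurable_berezin.
exact: le_lt_trans nf foo.
Qed.
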